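(* Let $n\geq 2$ and let $\Omega\subset\mathbb{R}^n$ be a nonempty bounded domain. The problem $(\mathrm{div})_\infty$ is solvable in $\Omega$ if and only if $d_\Omega\in L^1(\Omega)$.
   Context: A domain is a connected open set; no regularity of $\partial\Omega$ is assumed. Geodesic distance: for $x,y\in\Omega$, $\mathrm{dist}_\Omega(y,x)=\inf l(\gamma)$, the infimum being over all rectifiable paths $\gamma:[0,1]\to\Omega$ with $\gamma(0)=y$, $\gamma(1)=x$, where $l(\gamma)$ is the (Euclidean) length of $\gamma$. A reference point $x_0\in\Omega$ is fixed once and for all, and $d_\Omega(y):=\mathrm{dist}_\Omega(y,x_0)$. (Integrability of $d_\Omega$ over $\Omega$ does not depend on the choice of $x_0$.) The problem $(\mathrm{div})_\infty$ is said to be solvable in $\Omega$ if there exists a weight $w>0$ (a positive measurable function) on $\Omega$ such that: (i) $w\in L^1(\Omega)$; (ii) there is a constant $C>0$, depending only on $\Omega$ and $w$, such that for each $f\in L^\infty(\Omega)$ with $\int_\Omega f(x)\,dx=0$ there exists a vector-valued function $u:\Omega\to\mathbb{R}^n$ which is a solution of $$\mathrm{div}\,u=f\ \text{ in }\Omega,\qquad u\cdot\nu=0\ \text{ on }\partial\Omega,$$ and satisfies $\left\Vert \frac1w u\right\Vert_\infty\leq C\Vert f\Vert_\infty$. Here ''$u$ is a solution'' means, by definition, that $$\int_\Omega u\cdot\nabla g=-\int_\Omega fg$$ for all $g\in E$, where $E$ is the space of functions $g\in L^1(\Omega)$ whose distributional gradient is a function and such that $\Vert g\Vert_E=\int_\Omega|g|+\int_\Omega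 w\,|\nabla g|<+\infty$. *)

(* Defs.v *)
From HB Require Import structures.
From mathcomp Require Import all_boot all_order all_algebra.
From mathcomp Require Import all_classical all_reals all_analysis.
From mathcomp Require Import measurable_realfun ess_sup_inf.

Set Implicit Arguments.
Unset Strict Implicit.
Unset Printing Implicit Defensive.
Import Order.TTheory GRing.Theory Num.Theory.
Import numFieldNormedType.Exports.

Local Open Scope classical_set_scope.
Local Open Scope ring_scope.

Definition measure_rV_display : measure_display.
Proof. exact: default_measure_display. Qed.

(* 'rV[R]_n carries the product sigma-algebra, i.e. the one generated by the
   coordinates, which is the Borel one (see open_measurable_rV); so "measurable"
   means Borel measurable here, as for the library's lebesgue_measure on R.
   Any Lebesgue measurable function agrees a.e. with a Borel one. *)
Section measurable_rV.
Variables (R : realType) (n : nat).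

Let coors : 'I_n -> 'rV[R]_n -> R := fun i x => x ord0 i.

Let rV_set0 : g_sigma_preimage coors set0.
Proof. exact: sigma_algebra0. Qed.

Let rV_setC A : g_sigma_preimage coors A -> g_sigma_preimage coors (~` A).
Proof. exact: sigma_algebraC. Qed.

Let rV_bigcup (F : _^nat) : (forall i, g_sigma_preimage coors (F i)) ->
  g_sigma_preimage coors (\bigcup_i (F i)).
Proof. exact: sigma_algebra_bigcup. Qed.

HB.instance Definition _ := @isMeasurable.Build measure_rV_display
  'rV[R]_n (g_sigma_preimage coors) rV_set0 rV_setC rV_bigcup.

End measurable_rV.

Section measurable_rV_theory.
Variable R : realType.

Lemma measurable_rV_coord n (i : 'I_n) :
  measurable_fun [set: 'rV[R]_n] (fun x : 'rV[R]_n => x ord0 i).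
Proof.
move=> _ Y mY; rewrite setTI; apply: sub_sigma_algebra => /=.
rewrite -bigcup_seq/=; exists i => /=; first by rewrite mem_index_enum.
by exists Y => //; rewrite setTI.
Qed.

Lemma measurable_fun_rV d (T : measurableType d) n (f : T -> 'rV[R]_n) :
  (forall i, measurable_fun [set: T] (fun t => f t ord0 i)) ->
  measurable_fun [set: T] f.
Proof.
move=> mf _ A mA; rewrite setTI.
move: A mA; apply: smallest_sub.
  split => /=.
  - by rewrite preimage_set0.
  - by move=> A /= mA; rewrite setTD preimage_setC; exact: measurableC.
  - by move=> F mF /=; rewrite preimage_bigcup; exact: bigcup_measurable.
move=> A; rewrite -bigcup_seq/= => -[i _ [Y mY <-]] /=.
by rewrite setTI -[X in measurable X]setTI; exact: mf.
Qed.

Lemma open_measurable_rV n (U : set 'rV[R]_n) : open U -> measurable U.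
Proof.
move=> oU.
pose q2r (q : 'rV[rat]_n) : 'rV[R]_n := \row_i ratr (q ord0 i).
pose B (p : 'rV[rat]_n * nat) : set 'rV[R]_n := ball (q2r p.1) (p.2.+1%:R^-1).
have mB p : measurable (B p).
  have -> : B p = \bigcap_(i : 'I_n)
      ((fun x : 'rV[R]_n => x ord0 i) @^-1` ball (q2r p.1 ord0 i) p.2.+1%:R^-1).
    apply/seteqP; split => x /=.
      by move=> [_ xB] i _; exact: xB.
    by move=> xB; split; [by rewrite invr_gt0|]; move=> i j; rewrite ord1; exact: xB.
  rewrite bigcap_mkcond; apply: fin_bigcap_measurable; first exact: finite_finset.
  move=> i _; rewrite mem_setT -[X in measurable X]setTI.
  by apply: measurable_rV_coord => //; apply: open_measurable; exact: ball_open.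
have -> : U = \bigcup_(p in [set p | B p `<=` U]) B p.
  apply/seteqP; split => [x Ux|x [p /= BU Bx]]; last exact: BU.
  have /nbhs_ballP[e /= e0 eU] : nbhs x U by exact: open_nbhs_nbhs.
  have [k ke] : exists k : nat, k.+1%:R^-1 < e / 2.
    pose k := Num.truncn (e / 2)^-1; exists k.
    rewrite invf_plt ?posrE ?divr_gt0//.
    by rewrite truncnS_gt.
  have k0 : (0 : R) < k.+1%:R^-1 by rewrite invr_gt0.
  have /choice[q qP] : forall i, exists q : rat, `|x ord0 i - ratr q| < k.+1%:R^-1.
    move=> i; have := @dense_rat R (ball (x ord0 i) k.+1%:R^-1).
    case.
    - by exists (x ord0 i); exact: ballxx.
    - exact: ball_open.
    - by move=> z [+ [q _ qz]]; rewrite -qz -ball_normE/= => ?; exists q.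
  exists (\row_i q i, k).
    move=> y [_ yB]; apply: eU; split => // i j; rewrite ord1.
    have := yB ord0 j; rewrite -!ball_normE/= !mxE => yj.
    rewrite (splitr e).
    rewrite (le_lt_trans (ler_distD (ratr (q j)) _ _))// ltrD//.
      by rewrite (lt_trans (qP j)).
    exact: lt_trans ke.
  split => //= i j; rewrite ord1 -ball_normE/= !mxE distrC; exact: qP.
rewrite bigcup_mkcond; apply: countable_bigcupT_measurable => // p.
by case: ifPn.
Qed.

End measurable_rV_theory.

Definition rV_cons (R : realType) n (p : R * 'rV[R]_n) : 'rV[R]_n.+1 :=
  row_mx p.1%:M p.2.

Lemma rV_cons0 (R : realType) n (p : R * 'rV[R]_n) : rV_cons p ord0 ord0 = p.1.
Proof.
by rewrite mxE; case: splitP => // j _; rewrite mxE !ord1 eqxx.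
Qed.

Lemma rV_consS (R : realType) n (p : R * 'rV[R]_n) (i : 'I_n) :
  rV_cons p ord0 (lift ord0 i) = p.2 ord0 i.
Proof.
rewrite mxE; case: splitP => j /=; first by rewrite ord1.
by rewrite !add1n => -[/val_inj->].
Qed.

Lemma measurable_rV_cons (R : realType) n :
  measurable_fun [set: R * 'rV[R]_n] (@rV_cons R n).
Proof.
apply: measurable_fun_rV => i.
have [j ->|->] := unliftP ord0 i.
  under eq_fun do rewrite rV_consS.
  exact: measurableT_comp (measurable_rV_coord j) measurable_snd.
under eq_fun do rewrite rV_cons0.
exact: measurable_fst.
Qed.

(* n-dimensional Lebesgue measure, as the product of n copies of the Lebesgue
   measure on R; lebesgue_rV_box characterizes it. *)
Fixpoint lebesgue_rV (R : realType) (n : nat) : set 'rV[R]_n -> \bar R :=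
  match n with
  | 0%N => @dirac _ 'rV[R]_0 0 R
  | m.+1 => pushforward (@lebesgue_measure R \x @lebesgue_rV R m)%E
              (@rV_cons R m)
  end.
Arguments lebesgue_rV {R} n.

Section lebesgue_rV_measure.
Variable R : realType.
Local Open Scope ereal_scope.

Let lebesgue_rV_ex n : exists m : {sigma_finite_measure set 'rV[R]_n -> \bar R},
  lebesgue_rV n = m.
Proof.
elim: n => [|n [m mE]].
  by exists (@dirac _ 'rV[R]_0 0%R R).
pose g (x : 'rV[R]_n.+1) : R * 'rV[R]_n :=
  (x ord0 ord0, \row_i x ord0 (lift ord0 i))%R.
have mg : measurable_fun setT g.
  apply: measurable_fun_pair => /=; first exact: measurable_rV_coord.
  apply: measurable_fun_rV => i; under eq_fun do rewrite mxE.
  exact: measurable_rV_coord.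
have gK : cancel (@rV_cons R n) g.
  move=> [a v]; rewrite /g rV_cons0/=; congr pair.
  by apply/rowP => i; rewrite mxE rV_consS.
pose pushforward_cons mf : {measure set 'rV[R]_n.+1 -> \bar R} :=
  @measure_function_pushforward__canonical__measure_function_Measure _ _ _ _ _
    (@lebesgue_measure R \x m) (@rV_cons R n) mf.
pose p := pushforward_cons (@measurable_rV_cons R n).
have psf : sigma_finite setT p.
  have /sigma_finiteP[F [FT ndF Foo]] := sigma_finiteT (@lebesgue_measure R).
  have /sigma_finiteP[G [GT ndG Goo]] := sigma_finiteT m.
  exists (fun k => g @^-1` (F k `*` G k)).
    rewrite -preimage_bigcup (_ : \bigcup_k _ = setT) ?preimage_setT//.
    apply/seteqP; split => // -[a v] _.
    have : setT a by []. rewrite FT => -[i _ Fia].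
    have : setT v by []. rewrite GT => -[j _ Gjv].
    exists (maxn i j) => //; split => /=.
      by move: a Fia; exact/subsetPset/ndF/leq_maxl.
    by move: v Gjv; exact/subsetPset/ndG/leq_maxr.
  move=> k; have [mF Fk] := Foo k; have [mG Gk] := Goo k; split.
    by rewrite -[X in measurable X]setTI; apply: mg => //; exact: measurableX.
  rewrite /p /= /pushforward -comp_preimage.
  rewrite (_ : g \o _ = id) ?preimage_id; last by apply/funext => y /=; rewrite gK.
  by rewrite product_measure1E// lte_mul_pinfty// ge0_fin_numE.
exists (HB.pack_for {sigma_finite_measure set 'rV[R]_n.+1 -> \bar R}
  (Measure.sort p) (Measure.class p) (Measure_isSigmaFinite.Build _ _ _ p psf)).
by rewrite /= mE.
Qed.

Let lebesgue_rV0 n : lebesgue_rV n set0 = 0 :> \bar R.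
Proof. by have [m ->] := lebesgue_rV_ex n; exact: measure0. Qed.

Let lebesgue_rV_ge0 n A : 0 <= lebesgue_rV n A :> \bar R.
Proof. by have [m ->] := lebesgue_rV_ex n; exact: measure_ge0. Qed.

Let lebesgue_rV_sigma_additive n : semi_sigma_additive (@lebesgue_rV R n).
Proof.
by have [m ->] := lebesgue_rV_ex n; exact: measure_semi_sigma_additive.
Qed.

HB.instance Definition _ n := isMeasure.Build _ _ _ (@lebesgue_rV R n)
  (lebesgue_rV0 n) (@lebesgue_rV_ge0 n) (@lebesgue_rV_sigma_additive n).

Let lebesgue_rV_sigma_finite n : sigma_finite setT (@lebesgue_rV R n).
Proof. by have [m ->] := lebesgue_rV_ex n; exact: sigma_finiteT. Qed.

HB.instance Definition _ n := Measure_isSigmaFinite.Build _ _ _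
  (@lebesgue_rV R n) (@lebesgue_rV_sigma_finite n).

Lemma lebesgue_rV_box n (A : 'I_n -> set R) : (forall i, measurable (A i)) ->
  lebesgue_rV n [set x | forall i, A i (x ord0 i)] =
  \prod_(i < n) @lebesgue_measure R (A i).
Proof.
elim: n A => [|n ih] A mA.
  rewrite big_ord0 /= diracE mem_set//=.
  by move=> [].
rewrite big_ord_recl -ih// -product_measure1E//.
  rewrite /= /pushforward; congr product_measure1.
  apply/seteqP; split => -[a v] /=.
    move=> H; split => /=; first by have := H ord0; rewrite rV_cons0.
    by move=> i; have := H (lift ord0 i); rewrite rV_consS.
  move=> [/= Aa Av] i; have [j ->|->] := unliftP ord0 i.
    by rewrite rV_consS.
  by rewrite rV_cons0.
  exact: (mA ord0).
rewrite [X in measurable X](_ : _ = \bigcap_(i : 'I_n)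
    ((fun x : 'rV[R]_n => x ord0 i) @^-1` A (lift ord0 i))).
  apply: fin_bigcap_measurable; first exact: finite_finset.
  by move=> i _; rewrite -[X in measurable X]setTI; exact: measurable_rV_coord.
by apply/seteqP; split => x /= H i; [move=> _|]; exact: H.
Qed.

End lebesgue_rV_measure.

Section euclidean.
Variables (R : realType) (n : nat).
Implicit Types (u v : 'rV[R]_n).

Definition dotr u v : R := \sum_(i < n) u ord0 i * v ord0 i.

(* Euclidean norm; the library norm `|u| on 'rV[R]_n is the sup norm, which
   induces the same topology and the same bounded sets. *)
Definition enorm u : R := Num.sqrt (dotr u u).

End euclidean.

Section geodesic_distance.
Variables (R : realType) (n : nat).
Implicit Types (Omega : set 'rV[R]_n) (gamma : R -> 'rV[R]_n).

Definition domain Omega := open Omega /\ connected Omega.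

(* Euclidean analogue of variation / total_variation, for curves in R^n *)
Definition curve_variation (a b : R) gamma (s : seq R) : R :=
  let F := gamma \o nth b (a :: s) in
  \sum_(0 <= k < size s) enorm (F k.+1 - F k).

Definition curve_length (a b : R) gamma : \bar R :=
  ereal_sup [set (curve_variation a b gamma s)%:E | s in itv_partition a b].

Definition rectifiable_path Omega (y x : 'rV[R]_n) gamma :=
  [/\ {within `[0, 1], continuous gamma},
      gamma @` `[0, 1] `<=` Omega,
      gamma 0 = y, gamma 1 = x & (curve_length 0 1 gamma < +oo)%E].

Definition geodesic_dist Omega (y x : 'rV[R]_n) : \bar R :=
  ereal_inf [set curve_length 0 1 gamma | gamma in rectifiable_path Omega y x].

End geodesic_distance.

Section divergence.
Variables (R : realType) (n : nat).
Local Notation V := 'rV[R]_n.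
Local Notation mu := (@lebesgue_rV R n).
Implicit Types (Omega : set V) (f g w : V -> R) (u G : V -> V).

Definition partial (i : 'I_n) (phi : V -> R) : V -> R :=
  'D_(delta_mx ord0 i) phi.

(* foldr partial phi s ranges over the iterated partial derivatives of phi *)
Definition smooth (phi : V -> R) := forall s : seq 'I_n,
  continuous (foldr partial phi s) /\
  forall (i : 'I_n) (x : V),
    derivable (foldr partial phi s) x (delta_mx ord0 i).

Definition test_function Omega (phi : V -> R) :=
  [/\ smooth phi, compact (closure [set x | phi x != 0]) &
      closure [set x | phi x != 0] `<=` Omega].

Definition distributional_gradient Omega g G :=
  (* G is locally integrable *)
  [/\ measurable_fun Omega G,
      forall (K : set V) (i : 'I_n), compact K -> K `<=` Omega ->
        mu.-integrable K (fun x => (G x ord0 i)%:E) &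
      forall (phi : V -> R) (i : 'I_n), test_function Omega phi ->
        (\int[mu]_(x in Omega) (g x * partial i phi x)%:E =
         - \int[mu]_(x in Omega) (G x ord0 i * phi x)%:E)%E].

Definition E_norm Omega w g G : \bar R :=
  (\int[mu]_(x in Omega) `|(g x)%:E|
   + \int[mu]_(x in Omega) (w x * enorm (G x))%:E)%E.

(* g belongs to E, with distributional gradient G *)
Definition in_E Omega w g G :=
  [/\ mu.-integrable Omega (EFin \o g),
      distributional_gradient Omega g G &
      (E_norm Omega w g G < +oo)%E].

(* the L^oo(Omega) norm, as the norm over R^n of the extension by 0 *)
Definition Linfty_norm Omega f : \bar R :=
  ('N[mu]_+oo[EFin \o (f \_ Omega)])%E.

Definition in_Linfty Omega f :=
  measurable_fun Omega f /\ (Linfty_norm Omega f < +oo)%E.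

(* Weak form of div u = f in Omega, u . nu = 0 on the boundary. When
   |u| <= C w a.e. and f is in L^oo, as in div_infty_solvable, both integrals
   converge absolutely for g in E. *)
Definition div_solution Omega w f u :=
  measurable_fun Omega u /\
  forall g G, in_E Omega w g G ->
    (\int[mu]_(x in Omega) (dotr (u x) (G x))%:E =
     - \int[mu]_(x in Omega) (f x * g x)%:E)%E.

Definition div_infty_solvable Omega :=
  exists w : V -> R,
    [/\ measurable_fun Omega w,
        forall x, Omega x -> 0 < w x,
        mu.-integrable Omega (EFin \o w) &
        exists C : R, 0 < C /\
          forall f, in_Linfty Omega f ->
            (\int[mu]_(x in Omega) (f x)%:E = 0)%E ->
            exists u, div_solution Omega w f u /\
              (Linfty_norm Omega (fun x => enorm ((w x)^-1 *: u x)) <=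
               C%:E * Linfty_norm Omega f)%E].

End divergence.

(* Main.v *)
(* Necessity. Test a solution u, for the datum f equal to 1 minus a multiple of
   a bump near x0, against the truncations min (d_Omega) k. These are locally
   1-Lipschitz for the Euclidean distance, hence have gradients bounded
   independently of k, so that their integrals are bounded by a multiple of the
   integral of w; let k tend to infinity.

   Sufficiency. In a box, a bounded function F is moved to (int F) rho, where rho
   is a product of smooth bumps, by spreading it along one coordinate after the
   other; the cost int |u| of this is at most the size of the box times int |F|.
   Chaining small boxes along an almost shortest path from y to x0 moves a source
   located near y to a fixed bump near x0 at a cost proportional to its mass
   times d_Omega y + 1. Cut Omega into countably many small cells: a datum f of
   zero mean is the sum of its restrictions to the cells, whose contributions at
   x0 cancel, and the flows are dominated by norm f times a fixed weight, whose
   integral is controlled by that of d_Omega + 1. *)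
Require Import Defs.
From HB Require Import structures.
From mathcomp Require Import all_boot all_order all_algebra.
From mathcomp Require Import all_classical all_reals all_analysis.
From mathcomp Require Import measurable_realfun ess_sup_inf.
From mathcomp Require Import ring lra.

Set Implicit Arguments.
Unset Strict Implicit.
Unset Printing Implicit Defensive.
Import Order.TTheory GRing.Theory Num.Theory.
Import numFieldNormedType.Exports.

Local Open Scope classical_set_scope.
Local Open Scope ring_scope.

(** * Functionals on bounded functions *)

(** Solutions are tested against all of [E], about whose members only an integration by parts
    against smooth functions is known, whereas the data are merely bounded and measurable. Instead
    of mollifying the data, each identity is read as the vanishing of a functional of the datum that
    is linear and continuous under bounded pointwise convergence. On products of smooth bumps the
    coordinatewise flow is again a product of smooth functions, hence an admissible test function.
    This is why all kernels are products: the analysis proper takes place in one variable.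

    The weight has to be chosen before the datum. Each elementary transport therefore comes with a
    bound that is linear in a dominating density [H]; it is applied with [H] an indicator or a
    multiple of a bump, so that only a bound for the datum enters.

    In the other direction, the gradient of a Lipschitz function is needed only as a bounded
    function satisfying the weak identity; it is obtained by duality, without differentiability
    almost everywhere. *)

Section bounded_functions.
Context d (T : measurableType d) (R : realType).
Implicit Types (F G : T -> R) (Phi : (T -> R) -> R) (Q : set T).

(** The bound and the vanishing hold at every point, not almost everywhere, because these functions
    are later restricted to individual lines. *)
Definition bsupp Q F := [/\ measurable_fun setT F,
  exists M : R, forall x, `|F x| <= M & forall x, ~ Q x -> F x = 0].

Definition bounded_cvg Q (F_ : nat -> T -> R) F :=
  [/\ forall k, bsupp Q (F_ k), exists M : R, forall k x, `|F_ k x| <= M &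
      forall x, F_ ^~ x @ \oo --> F x].

(* A functional of this kind vanishes as soon as it vanishes on products of
   smooth bumps, which is how the identities below are extended to all bounded
   measurable functions. *)
Definition bcont Q Phi :=
  (forall a F G, bsupp Q F -> bsupp Q G ->
     Phi (fun x => a * F x + G x) = a * Phi F + Phi G) /\
  (forall (F_ : nat -> T -> R) F, bounded_cvg Q F_ F -> Phi (F_ n) @[n --> \oo] --> Phi F).

Lemma bsupp0 Q : bsupp Q (fun=> 0).
Proof. by split => //; exists 0 => x; rewrite normr0. Qed.

Lemma bsuppDZ Q a F G : bsupp Q F -> bsupp Q G ->
  bsupp Q (fun x => a * F x + G x).
Proof.
move=> [mF [M FM] F0] [mG [N GN] G0]; split.
- by apply: measurable_funD => //; exact: measurable_funM.
- exists (`|a| * M + N) => x; rewrite (le_trans (ler_normD _ _))// normrM.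
  by rewrite lerD// ler_wpM2l.
- by move=> x Qx; rewrite F0// G0// mulr0 addr0.
Qed.

Lemma bsuppZ Q a F : bsupp Q F -> bsupp Q (fun x => a * F x).
Proof.
move=> bF; have := bsuppDZ a bF (bsupp0 Q).
by under [X in bsupp _ X -> _]eq_fun do rewrite addr0.
Qed.

Lemma bsuppB Q F G : bsupp Q F -> bsupp Q G -> bsupp Q (fun x => F x - G x).
Proof.
move=> bF bG; have := bsuppDZ (-1) bG bF.
by under [X in bsupp _ X -> _]eq_fun do rewrite mulN1r addrC.
Qed.

Lemma bsupp_norm Q F : bsupp Q F -> bsupp Q (fun x => `|F x|).
Proof.
move=> [mF [M FM] F0]; split; first exact: measurableT_comp.
- by exists M => x; rewrite normr_id.
- by move=> x Qx; rewrite F0// normr0.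
Qed.

Lemma bsuppM Q F G : bsupp Q F -> measurable_fun setT G ->
  (exists M : R, forall x, `|G x| <= M) -> bsupp Q (fun x => G x * F x).
Proof.
move=> [mF [M FM] F0] mG [N GN]; split; first exact: measurable_funM.
- by exists (N * M) => x; rewrite normrM ler_pM.
- by move=> x Qx; rewrite F0// mulr0.
Qed.

Lemma bsuppS Q Q' F : Q `<=` Q' -> bsupp Q F -> bsupp Q' F.
Proof. by move=> QQ' [mF bF F0]; split => // x Qx; apply: F0 => /QQ'. Qed.

Lemma bsupp_indic Q A : measurable A -> A `<=` Q -> bsupp Q (\1_A : T -> R).
Proof.
move=> mA AQ; split; first exact: measurable_indic.
- by exists 1 => x; rewrite indicE; case: (x \in A); rewrite ?normr1 ?normr0.
- by move=> x Qx; rewrite indicE memNset// => /AQ.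
Qed.

Lemma bsupp_sum Q (I : Type) (r : seq I) (P : pred I) (F_ : I -> T -> R) :
  (forall i, bsupp Q (F_ i)) -> bsupp Q (fun x => \sum_(i <- r | P i) F_ i x).
Proof.
move=> bF; elim: r => [|i r ih].
  by under eq_fun do rewrite big_nil; exact: bsupp0.
under eq_fun do rewrite big_cons; case: (P i) => //.
by have := bsuppDZ 1 (bF i) ih; under [X in bsupp _ X -> _]eq_fun do rewrite mul1r.
Qed.

Lemma bounded_cvg_bsupp Q (F_ : nat -> T -> R) F :
  bounded_cvg Q F_ F -> bsupp Q F.
Proof.
move=> [bF [M FM] cF]; split.
- by apply: measurable_fun_cvg (fun k => let: And3 m _ _ := bF k in m) _ => x _; exact: cF.
- exists M => x; have : (fun k => `|F_ k x|) @ \oo --> `|F x| by apply: cvg_norm.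
  move=> /cvg_lim <- //; apply: limr_le.
    by apply: cvgP; apply: cvg_norm; exact: cF.
  by near=> k; exact: FM.
- move=> x Qx; have := cF x; rewrite (_ : F_ ^~ x = fun=> 0).
    by move=> /cvg_lim <-//; rewrite lim_cst.
  by apply/funext => k; case: (bF k) => _ _; exact.
Unshelve. all: by end_near.
Qed.

Lemma bcont0 Q Phi : bcont Q Phi -> Phi (fun=> 0) = 0.
Proof.
move=> [+ _] => /(_ (-1) _ _ (bsupp0 Q) (bsupp0 Q)).
by under eq_fun do rewrite mulr0 addr0; rewrite mulN1r addNr.
Qed.

Lemma bcontZ Q Phi a F : bcont Q Phi -> bsupp Q F ->
  Phi (fun x => a * F x) = a * Phi F.
Proof.
move=> bPhi bF; have [+ _] := bPhi => /(_ a _ _ bF (bsupp0 Q)).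
by under eq_fun do rewrite addr0; rewrite (bcont0 bPhi) addr0.
Qed.

Lemma bcontD Q Phi F G : bcont Q Phi -> bsupp Q F -> bsupp Q G ->
  Phi (fun x => F x + G x) = Phi F + Phi G.
Proof.
move=> [+ _] bF bG => /(_ 1 _ _ bF bG).
by under eq_fun do rewrite mul1r; rewrite mul1r.
Qed.

Lemma bcontB Q Phi F G : bcont Q Phi -> bsupp Q F -> bsupp Q G ->
  Phi (fun x => F x - G x) = Phi F - Phi G.
Proof.
move=> [+ _] bF bG => /(_ (-1) _ _ bG bF).
by under eq_fun do rewrite mulN1r addrC; rewrite mulN1r addrC.
Qed.

Lemma bcont_sum Q Phi (I : Type) (r : seq I) (F_ : I -> T -> R) :
  bcont Q Phi -> (forall i, bsupp Q (F_ i)) ->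
  Phi (fun x => \sum_(i <- r) F_ i x) = \sum_(i <- r) Phi (F_ i).
Proof.
move=> bPhi bF; elim: r => [|i r ih].
  by rewrite big_nil; under eq_fun do rewrite big_nil; exact: (bcont0 bPhi).
under eq_fun do rewrite big_cons.
by rewrite big_cons (bcontD bPhi (bF i)) ?ih//; exact: bsupp_sum.
Qed.

Lemma bcont_comb Q Phi Psi a : bcont Q Phi -> bcont Q Psi ->
  bcont Q (fun F => a * Phi F + Psi F).
Proof.
move=> [Pl Pc] [Sl Sc]; split => [b F G bF bG|F_ F cF].
  by rewrite Pl// Sl//; lra.
by apply: cvgD; [apply: cvgMl_tmp; exact: Pc|exact: Sc].
Qed.

Import HBNNSimple.

Lemma bcont_nnsfun Q Phi (F : {nnsfun T >-> R}) :
  bcont Q Phi -> (forall x, ~ Q x -> F x = 0) ->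
  (forall A, measurable A -> A `<=` Q -> Phi \1_A = 0) -> Phi F = 0.
Proof.
move=> bPhi F0 Phi0.
(* The level sets are intersected with [F x != 0] so that each of them lies in [Q]; the term of the
   value 0 vanishes anyway. *)
have FE : (F : T -> R) =
    (fun x => \sum_(y <- finmap.enum_fset (fset_set (range F)))
       y * \1_(F @^-1` [set y] `&` [set x | F x != 0]) x).
  apply/funext => x; rewrite {1}fimfunE fsbig_finite//=.
  apply: eq_bigr => y _; have [->|y0] := eqVneq y 0; first by rewrite !mul0r.
  congr (_ * _); rewrite !indicE; congr (_ %:R); congr nat_of_bool.
  apply/idP/idP; rewrite !inE/=; last by case.
  by move=> Fxy; rewrite Fxy; split.
rewrite FE.
have mA y : measurable (F @^-1` [set y] `&` [set x | F x != 0]).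
  apply: measurableI; first exact: measurable_sfunP.
  rewrite (_ : [set x | _] = ~` (F @^-1` [set 0])); last first.
    by apply/seteqP; split => x /=; [move/eqP|move=> /eqP].
  exact/measurableC/measurable_sfunP.
have AQ y : F @^-1` [set y] `&` [set x | F x != 0] `<=` Q.
  by move=> x [_ /=]; apply: contra_neqP => /F0.
rewrite (bcont_sum _ bPhi).
  rewrite big1// => y _; rewrite (bcontZ _ bPhi) ?Phi0 ?mulr0//.
  exact: bsupp_indic.
by move=> y; apply: bsuppZ; exact: bsupp_indic.
Qed.

(** The positive and negative parts of [F] are limits of simple functions lying between 0 and the
    part, which is a bounded convergence. *)
Lemma bcont_eq0 Q Phi F : bcont Q Phi ->
  (forall A, measurable A -> A `<=` Q -> Phi \1_A = 0) -> bsupp Q F -> Phi F = 0.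
Proof.
move=> bPhi Phi0.
have pos G : bsupp Q G -> (forall x, 0 <= G x) -> Phi G = 0.
  move=> [mG [M GM] G0] G_ge0.
  have mEG : measurable_fun setT (EFin \o G) by exact/measurable_EFinP.
  pose G_ := nnsfun_approx measurableT mEG.
  have cG x : (EFin \o G_^~ x) n @[n --> \oo] --> (G x)%:E.
    by apply: cvg_nnsfun_approx => // y _; rewrite lee_fin.
  have cG' x : G_ ^~ x @ \oo --> G x.
    by have /fine_cvg := cG x; rewrite /=.
  have G_le k x : 0 <= G_ k x <= G x.
    rewrite fun_ge0/=.
    have nd : nondecreasing_seq (G_ ^~ x).
      by move=> a b ab; have /lefP := nd_nnsfun_approx measurableT mEG ab; exact.
    rewrite -(cvg_lim _ (cG' x))//.
    by apply: nondecreasing_cvgn_le nd _ _; exact: cvgP (cG' x).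
  have G_0 k x : ~ Q x -> G_ k x = 0.
    by move=> Qx; apply/eqP; rewrite eq_le; have := G_le k x; rewrite G0// andbC.
  have : Phi (G_ n) @[n --> \oo] --> Phi G.
    apply: bPhi.2; split => //.
      move=> k; split => //; last by move=> x Qx; rewrite G_0.
      exists M => x; rewrite ger0_norm ?fun_ge0//.
      have /andP[_ /le_trans] := G_le k x; apply.
      by rewrite (le_trans _ (GM x))// ler_norm.
    exists M => k x; rewrite ger0_norm ?fun_ge0//.
    have /andP[_ /le_trans] := G_le k x; apply.
    by rewrite (le_trans _ (GM x))// ler_norm.
  rewrite (_ : (fun n => Phi (G_ n)) = (fun=> 0)).
    by move=> /cvg_lim <-//; rewrite lim_cst.
  by apply/funext => k; exact: (bcont_nnsfun bPhi (G_0 k)).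
move=> bF.
have bP : bsupp Q (fun x => 2^-1 * (`|F x| + F x)).
  apply: bsuppZ; have := bsuppDZ 1 (bsupp_norm bF) bF.
  by under [X in bsupp _ X -> _]eq_fun do rewrite mul1r.
have bN : bsupp Q (fun x => 2^-1 * (`|F x| - F x)).
  by apply: bsuppZ; exact: bsuppB (bsupp_norm bF) bF.
have -> : F = fun x => 2^-1 * (`|F x| + F x) - 2^-1 * (`|F x| - F x).
  by apply/funext => x; lra.
rewrite (bcontB bPhi)// !pos ?subr0//.
all: by move=> x; have := ler_norm (F x); have := ler_norm (- F x); rewrite normrN; lra.
Qed.

Lemma integrable_bounded_mul (mu : {measure set T -> \bar R}) (D : set T)
    (K F : T -> R) (M : R) : measurable D -> mu.-integrable D (EFin \o K) ->
  measurable_fun D F -> (forall x, D x -> `|F x| <= M) ->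
  mu.-integrable D (EFin \o (fun x => K x * F x)).
Proof.
move=> mD iK mF FM.
have mK : measurable_fun D K by exact/measurable_EFinP/(measurable_int mu).
apply: (le_integrable mD (g := EFin \o (fun x => M * `|K x|))) => //.
- by apply/measurable_EFinP; exact: measurable_funM.
- move=> x Dx /=; rewrite lee_fin normrM mulrC (ger0_norm (mulr_ge0 _ _))//.
    by rewrite ler_wpM2r// FM.
  exact: le_trans (FM x Dx).
- rewrite (_ : _ \o _ = (fun x => M%:E * `|(K x)%:E|)%E); last exact/funext.
  by apply: integrableZl => //; exact: integrable_abse.
Qed.

Lemma bcont_Rintegral (mu : {measure set T -> \bar R}) Q (K : T -> R) :
  mu.-integrable setT (EFin \o K) ->
  bcont Q (fun F => \int[mu]_x (K x * F x)).
Proof.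
move=> iK.
have mK : measurable_fun setT K by exact/measurable_EFinP/(measurable_int mu).
have iKF F : bsupp Q F -> mu.-integrable setT (EFin \o (fun x => K x * F x)).
  by move=> [mF [M FM] _]; exact: (@integrable_bounded_mul _ _ K F M).
split => [a F G bF bG|F_ F [bF [M FM] cF]].
  rewrite -RintegralZl//; last exact: iKF.
  rewrite -RintegralD//; last 2 first.
  - rewrite (_ : _ \o _ = (fun x => a%:E * (K x * F x)%:E)%E); last exact/funext.
    by apply: integrableZl => //; exact: iKF.
  - exact: iKF.
  by apply: eq_Rintegral => x _; lra.
have mF k : measurable_fun setT (F_ k) by case: (bF k).
have [mFl [N FlN] _] : bsupp Q F by apply: (@bounded_cvg_bsupp _ F_); split => //; exists M.
apply: fine_cvg; rewrite fineK; last first.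
  apply: integrable_fin_num => //; exact: (@integrable_bounded_mul _ _ K F N).
apply: (@dominated_cvg _ _ _ mu setT _ _ _ (fun x => (M%:E * `|(K x)%:E|)%E)) => //.
- by move=> k; apply/measurable_EFinP; exact: measurable_funM.
- by move=> x _; apply: cvg_EFin; [exact: nearW|apply: cvgMl_tmp; exact: cF].
- by apply: integrableZl => //; exact: integrable_abse.
- move=> n x _ /=; rewrite lee_fin normrM mulrC.
  by rewrite ler_wpM2r.
Qed.

Lemma bsupp_integrable (mu : {measure set T -> \bar R}) Q F :
  measurable Q -> (mu Q < +oo)%E -> bsupp Q F ->
  mu.-integrable setT (EFin \o F).
Proof.
move=> mQ Qoo [mF [M FM] F0].
have iQ : mu.-integrable setT (EFin \o (\1_Q : T -> R)).
  apply/integrableP; split; first by apply/measurable_EFinP; exact: measurable_indic.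
  under eq_integral do rewrite /= ger0_norm//.
  by rewrite integral_indic// setIT.
have := @integrable_bounded_mul mu setT _ F M measurableT iQ mF (fun x _ => FM x).
congr (_.-integrable _ _); apply/funext => x /=; rewrite indicE.
by have [|/negP xQ] := boolP (x \in Q); rewrite ?mul1r// F0 ?mulr0// => /mem_set.
Qed.

Lemma bcont_int (mu : {measure set T -> \bar R}) Q : measurable Q -> (mu Q < +oo)%E ->
  bcont Q (fun F : T -> R => \int[mu]_x F x).
Proof.
move=> mQ Qoo.
(* The constant kernel 1 need not be integrable on the whole space. The kernel [\1_Q] is, and it
   gives the same integrals on functions vanishing off [Q]. *)
have iQ : mu.-integrable setT (EFin \o (\1_Q : T -> R)).
  apply: (bsupp_integrable mQ Qoo); exact: bsupp_indic.
have [l c] := @bcont_Rintegral mu Q _ iQ.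
have E F : bsupp Q F -> \int[mu]_x (\1_Q x * F x) = \int[mu]_x F x.
  move=> [_ _ F0]; apply: eq_Rintegral => x _; rewrite indicE.
  by have [|/negP xQ] := boolP (x \in Q); rewrite ?mul1r// F0 ?mulr0// => /mem_set.
split => [a F G bF bG|F_ F cF].
  by rewrite -E ?l// ?E//; exact: bsuppDZ.
have bF := bounded_cvg_bsupp cF.
have [bF_ _ _] := cF.
have := c F_ F cF; rewrite E//; under eq_fun do rewrite E//; exact.
Qed.

End bounded_functions.

(** * Boxes as a pi-system generating the measurable sets *)

Section boxes.
Context (R : realType) (n : nat).
Local Notation V := 'rV[R]_n.
Implicit Types (a b p q : 'I_n -> R) (A Q : set V).

Definition box a b : set V := [set x | forall k, a k < x ord0 k < b k].

Lemma box_open a b : open (box a b).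
Proof.
rewrite openE => x xab.
apply: (@filter_forall _ 'I_n (fun k (y : V) => is_true (a k < y ord0 k < b k)) (nbhs x)) => k.
have := @coord_continuous R 1 n ord0 k x `]a k, b k[%classic; apply.
by apply: open_nbhs_nbhs; split; [exact: interval_open|rewrite /= in_itv/=; exact: xab].
Qed.

Lemma box_measurable a b : measurable (box a b).
Proof. by apply: open_measurable_rV; exact: box_open. Qed.

Lemma boxI a b p q : box a b `&` box p q =
  box (fun k => Num.max (a k) (p k)) (fun k => Num.min (b k) (q k)).
Proof.
apply/seteqP; split => x /=.
  move=> [H K] k; have /andP[? ?] := H k; have /andP[? ?] := K k.
  by rewrite gt_max lt_min; do ?[apply/andP; split].
by move=> H; split => k; have := H k; rewrite gt_max lt_min => /andP[/andP[? ?] /andP[? ?]]; apply/andP.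
Qed.

Definition boxes : set (set V) := [set A | exists a b, A = box a b].

Lemma boxes_setI : setI_closed boxes.
Proof. by move=> _ _ [a [b ->]] [p [q ->]]; rewrite boxI; do 2 eexists. Qed.

Lemma measurable_boxes : @measurable _ V = <<s boxes >>.
Proof.
apply/seteqP; split; last first.
  apply: smallest_sub; first exact: sigma_algebra_measurable.
  by move=> _ [a [b ->]]; exact: box_measurable.
have coord (i : 'I_n) (Y : set R) : measurable Y ->
    <<s boxes >> ((fun x : V => x ord0 i) @^-1` Y).
  move=> mY; have : (@RGenOpens.G R).-sigma.-measurable Y.
    by rewrite -RGenOpens.measurableE.
  move: {mY} Y; apply: smallest_sub.
    split => /=.
    - by rewrite preimage_set0; exact: sigma_algebra0.
    - by move=> A sA; rewrite setTD preimage_setC; exact: sigma_algebraC.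
    - by move=> F sF; rewrite preimage_bigcup; exact: sigma_algebra_bigcup.
  move=> _ [s [t ->]] /=.
  (* A slab in the direction [i] is the union of boxes whose other sides grow with [m]. *)
  rewrite (_ : _ @^-1` _ = \bigcup_m box (fun k => if k == i then s else - m%:R)
      (fun k => if k == i then t else m%:R)).
    apply: sigma_algebra_bigcup => m; apply: sub_sigma_algebra.
    by do 2 eexists.
  apply/seteqP; split => x /=; rewrite in_itv/=; last first.
    by move=> [m _ /(_ i)]; rewrite eqxx.
  move=> xst; pose m := (Num.truncn (\sum_k `|x ord0 k|)).+1.
  exists m => //= k; case: eqP => [->//|_]; rewrite -ltr_norml.
  apply: (le_lt_trans _ (truncnS_gt _)).
  by rewrite (bigD1 k)//= lerDl sumr_ge0.
apply: smallest_sub; first exact: smallest_sigma_algebra.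
by move=> A; rewrite -bigcup_seq/= => -[i _ [Y mY <-]]; rewrite setTI; exact: coord.
Qed.

(** Pi-lambda argument. The sets [A] such that [Phi] vanishes on the indicator of the trace of [A]
    on [box p q] form a Dynkin system: complements by linearity, disjoint unions by bounded
    convergence. Traces of boxes are boxes. *)
Lemma bcont_box (Phi : (V -> R) -> R) p q : bcont (box p q) Phi ->
  (forall a b, (forall k, p k <= a k) -> (forall k, a k < b k) ->
     (forall k, b k <= q k) -> Phi \1_(box a b) = 0) ->
  forall F, bsupp (box p q) F -> Phi F = 0.
Proof.
move=> bPhi Phi0 F; apply: bcont_eq0 => // A mA AQ.
have mQ := box_measurable p q.
have indic_bsupp B : measurable B -> bsupp (box p q) (\1_(B `&` box p q) : V -> R).
  by move=> mB; apply: bsupp_indic; [exact: measurableI|exact: subIsetr].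
(* Intersections may be degenerate; such boxes are empty, and [Phi] is 0 there by linearity. *)
have box0 a b : (forall k, p k <= a k) -> (forall k, b k <= q k) ->
    Phi \1_(box a b) = 0.
  move=> pa bq; have [ab|/existsNP[k /negP ab]] := pselect (forall k, a k < b k).
    exact: Phi0.
  rewrite (_ : \1_(box a b) = (fun=> 0) :> (V -> R)); first exact: (bcont0 bPhi).
  apply/funext => x; rewrite indicE memNset// => /(_ k)/andP[ax xb].
  by move: ab; rewrite (lt_trans ax xb).
suff : Phi \1_(A `&` box p q) = 0 by rewrite setIidl.
have : <<s boxes >> A by rewrite -measurable_boxes.
move: {mA AQ} A; apply: dynkin_induction.
- exact: measurable_boxes.
- exact: boxes_setI.
- by rewrite setTI; exact: box0.
- move=> _ [a [b ->]]; rewrite boxI; apply: box0 => k.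
    by rewrite le_max lexx orbT.
  by rewrite ge_min lexx orbT.
- move=> A mA A0.
  have -> : \1_(~` A `&` box p q) = (fun x => \1_(box p q) x - \1_(A `&` box p q) x) :> (V -> R).
    apply/funext => x; rewrite !indicE !in_setI in_setC.
    by case: (x \in A); case: (x \in box p q); rewrite /= ?subr0 ?subrr.
  rewrite (bcontB bPhi)//; last exact: indic_bsupp.
    by rewrite A0 box0// subrr.
  by apply: bsupp_indic.
- move=> A mA tA A0.
  have : Phi (fun x => \sum_(k < m) \1_(A k `&` box p q) x) @[m --> \oo] -->
      Phi \1_(\bigcup_k A k `&` box p q).
    have sumE m x : \sum_(k < m) \1_(A k `&` box p q) x =
        \1_(\bigcup_(k < m) A k `&` box p q) x :> R.
      rewrite indicE; have [xA|xA] := boolP (x \in _).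
        move: xA; rewrite inE => -[[k /= km Akx] qx].
        rewrite (bigD1 (Ordinal km))//= big1 ?addr0.
          by rewrite indicE mem_set.
        move=> [j jm] /= jk; rewrite indicE memNset// => -[Ajx _].
        move: jk; rewrite -val_eqE/= => /eqP; apply.
        by apply: (tA j k) => //; exists x.
      rewrite big1// => k _; rewrite indicE memNset// => -[Akx qx].
      by move/negP: xA; apply; rewrite inE; split => //; exists k => /=.
    apply: bPhi.2; split.
    - by move=> m; apply: bsupp_sum => k; exact: indic_bsupp.
    - exists 1 => m x; rewrite sumE indicE.
      by case: (x \in _); rewrite ?normr1 ?normr0.
    - move=> x; under eq_fun do rewrite sumE.
      have [[[k _ Akx] qx]|nx] := pselect ((\bigcup_k A k `&` box p q) x).
        apply: cvg_near_cst; exists k.+1 => // m /= km.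
        rewrite !indicE !mem_set//; first by split => //; exists k.
        by split => //; exists k => //=; exact: leq_trans km.
      apply: cvg_near_cst; apply: nearW => m; rewrite !indicE !memNset//.
      by move=> [[k _ Akx] qx]; apply: nx; split => //; exists k.
  rewrite (_ : (fun m => _) = fun=> 0).
    by move=> /cvg_lim <-//; rewrite lim_cst.
  apply/funext => m; rewrite (bcont_sum _ bPhi).
    by rewrite big1.
  by move=> k; exact: indic_bsupp.
Qed.

Definition prodf (h : 'I_n -> R -> R) : V -> R := fun x => \prod_(k < n) h k (x ord0 k).

End boxes.

(** * Integrals of products of functions of one variable *)

Section product_functions.
Context (R : realType).
Local Notation mu n := (@lebesgue_rV R n).
Local Notation leb := (@lebesgue_measure R).

Lemma ge0_integral_rV_cons n (f : 'rV[R]_n.+1 -> \bar R) :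
  measurable_fun setT f -> (forall x, 0 <= f x)%E ->
  (\int[mu n.+1]_x f x = \int[leb]_a \int[mu n]_v f (rV_cons (a, v)))%E.
Proof.
move=> mf f0.
have mc : measurable_fun [set: measurableTypeR R * 'rV[R]_n] (@rV_cons R n) :=
  @measurable_rV_cons R n.
pose m12 : {measure set (measurableTypeR R * 'rV[R]_n) -> \bar R} :=
  (leb \x mu n)%E.
transitivity (\int[leb \x mu n]_x f (rV_cons x))%E.
  have := @ge0_integral_pushforward _ _ _ _ _ _ mc m12 setT f measurableT mf.
  rewrite preimage_setT => <-//.
rewrite (@fubini_tonelli1 _ _ _ _ _ leb (mu n) (f \o @rV_cons R n))//.
  exact: measurableT_comp.
by move=> x; exact: f0.
Qed.

Lemma measurable_prodf n (h : 'I_n -> R -> R) :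
  (forall k, measurable_fun setT (h k)) -> measurable_fun setT (prodf h).
Proof.
move=> mh; rewrite /prodf; apply: measurable_prod => k _.
by apply: measurableT_comp => //; exact: measurable_rV_coord.
Qed.

Lemma integral_prodf n (h : 'I_n -> R -> R) :
  (forall k, measurable_fun setT (h k)) -> (forall k s, 0 <= h k s) ->
  (forall k, leb.-integrable setT (EFin \o h k)) ->
  (\int[mu n]_x (prodf h x)%:E = (\prod_(k < n) \int[leb]_s h k s)%:E)%E.
Proof.
elim: n h => [|n ih] h mh h0 ih_.
  rewrite big_ord0 integral_dirac//=.
    by rewrite diracT mul1e /prodf big_ord0.
  by apply/measurable_EFinP; exact: measurable_prodf.
have prod0 m (h' : 'I_m -> R -> R) x : (forall k s, 0 <= h' k s) -> 0 <= prodf h' x.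
  by move=> h'0; apply: prodr_ge0 => k _.
rewrite ge0_integral_rV_cons//; last 2 first.
- by apply/measurable_EFinP; exact: measurable_prodf.
- by move=> x; rewrite lee_fin prod0.
have mh' : measurable_fun setT (prodf (fun k : 'I_n => h (lift ord0 k))).
  by apply: measurable_prodf.
transitivity (\int[leb]_a ((h ord0 a)%:E *
    (\prod_(k < n) \int[leb]_s h (lift ord0 k) s)%:E))%E.
  apply: eq_integral => a _; rewrite -ih// -ge0_integralZl_EFin//.
  - apply: eq_integral => v _; rewrite -EFinM /prodf big_ord_recl rV_cons0.
    by congr (_ * _)%:E; apply: eq_bigr => k _; rewrite rV_consS.
  - by move=> v _; rewrite lee_fin prod0.
  - exact/measurable_EFinP.
rewrite integralZr//; last exact: ih_.
by rewrite big_ord_recl EFinM /Rintegral fineK//; apply: integrable_fin_num => //; exact: ih_.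
Qed.

Lemma integrable_prodf n (h : 'I_n -> R -> R) :
  (forall k, measurable_fun setT (h k)) -> (forall k s, 0 <= h k s) ->
  (forall k, leb.-integrable setT (EFin \o h k)) ->
  (mu n).-integrable setT (EFin \o prodf h).
Proof.
move=> mh h0 ih; apply/integrableP; split.
  by apply/measurable_EFinP; exact: measurable_prodf.
under eq_integral do rewrite gee0_abs ?lee_fin ?prodr_ge0//.
by rewrite integral_prodf// ltry.
Qed.

Lemma Rintegral_prodf n (h : 'I_n -> R -> R) :
  (forall k, measurable_fun setT (h k)) -> (forall k s, 0 <= h k s) ->
  (forall k, leb.-integrable setT (EFin \o h k)) ->
  \int[mu n]_x prodf h x = \prod_(k < n) \int[leb]_s h k s.
Proof. by move=> *; rewrite /Rintegral integral_prodf. Qed.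

Lemma box_prodf n (a b : 'I_n -> R) :
  \1_(box a b) = prodf (fun k => \1_`]a k, b k[%classic) :> ('rV[R]_n -> R).
Proof.
apply/funext => x; rewrite indicE; have [xab|xab] := boolP (x \in _).
  rewrite /prodf big1// => k _; rewrite indicE mem_set//= in_itv/=.
  by move: xab; rewrite inE; exact.
have [k xk] : exists k, ~~ (a k < x ord0 k < b k).
  apply: contrapT => H; move/negP: xab; apply; rewrite inE => k.
  by apply/negPn/negP => xk; apply: H; exists k.
rewrite /prodf (bigD1 k)//= indicE memNset ?mul0r//= in_itv/=; exact/negP.
Qed.

Lemma integrable_indic_itv (a b : R) :
  leb.-integrable setT (EFin \o (\1_`]a, b[%classic : R -> R)).
Proof.
apply/integrableP; split; first by apply/measurable_EFinP; exact: measurable_indic.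
under eq_integral do rewrite /= ger0_norm//.
rewrite integral_indic// setIT.
suff : (lebesgue_measure `]a, b[%classic < +oo :> \bar R)%E by [].
by rewrite lebesgue_measure_itv/=; case: ifP; rewrite ?ltry.
Qed.

Lemma box_finite n (a b : 'I_n -> R) : (mu n (box a b) < +oo)%E.
Proof.
have mk k : measurable_fun setT (\1_`]a k, b k[%classic : R -> R).
  exact: measurable_indic.
have := @integrable_prodf n (fun k => \1_`]a k, b k[%classic) mk
  (fun k s => ler0n _ _) (fun k => integrable_indic_itv _ _).
move=> /integrableP[_]; rewrite -box_prodf.
under eq_integral do rewrite /= ger0_norm//.
by rewrite integral_indic ?setIT//; exact: box_measurable.
Qed.

End product_functions.

(** * Smooth bumps *)

Section smooth1.
Context {R : realType}.
Implicit Types (f g : R -> R).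

(** The derivative is existentially quantified, rather than an iterated [derive1], so that closure
    properties are direct inductions on [m]. *)
Fixpoint cdiff (m : nat) f : Prop :=
  if m is m'.+1 then
    exists f', (forall x : R, is_derive x (1 : R) f (f' x)) /\ cdiff m' f'
  else continuous f.

Definition smooth1 f := forall m, cdiff m f.

Lemma is_derive1_continuous f f' : (forall x : R, is_derive x (1 : R) f (f' x)) -> continuous f.
Proof.
by move=> df x; apply: differentiable_continuous; apply/derivable1_diffP; case: (df x).
Qed.

Lemma cdiffW m f : cdiff m.+1 f -> cdiff m f.
Proof.
elim: m f => [|m ih] f [f' [df cf]]; first exact: is_derive1_continuous df.
by exists f'; split => //; exact: ih.
Qed.

Lemma smooth1_derive f f' : smooth1 f -> (forall x : R, is_derive x (1 : R) f (f' x)) -> smooth1 f'.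
Proof.
move=> sf df m; have [g [dg cg]] := sf m.+1.
rewrite (_ : f' = g)//; apply/funext => x.
by have [_ <-] := df x; have [_ <-] := dg x.
Qed.

Lemma smooth1_derivable f x : smooth1 f -> derivable f x 1.
Proof. by move=> /(_ 1%N) [f' [df _]]; case: (df x). Qed.

Lemma smooth1_derive1 f : smooth1 f -> smooth1 (derive1 f).
Proof.
move=> sf; apply: (smooth1_derive sf) => x; rewrite derive1E.
by apply: derivableP; exact: smooth1_derivable.
Qed.

Lemma smooth1_continuous f : smooth1 f -> continuous f.
Proof. by move=> /(_ 0%N). Qed.

Lemma smooth1_measurable f : smooth1 f -> measurable_fun setT f.
Proof. by move=> /smooth1_continuous /continuous_measurable_fun. Qed.

Lemma smooth1_prim f f' : smooth1 f' -> (forall x : R, is_derive x (1 : R) f (f' x)) -> smooth1 f.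
Proof.
by move=> sf df [|m]; [exact: is_derive1_continuous df|exists f'].
Qed.

Lemma cdiffM m f g : cdiff m f -> cdiff m g -> cdiff m (fun x => f x * g x).
Proof.
elim: m f g => [|m ih] f g; first by move=> cf cg x; apply: cvgM; [exact: cf|exact: cg].
have cD (a b : R -> R) : cdiff m a -> cdiff m b -> cdiff m (fun x => a x + b x).
  elim: {ih} m a b => [|m ih] a b.
    by move=> ca cb x; apply: cvgD; [exact: ca|exact: cb].
  move=> [a' [da ca]] [b' [db cb]]; exists (fun x => a' x + b' x); split.
    by move=> x; exact: is_deriveD.
  exact: ih.
move=> cf cg; have [f' [df cf']] := cf; have [g' [dg cg']] := cg.
exists (fun x => f x * g' x + g x * f' x); split.
  by move=> x; exact: is_deriveM.
by apply: cD; apply: ih => //; exact: cdiffW.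
Qed.

Lemma smooth1M f g : smooth1 f -> smooth1 g -> smooth1 (fun x => f x * g x).
Proof. by move=> sf sg m; exact: cdiffM. Qed.

Lemma smooth1_cst (a : R) : smooth1 (fun=> a).
Proof.
move=> m; elim: m a => [|m ih] a; first exact: cst_continuous.
by exists (fun=> 0); split => // x; exact: is_derive_cst.
Qed.

Lemma smooth1Z (a : R) f : smooth1 f -> smooth1 (fun x => a * f x).
Proof. by move=> sf; apply: smooth1M => //; exact: smooth1_cst. Qed.

Lemma smooth1B f g : smooth1 f -> smooth1 g -> smooth1 (fun x => f x - g x).
Proof.
move=> sf sg m; elim: m f g {sf sg} (sf m) (sg m) => [|m ih] f g.
  by move=> cf cg x; apply: cvgB; [exact: cf|exact: cg].
move=> [f' [df cf]] [g' [dg cg]]; exists (fun x => f' x - g' x); split.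
  by move=> x; exact: is_deriveB.
exact: ih.
Qed.

Lemma smooth1_affine (a b : R) f : smooth1 f -> smooth1 (fun x => f (a * x + b)).
Proof.
have dab x : is_derive x (1 : R) (fun x : R => a * x + b) a.
  have d1 : is_derive x (1 : R) (a \*: (@id R)) (a *: 1) by exact: is_deriveZ.
  have := is_deriveD d1 (is_derive_cst b x 1).
  by rewrite addr0 -[a *: 1]/(a * 1) mulr1.
move=> sf m; elim: m f {sf} (sf m) => [|m ih] f.
  move=> cf x; apply: continuous_comp => //; last exact: cf.
  exact: (is_derive1_continuous dab).
move=> [f' [df cf]]; exists (fun x => a * f' (a * x + b)); split.
  move=> x; rewrite mulrC.
  exact: (@is_derive1_comp R f (fun x => a * x + b) x _ _ (df _) (dab x)).
by apply: cdiffM; [exact: smooth1_cst|exact: ih].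
Qed.

Definition polyexp (p : {poly R}) (c t : R) : R :=
  if 0 < t then p.[t^-1] * expR (- (c * t^-1)) else 0.

(** With [y = s^-1 >= 1] and [d = size p], the polynomial is at most a multiple of [y ^+ d], while
    the exponential of [c * y] is at least its Taylor term of degree [d.+1]. The one power left over
    is the factor [s]. *)
Lemma polyexp_le (p : {poly R}) (c : R) : 0 < c -> exists B : R,
  forall s, s <= 1 -> `|polyexp p c s| <= B * `|s|.
Proof.
move=> c0; pose A := \sum_(i < size p) `|p`_i|; pose d := size p.
exists (A * (d.+1`!%:R / c ^+ d.+1)) => s s1; rewrite /polyexp.
have A0 : 0 <= A by exact: sumr_ge0.
case: ifPn => [s0|_]; last first.
  by rewrite normr0 mulr_ge0// mulr_ge0// divr_ge0// exprn_ge0// ltW.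
have y1 : 1 <= s^-1 by rewrite invf_ge1.
have y0 : 0 < s^-1 by rewrite invr_gt0.
have pA : `|p.[s^-1]| <= A * s^-1 ^+ d.
  rewrite horner_coef (le_trans (ler_norm_sum _ _ _))// mulr_suml ler_sum// => i _.
  rewrite normrM ler_wpM2l// normrX (gtr0_norm y0) ler_weXn2l//.
  exact: ltnW.
rewrite normrM (gtr0_norm s0) (ger0_norm (expR_ge0 _)) expRN.
have e1 : (c * s^-1) ^+ d.+1 / d.+1`!%:R <= expR (c * s^-1).
  apply: le_trans (expR_ge1Dxn d _); first by rewrite lerDr.
  by rewrite mulr_ge0 ?ltW.
have f0 : 0 < d.+1`!%:R :> R by rewrite ltr0n fact_gt0.
have cs0 : 0 < (c * s^-1) ^+ d.+1 by rewrite exprn_gt0// mulr_gt0.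
have e2 : (expR (c * s^-1))^-1 <= d.+1`!%:R / (c * s^-1) ^+ d.+1.
  by rewrite -[leRHS]invf_div lef_pV2// posrE ?divr_gt0// expR_gt0.
rewrite (le_trans (ler_pM _ _ pA e2))// ?invr_ge0 ?expR_ge0//.
have -> : d.+1`!%:R / (c * s^-1) ^+ d.+1 = d.+1`!%:R / c ^+ d.+1 * s ^+ d.+1.
  by rewrite exprMn exprVn invfM invrK mulrA.
have yd : s^-1 ^+ d * s ^+ d.+1 = s.
  by rewrite exprSr mulrA -exprMn mulVf ?gt_eqF// expr1n mul1r.
by rewrite mulrACA yd.
Qed.

Lemma is_derive_polyexp (p : {poly R}) (c : R) : 0 < c -> forall t : R,
  is_derive t (1 : R) (polyexp p c) (polyexp ((c *: p - p^`()) * 'X^2) c t).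
Proof.
move=> c0 t; have [t0|t0|->] := ltgtP t 0.
- rewrite {2}/polyexp ltNge (ltW t0)/=.
  apply: (@near_eq_is_derive _ _ _ (cst 0)); last first.
    by near=> s; rewrite /polyexp ltNge ltW//; near: s; exact: lt_nbhsl.
- have tN0 : t != 0 by rewrite gt_eqF.
  apply: (@near_eq_is_derive R R R (fun s : R => p.[s^-1] * expR (- (c * s^-1)))).
    by near=> s; rewrite /polyexp ifT//; near: s; exact: lt_nbhsr.
  have dV : is_derive t (1 : R) (fun s : R => s^-1) (- t ^- 2 *: 1).
    exact: (@is_deriveV R id).
  have dp := is_derive1_comp (is_derive_poly p t^-1) dV.
  have dcV : is_derive t (1 : R) (fun s : R => - (c * s^-1)) (- (c *: (- t ^- 2 *: 1))).
    by apply: is_deriveN; exact: is_deriveZ.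
  have de := is_derive1_comp (is_derive_expR _) dcV.
  apply: (is_derive_eq (is_deriveM dp de)).
  rewrite /polyexp t0 !hornerE /GRing.scale/=.
  rewrite !mulr1 ?mulrN ?mulNr ?mulrN ?opprK ?exprVn.
  set e := expR _; set a := p.[_]; set b := _.[_]; rewrite expr2 invfM.
  set z := t^-1; ring.
- rewrite {2}/polyexp ltxx.
  (* The difference quotient at 0 is [polyexp (p * 'X) c], again a member of the family, which
     [polyexp_le] sends to 0. *)
  have cvg0 : (fun h : R => h^-1 *: ((polyexp p c \o shift 0) (h *: 1) - polyexp p c 0)) @ 0^' --> (0 : R).
    have [B HB] := polyexp_le (p * 'X) c0.
    apply/cvgrPdist_le => /= e e0; near=> h.
    have h0 : h != 0 by near: h; exact: nbhs_dnbhs_neq.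
    have -> : h^-1 *: ((polyexp p c \o shift 0) (h *: 1) - polyexp p c 0) = polyexp (p * 'X) c h.
      rewrite /= addr0 [h *: 1]mulr1 {2}/polyexp ltxx subr0 /polyexp.
      by case: ifP => _; rewrite ?scaler0// hornerMX /GRing.scale/= -mulrA mulrCA.
    rewrite sub0r normrN; apply: (le_trans (HB _ _)).
      by rewrite ltW//; near: h; apply: nbhs_dnbhs; exact: lt_nbhsl.
    rewrite (@le_trans _ _ ((`|B| + 1) * `|h|))// ?ler_wpM2r//.
      by rewrite (le_trans (ler_norm _))// lerDl.
    rewrite -ler_pdivlMl ?ltr_wpDl//.
    near: h; apply: nbhs_dnbhs.
    have := @nbhs0_le R R ((`|B| + 1)^-1 * e); apply.
    by rewrite mulr_gt0// invr_gt0 ltr_wpDl.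
  by apply: DeriveDef; [apply: cvgP cvg0|apply/cvg_lim].
Unshelve. all: by end_near.
Qed.

Lemma polyexp_smooth (p : {poly R}) (c : R) : 0 < c -> smooth1 (polyexp p c).
Proof.
move=> c0 m; elim: m p => [|m ih] p.
  exact: (is_derive1_continuous (is_derive_polyexp p c0)).
by exists (polyexp ((c *: p - p^`()) * 'X^2) c); split => //; exact: is_derive_polyexp.
Qed.

(** The parameter [c] lets one family play two roles: at [c = 1] it is normalized into a mollifier,
    and as [c] tends to 0 it tends to the indicator of the open interval, with values in [0, 1]
    throughout. *)
Definition bump (a b c t : R) : R := polyexp 1 c (t - a) * polyexp 1 c (b - t).

Lemma polyexp1_itv (c s : R) : 0 < c -> 0 <= polyexp 1 c s <= 1.
Proof.
move=> c0; rewrite /polyexp; case: ifPn => [s0|_]; last by rewrite lexx ler01.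
rewrite hornerC mul1r expR_ge0/= expR_le1 oppr_le0 mulr_ge0// ?ltW//.
by rewrite invr_gt0.
Qed.

Lemma bump_itv (a b c t : R) : 0 < c -> 0 <= bump a b c t <= 1.
Proof.
move=> c0; have /andP[p0 p1] := polyexp1_itv (t - a) c0.
have /andP[q0 q1] := polyexp1_itv (b - t) c0.
by rewrite mulr_ge0//= mulr_ile1.
Qed.

Lemma bump_out (a b c t : R) : ~ `]a, b[%classic t -> bump a b c t = 0.
Proof.
rewrite /= in_itv/= /bump /polyexp !subr_gt0.
by case: (a < t); case: (t < b); rewrite ?mul0r ?mulr0// => /(_ isT).
Qed.

Lemma bump_smooth (a b c : R) : 0 < c -> smooth1 (bump a b c).
Proof.
move=> c0; apply: smooth1M.
  have := smooth1_affine 1 (- a) (polyexp_smooth 1 c0).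
  by under eq_fun do rewrite mul1r.
have := smooth1_affine (- 1) b (polyexp_smooth 1 c0).
by under eq_fun do rewrite mulN1r addrC.
Qed.

Lemma bump_bsupp (a b c : R) : 0 < c -> bsupp `]a, b[%classic (bump a b c).
Proof.
move=> c0; split; first by apply: smooth1_measurable; exact: bump_smooth.
- by exists 1 => t; have /andP[? ?] := bump_itv a b t c0; rewrite ger0_norm.
- by move=> t; exact: bump_out.
Qed.

Lemma bump_cvg (a b t : R) :
  bump a b m.+1%:R^-1 t @[m --> \oo] --> (\1_`]a, b[%classic t : R).
Proof.
rewrite indicE; have [/set_mem tab|/negP tab] := boolP (t \in _); last first.
  apply: cvg_near_cst; apply: nearW => m; apply: bump_out => tab'.
  by apply: tab; rewrite inE.
move: tab; rewrite /= in_itv/= => /andP[at_ tb].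
have pe (s : R) : 0 < s -> polyexp 1 m.+1%:R^-1 s @[m --> \oo] --> (1 : R).
  move=> s0; rewrite /polyexp s0 hornerC; under eq_fun do rewrite mul1r.
  have h0 : - (m.+1%:R^-1 * s^-1) @[m --> \oo] --> - (0 * s^-1).
    by apply: cvgN; apply: cvgMr_tmp; exact: (@cvg_harmonic R).
  rewrite mul0r oppr0 in h0.
  have := continuous_cvg _ (@continuous_expR R 0) h0 _.
  by rewrite expR0; exact.
have ta0 : 0 < t - a by rewrite subr_gt0.
have bt0 : 0 < b - t by rewrite subr_gt0.
have := cvgM (pe _ ta0) (pe _ bt0).
by rewrite mulr1; exact.
Qed.

Local Notation leb := (@lebesgue_measure R).

Lemma itv_fin (a b : R) : (leb `]a, b[%classic < +oo)%E.
Proof. by rewrite lebesgue_measure_itv/=; case: ifP; rewrite ?ltry. Qed.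

Lemma bsupp_integrable1 (a b : R) f : bsupp `]a, b[%classic f ->
  leb.-integrable setT (EFin \o f).
Proof.
move=> bf; apply: (@bsupp_integrable _ (measurableTypeR R) R leb `]a, b[%classic f).
- exact: measurable_itv.
- exact: itv_fin.
- exact: bf.
Qed.

Lemma bump_integral_gt0 (a b c : R) : 0 < c -> a < b ->
  0 < \int[leb]_t bump a b c t.
Proof.
(* On the middle half of the interval both factors are at least [e], being taken at distance more
   than [d] from the end points. *)
move=> c0 ab; pose d := (b - a) / 4.
have d0 : 0 < d by rewrite /d; lra.
pose e := expR (- (c * d^-1)).
have pe s : d < s -> e <= polyexp 1 c s.
  move=> ds; rewrite /polyexp (lt_trans d0 ds) hornerC mul1r ler_expR lerN2.
  rewrite ler_wpM2l ?ltW// ltf_pV2// posrE//; exact: lt_trans ds.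
have bi : bsupp `](a + d), (b - d)[%classic (fun t => e ^+ 2 * (\1_`](a + d), (b - d)[%classic t : R)).
  by apply: bsuppZ; exact: bsupp_indic.
apply: (@lt_le_trans _ _ (\int[leb]_t (e ^+ 2 * (\1_`](a + d), (b - d)[%classic t : R)))).
  rewrite RintegralZl//; last first.
    by apply: (@bsupp_integrable1 (a + d) (b - d)); exact: bsupp_indic.
  rewrite mulr_gt0// ?exprn_gt0 ?expR_gt0//.
  rewrite /Rintegral integral_indic// setIT.
  suff E : leb `](a + d), (b - d)[%classic = (2 * d)%:E :> \bar R.
    have : 0 < fine (leb `](a + d), (b - d)[%classic) by rewrite E /= mulr_gt0.
    exact.
  rewrite lebesgue_measure_itv/= lte_fin ifT; last by rewrite /d; lra.
  by rewrite -EFinD; congr EFin; rewrite /d; lra.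
apply: le_Rintegral => //.
- exact: bsupp_integrable1 bi.
- exact: bsupp_integrable1 (bump_bsupp a b c0).
- move=> t _; rewrite indicE; have [/set_mem/=|_] := boolP (t \in _); last first.
    by rewrite mulr0; have /andP[] := bump_itv a b t c0.
  rewrite in_itv/= => /andP[h1 h2]; rewrite mulr1 expr2.
  by apply: ler_pM; rewrite ?expR_ge0//; apply: pe; lra.
Qed.

Lemma mollifier_exists (a b : R) : a < b -> exists rho : R -> R,
  [/\ smooth1 rho, forall t, 0 <= rho t, bsupp `]a, b[%classic rho &
      \int[leb]_t rho t = 1].
Proof.
move=> ab; have I0 := bump_integral_gt0 (@ltr01 R) ab.
set I := \int[leb]_t _ in I0.
exists (fun t => I^-1 * bump a b 1 t); split.
- by apply: smooth1Z; exact: bump_smooth.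
- move=> t; rewrite mulr_ge0 ?invr_ge0 ?(ltW I0)//.
  by have /andP[] := bump_itv a b t (@ltr01 R).
- by apply: bsuppZ; exact: bump_bsupp.
- rewrite RintegralZl//; last exact: bsupp_integrable1 (bump_bsupp a b ltr01).
  by rewrite mulVf// gt_eqF.
Qed.

Definition primitive f (t : R) : R := \int[leb]_(s in `]-oo, t]) f s.

Lemma is_derive_primitive f (a b : R) : continuous f -> bsupp `]a, b[%classic f ->
  forall t : R, is_derive t (1 : R) (primitive f) (f t).
Proof.
move=> cf bf t.
have fi : leb.-integrable `]-oo, (t + 1)] (EFin \o f).
  by apply: (@integrableS _ _ _ leb setT) => //; exact: bsupp_integrable1 bf.
have ntb : (-oo < t%:E)%E by rewrite ltNyr.
have t1 : t < t + 1 by rewrite ltrDl.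
have [dF F'] := @continuous_FTC1 _ f (BInfty R true) t (t + 1) t1 fi ntb (cf t).
by rewrite -F' derive1E; exact: derivableP.
Qed.

(** Thanks to the zero mean, the primitive stays supported in the same interval and can serve as one
    factor of a test function in the same box. *)
Lemma primitive_out f (a b : R) : bsupp `]a, b[%classic f -> \int[leb]_t f t = 0 ->
  forall t, ~ `]a, b[%classic t -> primitive f t = 0.
Proof.
move=> [mf _ f0] If t /=; rewrite in_itv/= => /negP; rewrite negb_and -!leNgt.
rewrite /primitive => /orP[ta|bt].
  rewrite (@eq_Rintegral _ _ _ _ _ (fun=> 0)); first by rewrite Rintegral_cst// mul0r.
  move=> s /set_mem/=; rewrite in_itv/= => st; apply: f0; rewrite /= in_itv/=.
  by rewrite ltNge (le_trans st ta).
rewrite -If [LHS]Rintegral_mkcond; apply: eq_Rintegral => s _.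
rewrite patchE; case: ifPn => // /negP st; rewrite f0//= in_itv/=.
move=> /andP[_ sb]; apply: st; rewrite inE/= in_itv/=.
by rewrite (le_trans (ltW sb) bt).
Qed.

End smooth1.

(** * Products of smooth functions as test functions *)

Section product_test_functions.
Context (R : realType) (n : nat).
Local Notation V := 'rV[R]_n.
Implicit Types (h : 'I_n -> R -> R) (a b : 'I_n -> R).

Definition cbox a b : set V := [set x | forall k, a k <= x ord0 k <= b k].

Lemma cbox_compact a b : compact (cbox a b).
Proof.
have := @rV_compact R n (fun k => `[a k, b k]%classic) (fun k => @segment_compact R _ _).
by congr compact; apply/seteqP; split => x /= H k; have := H k; rewrite /= in_itv.
Qed.

Lemma cbox_closed a b : closed (cbox a b).
Proof. by apply: compact_closed; [exact: norm_hausdorff|exact: cbox_compact]. Qed.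

Lemma prodfD1 h (i : 'I_n) (f : R -> R) x :
  prodf (fun k => if k == i then f else h k) x =
  f (x ord0 i) * \prod_(k < n | k != i) h k (x ord0 k).
Proof.
rewrite /prodf (bigD1 i)//= eqxx; congr (_ * _).
by apply: eq_bigr => k /negPf ->.
Qed.

Lemma is_derive_prodf h (i : 'I_n) (x : V) : derivable (h i) (x ord0 i) 1 ->
  is_derive x (delta_mx ord0 i) (prodf h)
    (prodf (fun k => if k == i then derive1 (h i) else h k) x).
Proof.
move=> dh; rewrite prodfD1 mulrC.
set c := \prod_(k < n | _) _.
have E (s : R) : prodf h (s *: delta_mx ord0 i + x) = c * h i (s *: (1 : R) + x ord0 i).
  rewrite /prodf (bigD1 i)//= mulrC !mxE !eqxx; congr (_ * _).
  apply: eq_bigr => k /negPf ki; rewrite !mxE eqxx/= ki.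
  by rewrite mulr0 add0r.
have E0 : prodf h x = c * h i (x ord0 i).
  by have := E 0; rewrite !scale0r !add0r.
have : (fun s : R => s^-1 *: ((prodf h \o shift x) (s *: delta_mx ord0 i) - prodf h x)) @ 0^'
    --> c * derive1 (h i) (x ord0 i).
  rewrite (_ : (fun s => _) =
    fun s : R => c * (s^-1 *: ((h i \o shift (x ord0 i)) (s *: (1 : R)) - h i (x ord0 i)))).
    by apply: cvgMl_tmp; rewrite derive1E; exact: dh.
  by apply/funext => s; rewrite /= E E0 -mulrBr scalerAr.
by move=> H; apply: DeriveDef; [exact: cvgP H|exact/cvg_lim].
Qed.

Lemma partial_prodf h i : smooth1 (h i) ->
  partial i (prodf h) = prodf (fun k => if k == i then derive1 (h i) else h k).
Proof.
move=> sh; apply/funext => x.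
by have [_] := is_derive_prodf (smooth1_derivable (x := x ord0 i) sh).
Qed.

Lemma continuous_prodf h : (forall k, continuous (h k)) -> continuous (prodf h).
Proof.
move=> ch; rewrite /prodf; elim: (index_enum _) => [|k s ih] x.
  by under eq_fun do rewrite big_nil; exact: cst_continuous.
under eq_fun do rewrite big_cons.
have cx := @coord_continuous R 1 n ord0 k x.
exact: (continuousM (continuous_comp cx (ch k (x ord0 k))) (ih x)).
Qed.

(** A partial derivative of a product of smooth factors is again such a product, so induction on the
    list of derivations stays within the class. *)
Lemma smooth_prodf h : (forall k, smooth1 (h k)) -> smooth (prodf h).
Proof.
move=> sh s.
have [h' [sh' ->]] : exists h', (forall k, smooth1 (h' k)) /\
    foldr (@partial R n) (prodf h) s = prodf h'.
  elim: s => [|i s [h' [sh' IH]]] /=; first by exists h.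
  exists (fun k => if k == i then derive1 (h' i) else h' k); split.
    by move=> k; case: ifP => // _; exact: smooth1_derive1.
  by rewrite IH partial_prodf.
split; first by apply: continuous_prodf => k; exact: smooth1_continuous.
by move=> i x; have [] := is_derive_prodf (smooth1_derivable (x := x ord0 i) (sh' i)).
Qed.

Lemma prodf_out h a b x : (forall k t, ~ `]a k, b k[%classic t -> h k t = 0) ->
  ~ box a b x -> prodf h x = 0.
Proof.
move=> h0 /existsNP[k xk]; rewrite /prodf (bigD1 k)//= h0 ?mul0r//.
Qed.

Lemma test_function_prodf (Omega : set V) h a b : (forall k, smooth1 (h k)) ->
  (forall k t, ~ `]a k, b k[%classic t -> h k t = 0) ->
  cbox a b `<=` Omega -> test_function Omega (prodf h).
Proof.
move=> sh h0 abO.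
have sub : closure [set x | prodf h x != 0] `<=` cbox a b.
  rewrite [X in _ `<=` X](iffLR (closure_id _) (@cbox_closed a b)).
  apply: closure_subset => x /= hx; apply: contrapT => nx; move/eqP: hx; apply.
  apply: (prodf_out h0) => xab; apply: nx => k.
  by have /andP[? ?] := xab k; rewrite !ltW.
split; first exact: smooth_prodf.
- by apply: subclosed_compact sub; [exact: closed_closure|exact: cbox_compact].
- exact: subset_trans sub abO.
Qed.

End product_test_functions.

(** * Spreading along a coordinate *)

Section line_integrals.
Context (R : realType) (n : nat).
Local Notation V := 'rV[R]_n.
Local Notation leb := (@lebesgue_measure R).
Implicit Types (F G H : V -> R) (i : 'I_n) (x : V) (p q : 'I_n -> R).

Definition updc x i (s : R) : V := \row_k (if k == i then s else x ord0 k).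

Definition line F x i : R -> R := fun s => F (updc x i s).

Definition lineint i F x : R := \int[leb]_s line F x i s.

(** The half-line appears as an indicator under an integral over the full line, the form to which
    [measurable_parametric_Rintegral] and [bcont_Rintegral] apply. *)
Definition lineprim i F x : R :=
  \int[leb]_s (\1_`]-oo, x ord0 i]%classic s * line F x i s).

Lemma updcK x i s t : updc (updc x i s) i t = updc x i t.
Proof. by apply/rowP => k; rewrite !mxE; case: eqP. Qed.

Lemma updc_box p q x i s : box p q (updc x i s) -> p i < s < q i.
Proof. by move=> /(_ i); rewrite mxE eqxx. Qed.

Lemma measurable_updc2 i :
  measurable_fun [set: V * R] (fun z : V * R => updc z.1 i z.2).
Proof.
apply: measurable_fun_rV => k; under eq_fun do rewrite mxE.
case: (k == i); first exact: measurable_snd.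
exact: (measurableT_comp (measurable_rV_coord k) measurable_fst).
Qed.

Lemma measurable_updc x i : measurable_fun [set: R] (updc x i).
Proof.
apply: measurable_fun_rV => k; under eq_fun do rewrite mxE.
by case: (k == i); [exact: measurable_id|exact: measurable_cst].
Qed.

Lemma bsupp_line p q F x i : bsupp (box p q) F ->
  bsupp `]p i, q i[%classic (line F x i).
Proof.
move=> [mF [M FM] F0]; split.
- exact: (measurableT_comp mF (measurable_updc x i)).
- by exists M => s; exact: FM.
- by move=> s ps; apply: F0 => /updc_box; rewrite -(in_itv _ `]p i, q i[).
Qed.

Lemma integrable_line p q F x i : bsupp (box p q) F ->
  leb.-integrable setT (EFin \o line F x i).
Proof. by move=> bF; exact: bsupp_integrable1 (bsupp_line x i bF). Qed.

Lemma measurable_parametric_Rintegral (K : V * R -> R) :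
  measurable_fun setT K -> measurable_fun setT (fun x => \int[leb]_s K (x, s)).
Proof.
move=> mK; apply: measurableT_comp => //=.
have mEK : measurable_fun setT (EFin \o K) by exact/measurable_EFinP.
rewrite (_ : (fun x => _) = (fun x =>
    \int[leb]_s ((EFin \o K)^\+ (x, s)) - \int[leb]_s ((EFin \o K)^\- (x, s)))%E); last first.
  apply/funext => x; rewrite [LHS]integralE.
  congr (_ - _)%E; apply: eq_integral => s _.
    by rewrite !funeposE.
  by rewrite !funenegE.
apply: emeasurable_funB.
- apply: (@measurable_fun_fubini_tonelli_F _ _ _ _ _ leb ((EFin \o K)^\+)%E) => //.
  exact: measurable_funepos.
- apply: (@measurable_fun_fubini_tonelli_F _ _ _ _ _ leb ((EFin \o K)^\-)%E) => //.
  exact: measurable_funeneg.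
Qed.

Lemma measurable_lineint F i : measurable_fun setT F -> measurable_fun setT (lineint i F).
Proof.
move=> mF; apply: (@measurable_parametric_Rintegral (fun z => F (updc z.1 i z.2))).
exact: (measurableT_comp mF (@measurable_updc2 i)).
Qed.

Lemma measurable_lineprim F i : measurable_fun setT F -> measurable_fun setT (lineprim i F).
Proof.
move=> mF; apply: (@measurable_parametric_Rintegral
  (fun z => \1_`]-oo, z.1 ord0 i]%classic z.2 * F (updc z.1 i z.2))).
apply: measurable_funM; last first.
  exact: (measurableT_comp mF (@measurable_updc2 i)).
pose A : set (V * R) := [set z : V * R | 0 <= z.1 ord0 i - z.2].
rewrite (_ : (fun z => _) = \1_A :> (V * R -> R)); last first.
  apply/funext => z; rewrite !indicE; congr (_ %:R); congr nat_of_bool.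
  by apply/idP/idP; rewrite !inE /A /= subr_ge0 in_itv.
apply: measurable_indic.
have mf : measurable_fun [set: V * R] (fun z : V * R => z.1 ord0 i - z.2).
  apply: measurable_funB => //.
  exact: (measurableT_comp (measurable_rV_coord i) measurable_fst).
have := mf measurableT `[0, +oo[%classic (measurable_itv _).
by rewrite setTI; congr measurable; apply/seteqP; split => z /=; rewrite in_itv/= andbT.
Qed.

Lemma lineint_updc F x i s : lineint i F (updc x i s) = lineint i F x.
Proof. by apply: eq_Rintegral => t _; rewrite /line updcK. Qed.

Lemma line_eq0 p q F x i : bsupp (box p q) F -> (exists2 k, k != i & ~~ (p k < x ord0 k < q k)) ->
  line F x i = (fun=> 0).
Proof.
move=> [_ _ F0] [k /negPf ki xk]; apply/funext => s; apply: F0 => /(_ k).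
by rewrite mxE ki; exact/negP.
Qed.

Lemma lineint_le F G x i p q : bsupp (box p q) F -> bsupp (box p q) G ->
  (forall y, F y <= G y) -> lineint i F x <= lineint i G x.
Proof.
move=> bF bG FG; apply: le_Rintegral => //; [exact: (integrable_line _ _ bF)|
  exact: (integrable_line _ _ bG)|by move=> s _; exact: FG].
Qed.

Lemma lineint_norm F x i p q : bsupp (box p q) F ->
  `|lineint i F x| <= lineint i (fun y => `|F y|) x.
Proof.
by move=> bF; apply: le_normr_Rintegral => //; exact: (integrable_line _ _ bF).
Qed.

Lemma lineprim_norm F x i p q : bsupp (box p q) F ->
  `|lineprim i F x| <= lineint i (fun y => `|F y|) x.
Proof.
move=> bF; have bl := bsupp_line x i bF.
have bl1 : bsupp `]p i, q i[%classic (fun s => \1_`]-oo, x ord0 i]%classic s * line F x i s).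
  apply: bsuppM => //; exists 1 => s.
  by rewrite indicE; case: (_ \in _); rewrite ?normr1 ?normr0.
apply: (le_trans (le_normr_Rintegral _ _)) => //; first exact: bsupp_integrable1 bl1.
apply: le_Rintegral => //.
- exact: bsupp_integrable1 (bsupp_norm bl1).
- exact: bsupp_integrable1 (bsupp_norm bl).
- move=> s _; rewrite normrM ler_piMl// indicE.
  by case: (_ \in _); rewrite ?normr1 ?normr0.
Qed.

Lemma lineint_bound F x i p q M : bsupp (box p q) F -> (forall y, `|F y| <= M) ->
  lineint i (fun y => `|F y|) x <= M * fine (leb `]p i, q i[%classic).
Proof.
move=> bF FM; have bl := bsupp_line x i (bsupp_norm bF).
have bM : bsupp `]p i, q i[%classic (fun s => M * (\1_`]p i, q i[%classic s : R)).
  by apply: bsuppZ; exact: bsupp_indic.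
apply: (@le_trans _ _ (\int[leb]_s (M * (\1_`]p i, q i[%classic s : R)))).
  apply: le_Rintegral => //; [exact: bsupp_integrable1 bl|exact: bsupp_integrable1 bM|].
  move=> s _; rewrite indicE; have [_|/negP sp] := boolP (_ \in _); first by rewrite mulr1 FM.
  by case: bl => _ _ ->; rewrite ?mulr0// => ?; apply: sp; rewrite inE.
rewrite RintegralZl//; last by apply: (@bsupp_integrable1 _ (p i) (q i)); exact: bsupp_indic.
by rewrite /Rintegral integral_indic// setIT.
Qed.

Lemma bcont_pull Q (u : R -> V) (p q : R) (Phi : (R -> R) -> R) :
  (forall F, bsupp Q F -> bsupp `]p, q[%classic (F \o u)) -> bcont `]p, q[%classic Phi ->
  bcont Q (fun F => Phi (F \o u)).
Proof.
move=> bu [Pl Pc]; split => [a F G bF bG|F_ F [bF [M FM] cF]].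
  by have := Pl a _ _ (bu _ bF) (bu _ bG).
apply: (Pc (fun k => F_ k \o u) (F \o u)); split => [k||s].
- exact: bu.
- by exists M => k s; exact: FM.
- exact: cF.
Qed.

Lemma bcont_lineint p q x i : bcont (box p q) (fun F => lineint i F x).
Proof.
apply: (@bcont_pull _ (updc x i) (p i) (q i) (fun f => \int[leb]_s f s)).
  by move=> F; exact: bsupp_line.
apply: (@bcont_int _ (measurableTypeR R) R leb `]p i, q i[%classic) => //.
exact: itv_fin.
Qed.

Lemma bcont_lineprim p q x i : bcont (box p q) (fun F => lineprim i F x).
Proof.
apply: (@bcont_pull _ (updc x i) (p i) (q i)
  (fun f => \int[leb]_s (\1_`]-oo, x ord0 i]%classic s * f s))).
  by move=> F; exact: bsupp_line.
(* A half-line has infinite length. Cutting the kernel to the side of the box makes it integrable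
   without changing its action on functions supported there. *)
have iK : leb.-integrable setT (EFin \o (fun s =>
    \1_`]-oo, x ord0 i]%classic s * \1_`]p i, q i[%classic s : R)).
  apply: (@bsupp_integrable1 _ (p i) (q i)); apply: bsuppM => //.
    exact: bsupp_indic.
  exists 1 => s; rewrite indicE; case: (_ \in _); rewrite ?normr1 ?normr0//.
have [l c] := @bcont_Rintegral _ (measurableTypeR R) R leb `]p i, q i[%classic _ iK.
have E f : bsupp `]p i, q i[%classic f ->
    \int[leb]_s (\1_`]-oo, x ord0 i]%classic s * \1_`]p i, q i[%classic s * f s) =
    \int[leb]_s (\1_`]-oo, x ord0 i]%classic s * f s).
  move=> [_ _ f0]; apply: eq_Rintegral => s _; rewrite [X in _ * X * _]indicE.
  have [_|/negP sp] := boolP (s \in `]p i, q i[%classic); first by rewrite mulr1.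
  by rewrite f0 ?mulr0// => ?; apply: sp; rewrite inE.
split => [a f g bf bg|f_ f cf].
  by rewrite -E ?l// ?E//; exact: bsuppDZ.
have bf := bounded_cvg_bsupp cf; have [bf_ _ _] := cf.
have := c f_ f cf; rewrite E//; under eq_fun do rewrite E//; exact.
Qed.

End line_integrals.

Section bounded_operators.
Context d (T : measurableType d) (R : realType).
Implicit Types (F G : T -> R) (Q : set T) (U : (T -> R) -> T -> R).

(** The counterpart of [bcont] for operators, designed so that a [bcont] functional composed with
    such an operator is again [bcont]. *)
Definition bop Q U := [/\ forall F, bsupp Q F -> bsupp Q (U F),
  forall a F G, bsupp Q F -> bsupp Q G ->
    U (fun x => a * F x + G x) = (fun x => a * U F x + U G x) &
  forall (F_ : nat -> T -> R) F, bounded_cvg Q F_ F ->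
    bounded_cvg Q (fun k => U (F_ k)) (U F)].

Lemma bcont_bop Q U Phi : bop Q U -> bcont Q Phi -> bcont Q (fun F => Phi (U F)).
Proof.
move=> [Ub Ul Uc] [Pl Pc]; split => [a F G bF bG|F_ F cF].
  by rewrite Ul// Pl//; exact: Ub.
by apply: Pc; exact: Uc.
Qed.

Lemma bop_comp Q U U' : bop Q U -> bop Q U' -> bop Q (fun F => U (U' F)).
Proof.
move=> [Ub Ul Uc] [Ub' Ul' Uc']; split.
- by move=> F bF; apply: Ub; exact: Ub'.
- by move=> a F G bF bG; rewrite Ul'// Ul//; exact: Ub'.
- by move=> F_ F cF; apply: Uc; exact: Uc'.
Qed.

Lemma bop_id Q : bop Q id.
Proof. by []. Qed.

Lemma bop_subid Q U : bop Q U -> bop Q (fun F x => F x - U F x).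
Proof.
move=> [Ub Ul Uc]; split.
- by move=> F bF; apply: bsuppB => //; exact: Ub.
- by move=> a F G bF bG; apply/funext => x; rewrite Ul//; lra.
- move=> F_ F cF; have [bUF [N UN] cUF] := Uc _ _ cF; case: cF => bF [M FM] cF; split.
  + by move=> k; exact: bsuppB.
  + exists (M + N) => k x; rewrite (le_trans (ler_normB _ _))// lerD//.
  + by move=> x; apply: cvgB; [exact: cF|exact: cUF].
Qed.

End bounded_operators.

Section spreading.
Context (R : realType) (n : nat).
Local Notation V := 'rV[R]_n.
Local Notation leb := (@lebesgue_measure R).
Local Notation mu := (@lebesgue_rV R n).
Variables (p q : 'I_n -> R).
Implicit Types (F G H : V -> R) (i : 'I_n) (x : V) (sigma : R -> R).
Local Notation Q := (box p q).

(* Replaces the profile of F in the i-th coordinate by the fixed profile sigma,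
   keeping the mass of F on each line. *)
Definition spread sigma i F x : R := sigma (x ord0 i) * lineint i F x.

Lemma box_coord_out x : ~ Q x -> exists k, ~~ (p k < x ord0 k < q k).
Proof. by move=> /existsNP[k /negP xk]; exists k. Qed.

(** The coordinate that leaves the box is then another one, and it is constant on the line, which
    misses the box altogether. *)
Lemma lineint_out F i x : bsupp Q F -> ~ Q x -> p i < x ord0 i < q i ->
  lineint i F x = 0.
Proof.
move=> bF /box_coord_out[k xk] xi.
have ki : k != i by apply: contraTneq xi => <-.
by rewrite /lineint (line_eq0 bF) ?Rintegral_cst ?mul0r//; exists k.
Qed.

Lemma bop_spread sigma i : bsupp `]p i, q i[%classic sigma -> bop Q (spread sigma i).
Proof.
move=> [ms [N sN] s0].
have bs F : bsupp Q F -> bsupp Q (spread sigma i F).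
  move=> bF; have [mF [M FM] F0] := bF; split.
  - apply: measurable_funM; last exact: measurable_lineint.
    exact: (measurableT_comp ms (measurable_rV_coord i)).
  - exists (N * (M * fine (leb `]p i, q i[%classic))) => x.
    rewrite normrM ler_pM//.
    exact: (le_trans (lineint_norm _ _ bF) (lineint_bound _ _ bF FM)).
  - move=> x Qx; rewrite /spread.
    have [xi|/negP xi] := boolP (p i < x ord0 i < q i).
      by rewrite (lineint_out bF) ?mulr0.
    by rewrite s0 ?mul0r//= in_itv.
split => //.
- move=> a F G bF bG; apply/funext => x; rewrite /spread.
  by rewrite ((bcont_lineint p q x i).1 a F G bF bG); lra.
- move=> F_ F [bF [M FM] cF]; split.
  + by move=> k; exact: bs.
  + exists (N * (M * fine (leb `]p i, q i[%classic))) => k x.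
    rewrite normrM ler_pM//.
    exact: (le_trans (lineint_norm _ _ (bF k)) (lineint_bound _ _ (bF k) (FM k))).
  + move=> x; apply: cvgMl_tmp; apply: (bcont_lineint p q x i).2.
    by split => //; exists M.
Qed.

Lemma spread_ge0 sigma i F x : (forall s, 0 <= sigma s) -> (forall y, 0 <= F y) ->
  0 <= spread sigma i F x.
Proof. by move=> s0 F0; rewrite mulr_ge0//; apply: Rintegral_ge0 => s _; exact: F0. Qed.

Lemma spread_le sigma i F G x : (forall s, 0 <= sigma s) ->
  bsupp Q F -> bsupp Q G -> (forall y, F y <= G y) ->
  spread sigma i F x <= spread sigma i G x.
Proof. by move=> s0 bF bG FG; rewrite ler_wpM2l// (lineint_le _ _ bF bG). Qed.

Lemma spread_norm sigma i F x : (forall s, 0 <= sigma s) -> bsupp Q F ->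
  `|spread sigma i F x| <= spread sigma i (fun y => `|F y|) x.
Proof.
by move=> s0 bF; rewrite normrM (ger0_norm (s0 _)) ler_wpM2l// (lineint_norm _ _ bF).
Qed.

Lemma lineint_spread sigma i F x : bsupp `]p i, q i[%classic sigma ->
  lineint i (spread sigma i F) x = (\int[leb]_s sigma s) * lineint i F x.
Proof.
move=> bs; rewrite -RintegralZr//; last exact: bsupp_integrable1 bs.
by apply: eq_Rintegral => s _; rewrite /line /spread lineint_updc mxE eqxx.
Qed.

Lemma spread_prodf sigma i (h : 'I_n -> R -> R) :
  leb.-integrable setT (EFin \o h i) ->
  spread sigma i (prodf h) =
  prodf (fun k => if k == i then (fun s => (\int[leb]_t h i t) * sigma s) else h k).
Proof.
move=> ih; apply/funext => x; rewrite prodfD1 /spread /lineint.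
rewrite (_ : line (prodf h) x i = fun s => h i s * \prod_(k < n | k != i) h k (x ord0 k)).
  by rewrite RintegralZr//; lra.
apply/funext => s; rewrite /line /prodf (bigD1 i)//= mxE eqxx; congr (_ * _).
by apply: eq_bigr => k /negPf ki; rewrite mxE ki.
Qed.

(** This replaces Fubini in an arbitrary coordinate: both sides are [bcont] functionals of [F], and
    on the indicator of a box all integrals factor into one-variable ones. *)
Lemma int_spread sigma i F : (forall s, 0 <= sigma s) ->
  bsupp `]p i, q i[%classic sigma -> bsupp Q F ->
  \int[mu]_x spread sigma i F x = (\int[leb]_s sigma s) * \int[mu]_x F x.
Proof.
move=> s0 bs bF; apply/eqP; rewrite -subr_eq0 addrC -mulNr; apply/eqP.
have bi : bcont Q (fun F : V -> R => \int[mu]_x F x).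
  by apply: bcont_int; [exact: box_measurable|exact: box_finite].
apply: (@bcont_box _ _ (fun F => - (\int[leb]_s sigma s) * (\int[mu]_x F x) +
    \int[mu]_x spread sigma i F x) p q _ _ F bF).
  by apply: bcont_comb => //; apply: bcont_bop bi; exact: bop_spread.
move=> a b pa ab bq; rewrite box_prodf spread_prodf//; last exact: integrable_indic_itv.
have [ms _ _] := bs.
have I0 k : 0 <= \int[leb]_t \1_`]a k, b k[%classic t :> R by apply: Rintegral_ge0.
have is_ := bsupp_integrable1 bs.
rewrite !Rintegral_prodf//; last 4 first.
- by move=> k; case: ifP => // _; apply: measurable_funM.
- by move=> k s; case: ifP => // _; rewrite mulr_ge0.
- move=> k; case: ifP => // _; last exact: integrable_indic_itv.
  by apply: (@bsupp_integrable1 _ (p i) (q i)); exact: bsuppZ.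
- by move=> k; exact: integrable_indic_itv.
rewrite (bigD1 i)//= [X in _ + X](bigD1 i)//= eqxx RintegralZl//.
rewrite [X in _ + _ * X](eq_bigr (fun k => \int[leb]_t \1_`]a k, b k[%classic t)).
  by lra.
by move=> k /negPf ->.
Qed.

End spreading.

(** * Transport inside a single box *)

Section transport_in_box.
Context (R : realType) (n : nat).
Local Notation V := 'rV[R]_n.
Local Notation leb := (@lebesgue_measure R).
Local Notation mu := (@lebesgue_rV R n).
Variables (p q : 'I_n -> R) (rho : 'I_n -> R -> R).
Hypothesis srho : forall k, smooth1 (rho k).
Hypothesis rho0 : forall k s, 0 <= rho k s.
Hypothesis brho : forall k, bsupp `]p k, q k[%classic (rho k).
Hypothesis Irho : forall k, \int[leb]_s rho k s = 1.
Implicit Types (F G H : V -> R) (i : 'I_n) (x : V).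
Local Notation Q := (box p q).

(* The vector field [flow i F] along the i-th axis moves F to its spread: F and
   its spread have the same integral on each line, so that the primitive of the
   difference vanishes outside the box. *)
Definition flow i F x : R :=
  lineprim i (fun y => F y - spread (rho i) i F y) x.

Lemma bsupp_diff i F : bsupp Q F -> bsupp Q (fun y => F y - spread (rho i) i F y).
Proof. by move=> bF; apply: bsuppB => //; case: (bop_spread (brho i)) => + _ _; exact. Qed.

Lemma lineint_diff i F x : bsupp Q F ->
  lineint i (fun y => F y - spread (rho i) i F y) x = 0.
Proof.
move=> bF; rewrite (bcontB (bcont_lineint p q x i))//.
  by rewrite (lineint_spread _ x (brho i)) Irho mul1r subrr.
by case: (bop_spread (brho i)) => + _ _; exact.
Qed.

(** The 2 accounts for [F] and for its spread, which have line integrals of absolute values bounded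
    by the same number. The bound is itself a spread, with an indicator as profile, so the lemmas on
    [spread] give its integral. *)
Lemma flow_norm i F x : bsupp Q F ->
  `|flow i F x| <= spread (fun s => 2 * \1_`]p i, q i[%classic s) i (fun y => `|F y|) x.
Proof.
move=> bF; have bd := bsupp_diff i bF.
have bs : bsupp Q (spread (rho i) i F) by case: (bop_spread (brho i)) => + _ _; exact.
rewrite /spread indicE; have [xi|xi] := boolP (_ \in _); last first.
  rewrite mulr0 mul0r normr_le0; apply/eqP; move: xi => /negP.
  rewrite inE/= in_itv/= => /negP; rewrite negb_and -!leNgt => /orP[xp|qx].
    rewrite /flow /lineprim (@eq_Rintegral _ _ _ _ _ (fun=> 0)) ?Rintegral_cst ?mul0r//.
    move=> s _; rewrite indicE; have [/set_mem/=|_] := boolP (_ \in _); last by rewrite mul0r.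
    rewrite in_itv/= => sx; case: (bsupp_line x i bd) => _ _ ->; rewrite ?mulr0//= in_itv/=.
    by rewrite ltNge (le_trans sx xp).
  (* Beyond [q i] the primitive has collected the whole line integral of the difference, which is
     0. *)
  rewrite -(lineint_diff i x bF); apply: eq_Rintegral => s _.
  rewrite indicE; have [_|/negP sx] := boolP (_ \in _); first by rewrite mul1r.
  rewrite mul0r; case: (bsupp_line x i bd) => _ _ ->//=; rewrite in_itv/=.
  move=> /andP[_ sq]; apply: sx; rewrite inE/= in_itv/=.
  exact: le_trans (ltW sq) qx.
rewrite mulr1 (le_trans (lineprim_norm _ _ bd))//.
have bn := bsupp_norm bF; have bns := bsupp_norm bs.
have bsn : bsupp Q (spread (rho i) i (fun y => `|F y|)).
  by case: (bop_spread (brho i)) => + _ _; exact.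
have bsum : bsupp Q (fun y => `|F y| + spread (rho i) i (fun y => `|F y|) y).
  by have := bsuppDZ 1 bn bsn; under [X in bsupp _ X -> _]eq_fun do rewrite mul1r.
apply: (@le_trans _ _ (lineint i (fun y => `|F y| + spread (rho i) i (fun y => `|F y|) y) x)).
  apply: (lineint_le _ _ (bsupp_norm bd) bsum) => y.
  by rewrite (le_trans (ler_normB _ _))// lerD2l (spread_norm i y (@rho0 i) bF).
rewrite (bcontD (bcont_lineint p q x i))//.
by rewrite (lineint_spread _ x (brho i)) Irho mul1r -mulr2n mulr_natl.
Qed.

Lemma bop_flow i : bop Q (flow i).
Proof.
have [db dl dc] := bop_subid (bop_spread (brho i)).
have b2 : bsupp `]p i, q i[%classic (fun s => 2 * \1_`]p i, q i[%classic s : R).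
  by apply: bsuppZ; exact: bsupp_indic.
have [sb _ sc] := bop_spread b2.
have fb F : bsupp Q F -> bsupp Q (flow i F).
  move=> bF; have [_ [M FM] s0] := sb _ (bsupp_norm bF); split.
  - by apply: measurable_lineprim; case: (db _ bF).
  - exists M => x; rewrite (le_trans (flow_norm i x bF))//.
    exact: le_trans (ler_norm _) (FM x).
  - move=> x Qx; apply/eqP; rewrite -normr_le0.
    by rewrite (le_trans (flow_norm i x bF))// s0.
split => //.
- move=> a F G bF bG; apply/funext => x; rewrite /flow.
  rewrite -((bcont_lineprim p q x i).1 a _ _ (db _ bF) (db _ bG)).
  by congr lineprim; exact: (dl a F G bF bG).
- move=> F_ F cF; have [bF [M FM] cFx] := cF; split.
  + by move=> k; exact: fb.
  + exists (2 * (M * fine (leb `]p i, q i[%classic))) => k x.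
    have h := flow_norm i x (bF k).
    have h2 := lineint_bound x i (bF k) (FM k).
    apply: (le_trans h); rewrite /spread -mulrA ler_wpM2l//.
    rewrite (le_trans _ h2)// ler_piMl//.
    by apply: Rintegral_ge0 => s _; exact: normr_ge0.
  + by move=> x; apply: (bcont_lineprim p q x i).2; exact: dc.
Qed.

(** All that the transport in a box uses about [g] and its gradient [h]: the weak identity against
    product test functions of that box. *)
Definition ibp (g : V -> R) (h : 'I_n -> V -> R) := forall i (e : 'I_n -> R -> R),
  (forall k, smooth1 (e k)) -> (forall k t, ~ `]p k, q k[%classic t -> e k t = 0) ->
  \int[mu]_x (g x * partial i (prodf e) x) = - \int[mu]_x (h i x * prodf e x).

Lemma flow_prodf i (e : 'I_n -> R -> R) : (forall k, smooth1 (e k)) ->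
  (forall k, bsupp `]p k, q k[%classic (e k)) ->
  flow i (prodf e) = prodf (fun k => if k == i then
     primitive (fun s => e i s - (\int[leb]_t e i t) * rho i s) else e k).
Proof.
move=> se be; apply/funext => x; rewrite prodfD1 /flow /lineprim.
rewrite spread_prodf; last exact: bsupp_integrable1 (be i).
rewrite /primitive [X in _ = X * _]Rintegral_mkcond -RintegralZr//; last first.
  have bd : bsupp `]p i, q i[%classic (fun s => e i s - (\int[leb]_t e i t) * rho i s).
    by apply: bsuppB => //; exact: bsuppZ.
  have -> : EFin \o ((fun s => e i s - (\int[leb]_t e i t) * rho i s) \_ `]-oo, x ord0 i]) =
      (EFin \o (fun s => e i s - (\int[leb]_t e i t) * rho i s)) \_ `]-oo, x ord0 i].
    by rewrite restrict_EFin.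
  apply/integrable_restrict => //; rewrite setTI.
  by apply: (@integrableS _ _ _ leb setT) => //; exact: bsupp_integrable1 bd.
apply: eq_Rintegral => s _; rewrite patchE indicE /line.
rewrite prodfD1 /prodf (bigD1 i)//= !mxE eqxx.
rewrite [X in e i s * X](eq_bigr (fun k => e k (x ord0 k))); last first.
  by move=> k /negPf ki; rewrite mxE ki.
rewrite [X in _ - _ * X](eq_bigr (fun k => e k (x ord0 k))); last first.
  by move=> k /negPf ki; rewrite mxE ki.
by case: ifPn => _; rewrite ?mul1r ?mul0r -?mulrBl.
Qed.

(** Weak form of the fact that [flow i F] has [F] minus its spread as its derivative in the
    direction [i]. Both sides are [bcont] in [F]; on products of bumps the flow is a smooth product
    and [ibp] applies to it. *)
Lemma flow_ibp (g : V -> R) (h : 'I_n -> V -> R) i F :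
  mu.-integrable setT (EFin \o g) -> mu.-integrable setT (EFin \o h i) ->
  ibp g h -> bsupp Q F ->
  \int[mu]_x (h i x * flow i F x) =
  - \int[mu]_x (g x * (F x - spread (rho i) i F x)).
Proof.
move=> ig ih gh bF.
pose Phi F := 1 * \int[mu]_x (h i x * flow i F x) +
  \int[mu]_x (g x * (F x - spread (rho i) i F x)).
suff : Phi F = 0 by rewrite /Phi mul1r => /eqP; rewrite addr_eq0 => /eqP.
have bPhi : bcont Q Phi.
  apply: bcont_comb.
    apply: (@bcont_bop _ _ _ _ (flow i) (fun F => \int[mu]_x (h i x * F x))).
      exact: bop_flow.
    exact: bcont_Rintegral.
  apply: (@bcont_bop _ _ _ _ (fun F x => F x - spread (rho i) i F x)
    (fun F => \int[mu]_x (g x * F x))).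
    exact/bop_subid/bop_spread.
  exact: bcont_Rintegral.
apply: (@bcont_box _ _ Phi p q) => // a b pa ab bq.
(* Products of these bumps tend boundedly to the indicator of the box. *)
pose e m k := bump (a k) (b k) m.+1%:R^-1.
have m0 m : 0 < m.+1%:R^-1 :> R by rewrite invr_gt0.
have abpq k : `]a k, b k[%classic `<=` `]p k, q k[%classic.
  by move=> t; rewrite /= !in_itv/= => /andP[? ?]; rewrite (le_lt_trans (pa k))//= (lt_le_trans _ (bq k)).
have be m k : bsupp `]p k, q k[%classic (e m k).
  by apply: (bsuppS (abpq k)); exact: bump_bsupp.
have se m k : smooth1 (e m k) by exact: bump_smooth.
have e01 m k t : 0 <= e m k t <= 1 by exact: bump_itv.
have Phi0 m : Phi (prodf (e m)) = 0.
  rewrite /Phi flow_prodf//.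
  set f := fun s => e m i s - _.
  have bf : bsupp `]p i, q i[%classic f by apply: bsuppB => //; exact: bsuppZ.
  have sf : smooth1 f by apply: smooth1B => //; exact: smooth1Z.
  have If : \int[leb]_s f s = 0.
    rewrite /f RintegralB//; [|exact: bsupp_integrable1 (be m i)|]; last first.
      by apply: (@bsupp_integrable1 _ (p i) (q i)); exact: bsuppZ.
    by rewrite RintegralZl// ?Irho ?mulr1 ?subrr//; exact: bsupp_integrable1 (brho i).
  have dP := is_derive_primitive (smooth1_continuous sf) bf.
  have sP : smooth1 (primitive f) := smooth1_prim sf dP.
  (* The factors of [flow i (prodf (e m))]. Differentiating the factor [i] gives back [f], so the
     partial derivative of the product is [prodf (e m)] minus its spread. *)
  pose eP k := if k == i then primitive f else e m k.
  have seP k : smooth1 (eP k) by rewrite /eP; case: ifP.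
  have := gh i eP seP; rewrite partial_prodf//.
  have -> : prodf (fun k => if k == i then derive1 (eP i) else eP k) =
      (fun x : V => prodf (e m) x - spread (rho i) i (prodf (e m)) x).
    apply/funext => x; rewrite spread_prodf; last exact: bsupp_integrable1 (be m i).
    rewrite (_ : prodf (e m) x = e m i (x ord0 i) * \prod_(k < n | k != i) e m k (x ord0 k)); last first.
      by rewrite /prodf (bigD1 i).
    rewrite !prodfD1 -mulrBl {1}/eP eqxx.
    have -> : derive1 (primitive f) = f.
      by apply/funext => t; rewrite derive1E; case: (dP t).
    by congr (_ * _); apply: eq_bigr => k /negPf ki; rewrite /eP ki.
  move=> ->; first by rewrite mul1r subrr.
  move=> k t kt; rewrite /eP; case: eqP => ki.
    by subst k; exact: (primitive_out bf If).
  by case: (be m k) => _ _; exact.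
have : Phi (prodf (e m)) @[m --> \oo] --> Phi \1_(box a b).
  apply: bPhi.2; split.
  - move=> m; split.
    + by apply: measurable_prodf => k; case: (be m k).
    + exists 1 => x; rewrite ger0_norm.
        by apply: prodr_ile1 => k _; exact: e01.
      by apply: prodr_ge0 => k _; case/andP: (e01 m k (x ord0 k)).
    + by move=> x; apply: prodf_out => k t; case: (be m k) => _ _; exact.
  - exists 1 => m x; rewrite ger0_norm.
      by apply: prodr_ile1 => k _; exact: e01.
    by apply: prodr_ge0 => k _; case/andP: (e01 m k (x ord0 k)).
  - move=> x; rewrite box_prodf /prodf; elim: (index_enum _) => [|k s IH].
      by under eq_fun do rewrite big_nil; rewrite big_nil; exact: cvg_cst.
    under eq_fun do rewrite big_cons; rewrite big_cons; apply: cvgM => //.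
    exact: bump_cvg.
under eq_fun do rewrite Phi0.
by move=> /cvg_lim <-//; rewrite lim_cst.
Qed.

(** The head of the list is the coordinate treated last; [weight] and [flows] follow the same
    order. *)
Fixpoint spreads (s : seq 'I_n) F : V -> R :=
  if s is i :: s' then spread (rho i) i (spreads s' F) else F.

Lemma bop_spreads s : bop Q (spreads s).
Proof.
elim: s => [|i s ih]; first exact: bop_id.
by apply: bop_comp => //; exact: bop_spread.
Qed.

Lemma spreads_ge0 s F x : (forall y, 0 <= F y) -> 0 <= spreads s F x.
Proof. by move=> F0; elim: s x => [//|i s ih] x; exact: spread_ge0. Qed.

Lemma spreads_norm s F H M : bsupp Q F -> bsupp Q H ->
  (forall y, `|F y| <= M * H y) -> forall x, `|spreads s F x| <= M * spreads s H x.
Proof.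
move=> bF bH FH; have [sb _ _] := bop_spreads s.
elim: s {sb} => [//|i s ih] x /=.
have [sb _ _] := bop_spreads s.
rewrite (le_trans (spread_norm i x (@rho0 i) (sb _ bF)))//.
have -> : M * spread (rho i) i (spreads s H) x = spread (rho i) i (fun y => M * spreads s H y) x.
  rewrite /spread (bcontZ M (bcont_lineint p q x i) (sb _ bH)); lra.
apply: (spread_le i x (@rho0 i) (bsupp_norm (sb _ bF)) _ ih).
exact: bsuppZ (sb _ bH).
Qed.

Lemma int_spreads s F : bsupp Q F -> \int[mu]_x spreads s F x = \int[mu]_x F x.
Proof.
move=> bF; elim: s => [//|i s ih] /=; have [sb _ _] := bop_spreads s.
by rewrite (int_spread (@rho0 i) (brho i) (sb _ bF)) Irho mul1r.
Qed.

Lemma spreads_prodf s (h : 'I_n -> R -> R) : uniq s ->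
  (forall k, leb.-integrable setT (EFin \o h k)) ->
  spreads s (prodf h) =
  prodf (fun k => if k \in s then (fun t => (\int[leb]_t h k t) * rho k t) else h k).
Proof.
move=> + ih; elim: s => [|i s IH] /=.
  by move=> _; apply/funext => x; apply: eq_bigr => k _.
move=> /andP[nis us]; rewrite IH// spread_prodf ?(negPf nis)//.
apply/funext => x; apply: eq_bigr => k _.
by rewrite in_cons; case: eqP => [->|//].
Qed.

(** On the indicator of a box each factor is replaced by its integral times [rho k], so only the
    total mass survives; [bcont_box] extends this to all [F]. *)
Lemma spreads_all F : bsupp Q F ->
  spreads (enum 'I_n) F = (fun x => (\int[mu]_y F y) * prodf rho x).
Proof.
move=> bF; apply/funext => x; apply/eqP; rewrite -subr_eq0 addrC mulrC -mulNr; apply/eqP.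
have bi : bcont Q (fun F : V -> R => \int[mu]_x F x).
  by apply: bcont_int; [exact: box_measurable|exact: box_finite].
have [sb sl sc] := bop_spreads (enum 'I_n).
apply: (@bcont_box _ _ (fun F => - prodf rho x * (\int[mu]_y F y) +
    spreads (enum 'I_n) F x) p q _ _ F bF).
  apply: bcont_comb => //; split; first by move=> a F' G' bF' bG'; rewrite sl.
  by move=> F_ F' cF'; have [_ _] := sc _ _ cF'; exact.
move=> a b pa ab bq; rewrite box_prodf Rintegral_prodf//; last first.
  by move=> k; exact: integrable_indic_itv.
rewrite spreads_prodf ?enum_uniq//; last by move=> k; exact: integrable_indic_itv.
rewrite /prodf mulNr -big_split/= addrC; apply/eqP; rewrite subr_eq0; apply/eqP.
by apply: eq_bigr => k _; rewrite mem_enum mulrC.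
Qed.

(** Sum over the successive steps of the bounds of [flow_norm], with a density [H] in place of the
    absolute value of the datum. *)
Fixpoint weight (s : seq 'I_n) H : V -> R :=
  if s is i :: s' then
    fun x => spread (fun t => 2 * \1_`]p i, q i[%classic t) i (spreads s' H) x + weight s' H x
  else fun=> 0.

(** A step along [i] contributes to the component [i] only. Since the lists used have no repetition,
    each component receives exactly one flow and no addition occurs. *)
Fixpoint flows (s : seq 'I_n) F : 'I_n -> V -> R :=
  if s is i :: s' then
    fun k x => if k == i then flow i (spreads s' F) x else flows s' F k x
  else fun _ _ => 0.

Lemma flows_notin s F k : k \notin s -> flows s F k = (fun=> 0).
Proof.
elim: s => [//|i s ih] /=; rewrite in_cons negb_or => /andP[/negPf -> ks].
by apply/funext => x; rewrite ih.
Qed.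

Lemma bsupp_flows s F k : bsupp Q F -> bsupp Q (flows s F k).
Proof.
move=> bF; elim: s => [|i s ih] /=; first exact: bsupp0.
case: eqP => // _; have [fb _ _] := bop_flow i; apply: fb.
by have [sb _ _] := bop_spreads s; exact: sb.
Qed.

Let sig i := fun t => 2 * \1_`]p i, q i[%classic t : R.

Let bsig i : bsupp `]p i, q i[%classic (sig i).
Proof. by apply: bsuppZ; exact: bsupp_indic. Qed.

Let sig0 i t : 0 <= sig i t.
Proof. by rewrite mulr_ge0. Qed.

Lemma bsupp_weight s H : bsupp Q H -> bsupp Q (weight s H).
Proof.
move=> bH; elim: s => [|i s ih] /=; first exact: bsupp0.
have [sb _ _] := bop_spread (bsig i); have [sb' _ _] := bop_spreads s.
have := bsuppDZ 1 (sb _ (sb' _ bH)) ih.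
by under [X in bsupp _ X -> _]eq_fun do rewrite mul1r.
Qed.

Lemma weight_ge0 s H x : (forall y, 0 <= H y) -> 0 <= weight s H x.
Proof.
move=> H0; elim: s => [//|i s ih] /=; rewrite addr_ge0//.
by apply: spread_ge0 => [t|y]; [exact: sig0|exact: spreads_ge0].
Qed.

(** Earlier spreads preserve the mass of [H], so each step costs this mass times twice the side of
    the box. *)
Lemma int_weight L s H : 0 <= L -> (forall k, q k - p k <= L) -> bsupp Q H ->
  (forall y, 0 <= H y) ->
  \int[mu]_x weight s H x <= (size s)%:R * (2 * L) * \int[mu]_x H x.
Proof.
move=> L0 pqL bH H0; elim: s => [|i s ih] /=.
  by rewrite Rintegral_cst// !mul0r.
have bi : bcont Q (fun F : V -> R => \int[mu]_x F x).
  by apply: bcont_int; [exact: box_measurable|exact: box_finite].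
have [sb _ _] := bop_spread (bsig i); have [sb' _ _] := bop_spreads s.
rewrite (bcontD bi (sb _ (sb' _ bH)) (bsupp_weight s bH)).
rewrite (int_spread (@sig0 i) (bsig i) (sb' _ bH)) int_spreads//.
rewrite -natr1 mulrDl mul1r mulrDl addrC lerD// ler_wpM2r//.
  by apply: Rintegral_ge0.
rewrite RintegralZl//; last first.
  by apply: (@bsupp_integrable1 _ (p i) (q i)); exact: bsupp_indic.
rewrite ler_wpM2l// /Rintegral integral_indic// setIT.
suff : fine (leb `]p i, q i[%classic) <= L by [].
rewrite lebesgue_measure_itv/= lte_fin; case: ltP => //= h; exact: pqL.
Qed.

Lemma flows_weight s F H M : bsupp Q F -> bsupp Q H -> 0 <= M ->
  (forall y, 0 <= H y) ->
  (forall y, `|F y| <= M * H y) -> forall k x, `|flows s F k x| <= M * weight s H x.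
Proof.
move=> bF bH M0 H0 FH k x; elim: s => [|i s ih] /=; first by rewrite normr0 mulr0.
have [sb' _ _] := bop_spreads s.
have w0 := weight_ge0 s x H0.
have s0 : 0 <= spread (sig i) i (spreads s H) x.
  by apply: spread_ge0 => [t|y]; [exact: sig0|exact: spreads_ge0].
rewrite mulrDr; case: eqP => _; last first.
  by rewrite (le_trans ih)// lerDr mulr_ge0.
rewrite -[leLHS]addr0 lerD//; last by rewrite mulr_ge0.
rewrite (le_trans (flow_norm i x (sb' _ bF)))//.
have -> : M * spread (sig i) i (spreads s H) x = spread (sig i) i (fun y => M * spreads s H y) x.
  rewrite /spread (bcontZ M (bcont_lineint p q x i) (sb' _ bH)); lra.
apply: (spread_le i x (@sig0 i) (bsupp_norm (sb' _ bF)) (bsuppZ M (sb' _ bH))).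
exact: spreads_norm.
Qed.

(** By [flow_ibp], each step contributes the difference between the states before and after it, and
    the sum telescopes. *)
Lemma flows_ibp (g : V -> R) (h : 'I_n -> V -> R) s F : uniq s ->
  mu.-integrable setT (EFin \o g) -> (forall i, mu.-integrable setT (EFin \o h i)) ->
  ibp g h -> bsupp Q F ->
  \sum_i \int[mu]_x (h i x * flows s F i x) =
  - \int[mu]_x (g x * (F x - spreads s F x)).
Proof.
have I0 (f : V -> R) : (forall x, f x = 0) -> \int[mu]_x f x = 0.
  move=> f0; rewrite (_ : f = fun=> 0); last exact/funext.
  by rewrite Rintegral_cst// mul0r.
move=> + ig ih gh bF; elim: s => [_|i s IH] /=.
  rewrite big1 => [|i _]; rewrite I0 ?oppr0// => x; rewrite ?subrr mulr0//.
move=> /andP[nis us]; have {}IH := IH us.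
have [sb _ _] := bop_spreads s.
have [sb' _ _] := bop_spread (brho i).
have bg := bcont_Rintegral Q ig.
rewrite (bigD1 i)//= eqxx (flow_ibp ig (ih i) gh (sb _ bF)).
rewrite [X in _ + X](eq_bigr (fun k => \int[mu]_x (h k x * flows s F k x))); last first.
  by move=> k /negPf ->.
(* As [i] does not occur in [s], the component [i] is still zero in the induction hypothesis. *)
rewrite (bigD1 i)//= in IH.
rewrite (flows_notin F nis) in IH.
rewrite [X in X + _ = _]I0 ?add0r in IH; last by move=> x; rewrite mulr0.
rewrite IH -opprD; congr (- _).
rewrite (bcontB bg (sb _ bF) (sb' _ (sb _ bF))) (bcontB bg bF (sb _ bF)).
rewrite (bcontB bg bF (sb' _ (sb _ bF))).
by rewrite addrC addrA subrK.
Qed.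

End transport_in_box.

(** * Euclidean norm and geodesic distance *)

Section enorm_theory.
Context (R : realType) (n : nat).
Implicit Types u v : 'rV[R]_n.

Lemma dotr_ge0 u : 0 <= dotr u u.
Proof. by apply: sumr_ge0 => i _; rewrite -expr2 sqr_ge0. Qed.

Lemma enorm_ge0 u : 0 <= enorm u.
Proof. exact: sqrtr_ge0. Qed.

Lemma enorm_sqr u : enorm u ^+ 2 = dotr u u.
Proof. by rewrite sqr_sqrtr// dotr_ge0. Qed.

Lemma coord_le_enorm u i : `|u ord0 i| <= enorm u.
Proof.
rewrite -(ler_pXn2r (ltn0Sn 1)) ?nnegrE ?enorm_ge0// enorm_sqr real_normK ?num_real//.
by rewrite /dotr (bigD1 i)//= expr2 lerDl sumr_ge0// => k _; rewrite -expr2 sqr_ge0.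
Qed.

Lemma enorm_le_sum u : enorm u <= \sum_i `|u ord0 i|.
Proof.
have s0 : 0 <= \sum_i `|u ord0 i| by apply: sumr_ge0.
rewrite -(ler_pXn2r (ltn0Sn 1)) ?nnegrE ?enorm_ge0// enorm_sqr expr2 mulr_suml.
apply: ler_sum => i _; rewrite (le_trans (ler_norm _))// normrM ler_wpM2l//.
by rewrite (bigD1 i)//= lerDl sumr_ge0.
Qed.

Lemma coord_le_norm u i : `|u ord0 i| <= `|u|.
Proof.
rewrite /Num.norm/= mx_normrE.
exact: (le_bigmax 0 (fun ij => `|u ij.1 ij.2|) (ord0, i)).
Qed.

Lemma enorm_le_norm u : enorm u <= n%:R * `|u|.
Proof.
rewrite (le_trans (enorm_le_sum u))//.
rewrite (@le_trans _ _ (\sum_(i < n) `|u|))//; last first.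
  by rewrite sumr_const card_ord mulr_natl.
by apply: ler_sum => i _; exact: coord_le_norm.
Qed.

Lemma norm_le_enorm u : `|u| <= enorm u.
Proof.
rewrite /Num.norm/=; have [->|/mx_norm_neq0[[i j]]] := eqVneq (mx_norm u) 0.
  exact: enorm_ge0.
by rewrite ord1 => ->; exact: coord_le_enorm.
Qed.

(** Cauchy-Schwarz, by expanding the sum of the squares of [enorm u * v i - enorm v * u i]. Vectors
    of norm 0 are set apart since one divides by the product of the norms. *)
Lemma dotr_le u v : dotr u v <= enorm u * enorm v.
Proof.
have [/eqP u0|u0] := boolP (enorm u == 0).
  rewrite u0 mul0r /dotr big1// => i _.
  have := coord_le_enorm u i; rewrite u0 normr_le0 => /eqP ->.
  by rewrite mul0r.
have [/eqP v0|v0] := boolP (enorm v == 0).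
  rewrite v0 mulr0 /dotr big1// => i _.
  have := coord_le_enorm v i; rewrite v0 normr_le0 => /eqP ->.
  by rewrite mulr0.
have ab : 0 < enorm u * enorm v by rewrite mulr_gt0// lt_def ?u0 ?v0 enorm_ge0.
have : 0 <= \sum_i (enorm u * v ord0 i - enorm v * u ord0 i) ^+ 2.
  by apply: sumr_ge0 => i _; exact: sqr_ge0.
rewrite (_ : \sum_i _ = 2 * (enorm u * enorm v) * (enorm u * enorm v - dotr u v)).
  by rewrite pmulr_rge0 ?subr_ge0// mulr_gt0.
transitivity (enorm u ^+ 2 * dotr v v + enorm v ^+ 2 * dotr u u - 2 * (enorm u * enorm v) * dotr u v).
  rewrite /dotr !mulr_sumr -big_split -sumrB; apply: eq_bigr => i _ /=; ring.
by rewrite -!enorm_sqr; ring.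
Qed.

Lemma enormD u v : enorm (u + v) <= enorm u + enorm v.
Proof.
rewrite -(ler_pXn2r (ltn0Sn 1)) ?nnegrE ?addr_ge0 ?enorm_ge0//.
rewrite enorm_sqr sqrrD !enorm_sqr.
have -> : dotr (u + v) (u + v) = dotr u u + dotr u v *+ 2 + dotr v v.
  rewrite /dotr mulr2n -!big_split; apply: eq_bigr => i _ /=; rewrite !mxE; ring.
by rewrite lerD2r lerD2l lerMn2r dotr_le.
Qed.

Lemma enormZ (c : R) u : enorm (c *: u) = `|c| * enorm u.
Proof.
rewrite /enorm (_ : dotr (c *: u) (c *: u) = c ^+ 2 * dotr u u).
  by rewrite sqrtrM ?sqr_ge0// sqrtr_sqr.
by rewrite /dotr mulr_sumr; apply: eq_bigr => i _; rewrite !mxE; ring.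
Qed.

Lemma enormN u : enorm (- u) = enorm u.
Proof. by rewrite -scaleN1r enormZ normrN1 mul1r. Qed.

Lemma enorm0 : enorm (0 : 'rV[R]_n) = 0.
Proof. by rewrite /enorm /dotr big1 ?sqrtr0// => i _; rewrite mxE mul0r. Qed.

End enorm_theory.

Section curves.
Context (R : realType) (n : nat).
Local Notation V := 'rV[R]_n.
Implicit Types (gamma : R -> V) (s : seq R).

Lemma curve_variation_nil (a b : R) gamma : curve_variation a b gamma [::] = 0.
Proof. by rewrite /curve_variation big_geq. Qed.

Lemma curve_variation_cons (a b x : R) gamma s :
  curve_variation a b gamma (x :: s) = enorm (gamma x - gamma a) + curve_variation x b gamma s.
Proof. by rewrite /curve_variation /= big_nat_recl. Qed.

Lemma curve_variation_rcons (a b b' x : R) gamma s :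
  curve_variation a b gamma (rcons s x) =
  curve_variation a b' gamma s + enorm (gamma x - gamma (last a s)).
Proof.
elim: s a => [|y s ih] a /=.
  by rewrite !curve_variation_cons !curve_variation_nil addr0 add0r.
by rewrite !curve_variation_cons ih addrA.
Qed.

Lemma curve_variation_ge0 (a b : R) gamma s : 0 <= curve_variation a b gamma s.
Proof. by apply: sumr_ge0 => k _; exact: enorm_ge0. Qed.

Lemma path_lt_last (a : R) s : path <%R a s -> a <= last a s.
Proof.
elim: s a => [//|y s ih] a /= /andP[ay ys].
exact: le_trans (ltW ay) (ih _ ys).
Qed.

(** Stands in for partitions: such a [Lam] bounds the length by [Lam 1 - Lam 0], and a curve of
    finite length has one attaining equality. Paths are then glued and subdivided by computing with
    [Lam]. *)
Definition dominates_increments gamma (Lam : R -> R) := forall s t : R,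
  0 <= s -> s <= t -> t <= 1 -> enorm (gamma t - gamma s) <= Lam t - Lam s.

Lemma curve_length_le gamma Lam : dominates_increments gamma Lam ->
  (curve_length 0 1 gamma <= (Lam 1 - Lam 0)%:E)%E.
Proof.
move=> GL; apply: ge_ereal_sup => _ [s /= [ps /eqP ls] <-]; rewrite lee_fin.
suff H (a : R) : 0 <= a -> path <%R a s -> last a s <= 1 ->
    curve_variation a 1 gamma s <= Lam (last a s) - Lam a.
  by rewrite -{2}ls; apply: H => //; rewrite ls.
move=> {ps ls}.
elim: s a => [|x s ih] a /=; first by rewrite curve_variation_nil subrr.
move=> a0 /andP[ax xs] l1; have xl := path_lt_last xs.
rewrite curve_variation_cons.
have -> : Lam (last x s) - Lam a = (Lam x - Lam a) + (Lam (last x s) - Lam x) by ring.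
rewrite lerD//; first by apply: GL => //; [exact: ltW|exact: le_trans xl l1].
by apply: ih => //; exact: le_trans a0 (ltW ax).
Qed.

(** [Lam t] is the length of the arc between the parameters 0 and [t]. *)
Lemma curve_length_increments gamma : (curve_length 0 1 gamma < +oo)%E ->
  exists Lam, dominates_increments gamma Lam /\
    (Lam 1 - Lam 0)%:E = curve_length 0 1 gamma.
Proof.
move=> len; pose len_ t := curve_length 0 t gamma.
have ge0 (t : R) : 0 <= t -> (0 <= len_ t)%E.
  rewrite le_eqVlt => /predU1P[<-|t0].
    apply: ereal_sup_ubound; exists [::]; first by split => /=.
    by rewrite curve_variation_nil.
  apply: (@le_trans _ _ (curve_variation 0 t gamma [:: t])%:E).
    by rewrite lee_fin curve_variation_ge0.
  by apply: ereal_sup_ubound; exists [:: t] => //; split => //=; rewrite t0.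
(* Appending [t] to a partition of [0, s] gives a partition of [0, t] whose variation has one more
   term. *)
have incr (s t : R) : 0 <= s -> s <= t -> (len_ s + (enorm (gamma t - gamma s))%:E <= len_ t)%E.
  move=> s0; rewrite le_eqVlt => /predU1P[<-|st]; first by rewrite subrr enorm0 adde0.
  rewrite -leeBrDr//; apply: ge_ereal_sup => _ [l [pl /eqP ll] <-].
  rewrite leeBrDr// -EFinD; apply: ereal_sup_ubound; exists (rcons l t).
    by split; rewrite ?last_rcons// rcons_path pl ll.
  by rewrite (curve_variation_rcons _ _ s) ll.
have fin (t : R) : 0 <= t -> t <= 1 -> len_ t \is a fin_num.
  move=> t0 t1; rewrite ge0_fin_numE ?ge0//; apply: le_lt_trans len.
  have := incr t 1 t0 t1; apply: le_trans; rewrite leeDl// lee_fin enorm_ge0//.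
have len0 : len_ 0 = 0%E.
  apply/eqP; rewrite eq_le ge0// andbT; apply: ge_ereal_sup => _ [l [pl /eqP ll] <-].
  case: l pl ll => [|x l] /=; first by rewrite curve_variation_nil.
  move=> /andP[x0 xl] ll; have := path_lt_last xl.
  by rewrite ll leNgt x0.
exists (fine \o len_); split.
  move=> s t s0 st t1; rewrite /= -lee_fin EFinB !fineK ?fin//.
  - by rewrite leeBrDr ?fin// 1?addeC ?incr// (le_trans st).
  - exact: le_trans st t1.
  - exact: le_trans s0 st.
by rewrite /= len0 subr0 fineK// fin.
Qed.

Lemma geodesic_dist_ge0 Omega (y x : V) : (0 <= geodesic_dist Omega y x)%E.
Proof.
apply: le_ereal_inf_tmp => _ [gamma [_ _ _ _ len] <-].
have [Lam [GL <-]] := curve_length_increments len.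
by rewrite lee_fin (le_trans (enorm_ge0 _) (GL 0 1 _ _ _)).
Qed.

Lemma within_continuous_comp (T : topologicalType) (A B : set R) (u : R -> R) (f : R -> T) :
  (forall t, B t -> A (u t)) -> continuous u -> {within A, continuous f} ->
  {within B, continuous (f \o u)}.
Proof.
move=> BA cu /subspace_continuousP cf; apply/subspace_continuousP => t Bt.
have := cf _ (BA _ Bt); apply: cvg_comp => P /= AP.
have AP' : nbhs (u t) [set s | A s -> P s] := AP.
have uAP : \forall t' \near t, A (u t') -> P (u t') := cu t _ AP'.
rewrite /within/=; apply: filterS uAP => t' /= h Bt'; apply: h; exact: BA.
Qed.

Definition concat_segment (y y' : V) gamma (t : R) : V :=
  if t <= 2^-1 then y' + (2 * t) *: (y - y') else gamma (2 * t - 1).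

Lemma rectifiable_concat_segment Omega (y y' x : V) gamma Lam :
  (forall t : R, 0 <= t <= 1 -> Omega (y' + t *: (y - y'))) ->
  rectifiable_path Omega y x gamma -> dominates_increments gamma Lam ->
  rectifiable_path Omega y' x (concat_segment y y' gamma) /\
  (curve_length 0 1 (concat_segment y y' gamma) <=
     (enorm (y - y') + (Lam 1 - Lam 0))%:E)%E.
Proof.
move=> seg [cg gO g0 g1 _] GL.
pose e := enorm (y - y').
(* Distance travelled: the segment at constant speed, then the increments of [Lam] at double
   speed. *)
pose Lam' t := if t <= 2^-1 then 2 * t * e else e + (Lam (2 * t - 1) - Lam 0).
have DL : dominates_increments (concat_segment y y' gamma) Lam'.
  move=> s t s0 st t1; rewrite /concat_segment /Lam'.
  have e0 : 0 <= e := enorm_ge0 _.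
  case: (leP s (2^-1)) => hs; case: (leP t (2^-1)) => ht.
  - rewrite opprD addrACA subrr add0r -scalerBl enormZ ger0_norm -?mulrBl//.
    by rewrite subr_ge0; lra.
  (* For times on either side of 1/2, the triangle inequality goes through the junction point
     [y = gamma 0]. *)
  - have -> : gamma (2 * t - 1) - (y' + (2 * s) *: (y - y')) =
        (gamma (2 * t - 1) - gamma 0) + (1 - 2 * s) *: (y - y').
      rewrite g0 scalerBl scale1r; apply/rowP => k; rewrite !mxE; ring.
    rewrite (le_trans (enormD _ _))// enormZ ger0_norm; last lra.
    have := GL 0 (2 * t - 1) (lexx _) _ _; rewrite -/e => h.
    have : enorm (gamma (2 * t - 1) - gamma 0) <= Lam (2 * t - 1) - Lam 0 by apply: h; lra.
    lra.
  - lra.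
  - have := GL (2 * s - 1) (2 * t - 1) _ _ _ => h.
    have : enorm (gamma (2 * t - 1) - gamma (2 * s - 1)) <= Lam (2 * t - 1) - Lam (2 * s - 1).
      by apply: h; lra.
    lra.
have len : (curve_length 0 1 (concat_segment y y' gamma) <= (e + (Lam 1 - Lam 0))%:E)%E.
  have -> : e + (Lam 1 - Lam 0) = Lam' 1 - Lam' 0.
    rewrite /Lam' ifF; last by apply/negbTE; rewrite -ltNge; lra.
    rewrite ifT; last lra.
    by rewrite mulr0 mul0r subr0 mulr1 (_ : 2 - 1 = 1 :> R)//; lra.
  exact: curve_length_le.
split => //; split.
- rewrite (_ : `[0, 1]%classic = `[0, 2^-1] `|` `[2^-1, 1]); last first.
    apply/seteqP; split => t /=; rewrite !in_itv/=; last by case=> /andP[? ?]; lra.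
    by move=> /andP[? ?]; case: (leP t 2^-1) => h; [left|right]; lra.
  apply: withinU_continuous.
  + exact: itv_closed.
  + exact: itv_closed.
  + apply: (@subspace_eq_continuous _ _ _ (fun t : R => y' + (2 * t) *: (y - y'))).
      move=> t /set_mem; rewrite /= in_itv/= => /andP[_ h].
      by rewrite /from_subspace /concat_segment ifT.
    apply: continuous_subspaceT => t.
    apply: cvgD; first exact: cvg_cst.
    apply: cvgZr_tmp; apply: cvgMl_tmp; exact: cvg_id.
  + apply: (@subspace_eq_continuous _ _ _ (gamma \o (fun t : R => 2 * t - 1))).
      move=> t /set_mem; rewrite /= in_itv/= => /andP[ht _].
      rewrite /from_subspace /concat_segment; case: leP => // ht'.
      have -> : t = 2^-1 by apply/eqP; rewrite eq_le ht ht'.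
      by rewrite mulfV// subrr g0 scale1r addrC subrK.
    apply: within_continuous_comp cg.
      by move=> t /=; rewrite !in_itv/= => /andP[? ?]; lra.
    move=> t; apply: cvgB; last exact: cvg_cst.
    by apply: cvgMl_tmp; exact: cvg_id.
- move=> _ [t /= + <-]; rewrite in_itv/= /concat_segment => /andP[t0 t1].
  case: leP => ht; first by apply: seg; lra.
  by apply: gO; exists (2 * t - 1) => //=; rewrite in_itv/=; lra.
- by rewrite /concat_segment ifT ?mulr0 ?scale0r ?addr0//; lra.
- rewrite /concat_segment ifF; last by apply/negbTE; rewrite -ltNge; lra.
  by rewrite mulr1 (_ : 2 - 1 = 1 :> R)//; lra.
- by apply: le_lt_trans len _; rewrite ltry.
Qed.

Lemma geodesic_dist_segment Omega (y y' x : V) :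
  (forall t : R, 0 <= t <= 1 -> Omega (y' + t *: (y - y'))) ->
  (geodesic_dist Omega y' x <= (enorm (y - y'))%:E + geodesic_dist Omega y x)%E.
Proof.
move=> seg; rewrite -leeBlDl//; apply: le_ereal_inf_tmp => _ [gamma rg <-].
have [_ _ _ _ len] := rg.
have [Lam [GL lenE]] := curve_length_increments len.
rewrite leeBlDl// -lenE -EFinD.
have [rg' le] := rectifiable_concat_segment seg rg GL.
by apply: le_trans le; apply: ereal_inf_lbound; exists (concat_segment y y' gamma).
Qed.

Lemma geodesic_distxx Omega (x : V) : Omega x -> geodesic_dist Omega x x = 0%E.
Proof.
move=> Ox; apply/eqP; rewrite eq_le geodesic_dist_ge0 andbT.
have DL : dominates_increments (fun=> x) (fun=> 0).
  by move=> s t _ _ _; rewrite !subrr enorm0.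
have := curve_length_le DL; rewrite subrr => len.
apply: le_trans len; apply: ereal_inf_lbound; exists (fun=> x) => //; split => //.
- by apply: continuous_subspaceT => t; exact: cvg_cst.
- by move=> _ [t _ <-].
- by apply: (le_lt_trans (curve_length_le DL)); rewrite ltry.
Qed.

Lemma geodesic_dist_path Omega (y x : V) : (geodesic_dist Omega y x < +oo)%E ->
  exists gamma Lam, [/\ rectifiable_path Omega y x gamma, dominates_increments gamma Lam &
    Lam 1 - Lam 0 <= fine (geodesic_dist Omega y x) + 1].
Proof.
move=> dy; have fd : geodesic_dist Omega y x \is a fin_num.
  by rewrite ge0_fin_numE// geodesic_dist_ge0.
have : (geodesic_dist Omega y x < (fine (geodesic_dist Omega y x) + 1)%:E)%E.
  by rewrite EFinD fineK// lteDl// lte_fin.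
move=> /ereal_inf_lt[_ [gamma rg <-] lt]; have [_ _ _ _ len] := rg.
have [Lam [GL lenE]] := curve_length_increments len.
exists gamma, Lam; split => //.
by rewrite -lee_fin lenE ltW.
Qed.

End curves.

(** * Uniform neighbourhoods and uniform continuity from compactness *)

Section path_compactness.
Context (R : realType) (n : nat).
Local Notation V := 'rV[R]_n.
Implicit Types (gamma : R -> V) (Omega : set V).

Lemma norm_le_coord (u : V) (e : R) : 0 <= e ->
  (forall k, `|u ord0 k| <= e) -> `|u| <= e.
Proof.
move=> e0 ue; rewrite /Num.norm/=; have [->//|/mx_norm_neq0[[i j]]] := eqVneq (mx_norm u) 0.
by rewrite ord1 => ->; exact: ue.
Qed.

(** Applied both to the image of a path and to the support of a test function. *)
Lemma compact_tube Omega (K : set V) : compact K -> open Omega -> K `<=` Omega ->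
  exists2 e : R, 0 < e & forall y x, K y -> `|x - y| <= e -> Omega x.
Proof.
move=> /compact_near_coveringP cK oO KO.
move: cK => /(_ R (0 : R)^'+ (fun e y => forall x, `|x - y| <= e -> Omega x) _).
have cover : forall y, K y ->
    \forall y' \near y & e \near (0 : R)^'+, forall x, `|x - y'| <= e -> Omega x.
  move=> y /KO Oy.
  have /nbhs_ballP[r /= r0 rO] : nbhs y Omega by exact: open_nbhs_nbhs.
  exists (ball y (r / 2), [set e | 0 < e < r / 2]) => /=.
    split; first by apply: nbhsx_ballx; rewrite divr_gt0.
    near=> e; apply/andP; split; first by near: e; exact: nbhs_right_gt.
    by near: e; apply: nbhs_right_lt; rewrite divr_gt0.
  move=> [y' e] /= [yy' /andP[e0 er]] x xy'; apply: rO.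
  move: yy'; rewrite -!ball_normE /= => yy'.
  rewrite (le_lt_trans (ler_distD y' _ _))// (splitr r) ltrD// distrC.
  exact: le_lt_trans xy' er.
move=> /(_ cover) Hn.
have : \forall e \near (0 : R)^'+, 0 < e /\ K `<=` [set y | forall x, `|x - y| <= e -> Omega x].
  by near=> e; split; [near: e; exact: nbhs_right_gt|near: e; exact: Hn].
by move=> /filter_ex[e [e0 eK]]; exists e => // y x /eK; apply.
Unshelve. all: by end_near. Qed.

Lemma path_tube Omega gamma : open Omega -> {within `[0, 1], continuous gamma} ->
  gamma @` `[0, 1] `<=` Omega ->
  exists2 e : R, 0 < e & forall t x, 0 <= t <= 1 -> `|x - gamma t| <= e -> Omega x.
Proof.
move=> oO cg gO; have cK := continuous_compact cg (@segment_compact R 0 1).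
have [e e0 eO] := compact_tube cK oO gO; exists e => // t x t01; apply: eO.
by exists t => //=; rewrite in_itv.
Qed.

(** Heine's theorem, in the near-covering form of compactness; it fixes the number of steps of a
    chain. *)
Lemma path_equicontinuous gamma (e : R) : 0 < e -> {within `[0, 1], continuous gamma} ->
  exists2 r : R, 0 < r & forall s t : R, 0 <= s <= 1 -> 0 <= t <= 1 -> `|s - t| <= r ->
    `|gamma s - gamma t| <= e.
Proof.
move=> e0 /subspace_continuousP cg.
have /compact_near_coveringP/near_covering_withinP := @segment_compact R 0 1.
move=> /(_ R (0 : R)^'+ (fun r t => forall s, 0 <= s <= 1 -> `|s - t| <= r ->
  `|gamma s - gamma t| <= e) _).
have cover : forall t : R, `[0, 1]%classic t ->
    \forall t' \near t & r \near (0 : R)^'+, `[0, 1]%classic t' ->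
      forall s, 0 <= s <= 1 -> `|s - t'| <= r -> `|gamma s - gamma t'| <= e.
  move=> t t01; have /cvgrPdist_lt/(_ (e / 2)) := cg t t01.
  rewrite divr_gt0// => /(_ isT); rewrite near_withinE => /nbhs_ballP[r /= r0 rg].
  exists (ball t (r / 2), [set d | 0 < d < r / 2]) => /=.
    split; first by apply: nbhsx_ballx; rewrite divr_gt0.
    near=> d; apply/andP; split; first by near: d; exact: nbhs_right_gt.
    by near: d; apply: nbhs_right_lt; rewrite divr_gt0.
  move=> [t' d] /= [tt' /andP[d0 dr]] t'01 s s01 st'.
  move: tt'; rewrite -ball_normE /= => tt'.
  rewrite (le_trans (ler_distD (gamma t) _ _))// (splitr e) lerD//.
    rewrite distrC ltW// rg//=.
    rewrite -ball_normE/= (le_lt_trans (ler_distD t' _ _))// (splitr r) ltrD//.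
    by rewrite distrC; exact: le_lt_trans st' dr.
  rewrite ltW// rg//= -ball_normE/= (lt_le_trans tt')// ler_pdivrMr//.
  by rewrite ler_peMr ?ler1n// ltW.
move=> /(_ cover) Hn.
have : \forall r \near (0 : R)^'+, 0 < r /\
  `[0, 1]%classic `<=` [set t | forall s, 0 <= s <= 1 -> `|s - t| <= r -> `|gamma s - gamma t| <= e].
  by near=> r; split; [near: r; exact: nbhs_right_gt|near: r; exact: Hn].
move=> /filter_ex[r [r0 rK]]; exists r => // s t s01 t01; exact: rK.
Unshelve. all: by end_near. Qed.

End path_compactness.

(** * Transport along paths *)

Section plans.
Context (R : realType) (n : nat).
Local Notation V := 'rV[R]_n.
Local Notation leb := (@lebesgue_measure R).
Local Notation mu := (@lebesgue_rV R n).
Variable Omega : set V.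
Hypothesis oOmega : open Omega.
Hypothesis fOmega : (mu Omega < +oo)%E.
Implicit Types (F : V -> R) (v : 'I_n -> V -> R).

Let mOmega : measurable Omega := open_measurable_rV oOmega.

(** The weak equation div v = F with zero normal component, tested against every integrable [g] with
    a distributional gradient, with no weighted bound. The integrability of the products is part of
    the definition because [G] is only locally integrable and integrals of sums have to be split. *)
Definition moves v F := bsupp Omega F /\
  forall g G, mu.-integrable Omega (EFin \o g) -> distributional_gradient Omega g G ->
    (forall i, mu.-integrable setT (EFin \o (fun x => G x ord0 i * v i x))) /\
    \sum_i \int[mu]_x (G x ord0 i * v i x) = - \int[mu]_x ((g \_ Omega) x * F x).

(* A plan of cost K moves every source F in the class A M by a flow bounded by
   M W, where the weight W has integral at most K and does not depend on F. *)
Definition plan (K : R) (A : R -> (V -> R) -> Prop) := exists W : V -> R,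
  [/\ bsupp Omega W, forall x, 0 <= W x, \int[mu]_x W x <= K &
   forall (M : R) F, 0 <= M -> A M F -> exists v,
     [/\ forall i, bsupp Omega (v i), forall i x, `|v i x| <= M * W x & moves v F]].

Lemma integrable_patch g : mu.-integrable Omega (EFin \o g) ->
  mu.-integrable setT (EFin \o (g \_ Omega)).
Proof.
move=> ig; have -> : EFin \o (g \_ Omega) = (EFin \o g) \_ Omega.
  by rewrite restrict_EFin.
by apply/integrable_restrict => //; rewrite setTI.
Qed.

Lemma movesD v v' F F' : moves v F -> moves v' F' ->
  moves (fun i x => v i x + v' i x) (fun x => F x + F' x).
Proof.
move=> [bF1 mv] [bF2 mv'].
split; first by have := bsuppDZ 1 bF1 bF2; under [X in bsupp _ X -> _]eq_fun do rewrite mul1r.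
move=> g G ig dG; have [i1 e1] := mv g G ig dG; have [i2 e2] := mv' g G ig dG.
have E i : (fun x => G x ord0 i * (v i x + v' i x)) =
    (fun x => G x ord0 i * v i x + G x ord0 i * v' i x).
  by apply/funext => x; rewrite mulrDr.
split.
  move=> i; rewrite E (_ : EFin \o _ = (fun x => (G x ord0 i * v i x)%:E + (G x ord0 i * v' i x)%:E)%E)//.
  exact: (integrableD measurableT (i1 i) (i2 i)).
rewrite (eq_bigr (fun i => \int[mu]_x (G x ord0 i * v i x) + \int[mu]_x (G x ord0 i * v' i x))).
  rewrite big_split/= e1 e2 -opprD; congr (- _).
  by rewrite -(bcontD (bcont_Rintegral Omega (integrable_patch ig))).
by move=> i _; rewrite E RintegralD.
Qed.

Lemma moves0 : moves (fun _ _ => 0) (fun=> 0).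
Proof.
have I0 (f : V -> R) : (forall x, f x = 0) -> \int[mu]_x f x = 0.
  move=> f0; rewrite (_ : f = fun=> 0); last exact/funext.
  by rewrite Rintegral_cst// mul0r.
split; first exact: bsupp0.
move=> g G ig dG; split.
  move=> i; rewrite (_ : _ \o _ = cst 0%E); first exact: integrable0.
  by apply/funext => x /=; rewrite mulr0.
by rewrite big1 => [|i _]; rewrite I0 ?oppr0// => x; rewrite mulr0.
Qed.

Lemma planD K K' A A' : plan K A -> plan K' A' ->
  plan (K + K') (fun M F => exists F1 F2, [/\ A M F1, A' M F2 & F = (fun x => F1 x + F2 x)]).
Proof.
move=> [W [bW W0 IW PW]] [W' [bW' W'0 IW' PW']].
have bi : bcont Omega (fun F : V -> R => \int[mu]_x F x) by exact: bcont_int.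
exists (fun x => W x + W' x); split.
- by have := bsuppDZ 1 bW bW'; under [X in bsupp _ X -> _]eq_fun do rewrite mul1r.
- by move=> x; exact: addr_ge0.
- by rewrite (bcontD bi)// lerD.
move=> M _ M0 [F1 [F2 [AF1 AF2 ->]]].
have [v [bv vW mv]] := PW _ _ M0 AF1.
have [v' [bv' vW' mv']] := PW' _ _ M0 AF2.
exists (fun i x => v i x + v' i x); split.
- by move=> i; have := bsuppDZ 1 (bv i) (bv' i); under [X in bsupp _ X -> _]eq_fun do rewrite mul1r.
- by move=> i x; rewrite mulrDr (le_trans (ler_normD _ _))// lerD.
- exact: movesD.
Qed.

Lemma planW K K' A A' : K <= K' -> (forall (M : R) F, 0 <= M -> A' M F -> A M F) ->
  plan K A -> plan K' A'.
Proof.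
move=> KK' AA' [W [bW W0 IW PW]]; exists W; split => //; first exact: le_trans KK'.
by move=> M F M0 AF; apply: PW => //; exact: AA'.
Qed.

Lemma plan0 : plan 0 (fun M F => F = fun=> 0).
Proof.
exists (fun=> 0); split => //; first exact: bsupp0.
  by rewrite Rintegral_cst// mul0r.
move=> M F M0 ->; exists (fun _ _ => 0); split.
- by move=> i; exact: bsupp0.
- by move=> i x; rewrite normr0 mulr0.
- exact: moves0.
Qed.

Lemma distributional_gradient_ibp (p q : 'I_n -> R) g G :
  cbox p q `<=` Omega -> mu.-integrable Omega (EFin \o g) ->
  distributional_gradient Omega g G ->
  ibp p q (g \_ Omega) (fun i => (fun x => G x ord0 i) \_ (cbox p q)).
Proof.
move=> pqO ig [mG iG dG] i e se e0.
have te := test_function_prodf se e0 pqO.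
have := dG (prodf e) i te.
have -> : (\int[mu]_(x in Omega) (g x * partial i (prodf e) x)%:E)%E =
    (\int[mu]_x ((g \_ Omega) x * partial i (prodf e) x)%:E)%E.
  rewrite integral_mkcond; apply: eq_integral => x _.
  by rewrite !patchE; case: ifP => //; rewrite mul0r.
have -> : (\int[mu]_(x in Omega) (G x ord0 i * prodf e x)%:E)%E =
    (\int[mu]_x (((fun x => G x ord0 i) \_ (cbox p q)) x * prodf e x)%:E)%E.
  rewrite integral_mkcond; apply: eq_integral => x _.
  rewrite !patchE; have [/set_mem xO|/negP xO] := boolP (x \in Omega).
    have [//|/negP xpq] := boolP (x \in cbox p q).
    rewrite (prodf_out e0) ?mulr0// => xbox; apply: xpq; rewrite inE => k.
    by have /andP[? ?] := xbox k; rewrite !ltW.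
  rewrite ifF ?mul0r//; apply/negP => /set_mem xpq; apply: xO; rewrite inE; exact: pqO.
by rewrite /Rintegral => ->; rewrite fineN.
Qed.

Lemma box_cbox (p q : 'I_n -> R) : box p q `<=` cbox p q.
Proof. by move=> x xpq k; have /andP[? ?] := xpq k; rewrite !ltW. Qed.

(** The cost comes from [int_weight]: one step for each of the [n] coordinates, each at the price
    [2 * L] per unit of mass of [H]. *)
Lemma plan_box (p q : 'I_n -> R) (rho : 'I_n -> R -> R) (L : R) (H : V -> R) :
  cbox p q `<=` Omega -> 0 <= L -> (forall k, q k - p k <= L) ->
  (forall k, smooth1 (rho k)) -> (forall k s, 0 <= rho k s) ->
  (forall k, bsupp `]p k, q k[%classic (rho k)) ->
  (forall k, \int[leb]_s rho k s = 1) ->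
  bsupp (box p q) H -> (forall x, 0 <= H x) ->
  plan (n%:R * (2 * L) * \int[mu]_x H x) (fun M F => exists F0,
    [/\ bsupp (box p q) F0, forall x, `|F0 x| <= M * H x &
        F = (fun x => F0 x - (\int[mu]_y F0 y) * prodf rho x)]).
Proof.
move=> pqO L0 pqL srho rho0 brho Irho bH H0.
have bO : box p q `<=` Omega := subset_trans (@box_cbox p q) pqO.
exists (weight p q rho (enum 'I_n) H); split.
- by apply: bsuppS bO _; exact: bsupp_weight.
- by move=> x; exact: weight_ge0.
- have := int_weight rho0 brho Irho (enum 'I_n) L0 pqL bH H0.
  by rewrite size_enum_ord.
move=> M _ M0 [F0 [bF0 F0H ->]].
exists (flows rho (enum 'I_n) F0); split.
- by move=> i; apply: bsuppS bO _; exact: bsupp_flows.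
- by move=> i x; exact: flows_weight.
have [sb _ _] := bop_spreads brho (enum 'I_n).
split.
  rewrite (_ : (fun x => _) = (fun x => F0 x - spreads rho (enum 'I_n) F0 x)).
    2: by rewrite (spreads_all brho bF0).
  by apply: bsuppS bO _; apply: bsuppB => //; exact: sb.
move=> g G ig dG; have dG' := dG; have [mG iG _] := dG'.
have ih i : mu.-integrable setT (EFin \o ((fun x => G x ord0 i) \_ (cbox p q))).
  have -> : EFin \o ((fun x => G x ord0 i) \_ (cbox p q)) =
     (EFin \o (fun x => G x ord0 i)) \_ (cbox p q) by rewrite restrict_EFin.
  have mc : measurable (cbox p q).
    by rewrite -[cbox p q]setCK; apply: measurableC; apply: open_measurable_rV;
    rewrite openC; exact: cbox_closed.
  apply/integrable_restrict => //; rewrite setTI; apply: iG => //; exact: cbox_compact.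
have E i : (fun x => G x ord0 i * flows rho (enum 'I_n) F0 i x) =
    (fun x => ((fun x => G x ord0 i) \_ (cbox p q)) x * flows rho (enum 'I_n) F0 i x).
  apply/funext => x; rewrite patchE; case: ifPn => // /negP xpq.
  have [_ _ ->] := bsupp_flows rho0 brho Irho (enum 'I_n) i bF0; rewrite ?mulr0//.
  by move=> xb; apply: xpq; rewrite inE; exact: box_cbox.
split.
  move=> i; rewrite E; have [mf [N fN] _] := bsupp_flows rho0 brho Irho (enum 'I_n) i bF0.
  exact: (integrable_bounded_mul measurableT (ih i) mf (fun x _ => fN x)).
have := flows_ibp srho rho0 brho Irho (enum_uniq 'I_n) (integrable_patch ig) ih
  (distributional_gradient_ibp pqO ig dG) bF0.
rewrite (spreads_all brho bF0) => <-; apply: eq_bigr => i _.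
by congr (Rintegral _ _ _); exact: E.
Qed.
End plans.

(** * Cubes and smoothed point masses *)

Section mollified_points.
Context (R : realType) (n : nat).
Local Notation V := 'rV[R]_n.
Local Notation leb := (@lebesgue_measure R).
Local Notation mu := (@lebesgue_rV R n).
Implicit Types (z : V) (r delta : R).

(** Made total by the default value 0 when the interval is empty, so that no proof of [a < b] has to
    be carried along. *)
Definition mollifier (a b : R) : R -> R :=
  if pselect (a < b) is left ab then sval (cid (mollifier_exists ab)) else fun=> 0.

Lemma mollifierP (a b : R) : a < b ->
  [/\ smooth1 (mollifier a b), forall t, 0 <= mollifier a b t,
      bsupp `]a, b[%classic (mollifier a b) & \int[leb]_t mollifier a b t = 1].
Proof. by rewrite /mollifier; case: pselect => // ab _; case: cid. Qed.

Definition cube z r : set V := box (fun k => z ord0 k - r) (fun k => z ord0 k + r).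
Definition ccube z r : set V := cbox (fun k => z ord0 k - r) (fun k => z ord0 k + r).

Definition moll z delta (k : 'I_n) : R -> R :=
  mollifier (z ord0 k - delta) (z ord0 k + delta).

(** A smooth unit mass near [z], which replaces a Dirac mass in the chains of cubes. *)
Definition dens z delta : V -> R := prodf (moll z delta).

Lemma mollP z delta k : 0 < delta ->
  [/\ smooth1 (moll z delta k), forall t, 0 <= moll z delta k t,
      bsupp `](z ord0 k - delta), (z ord0 k + delta)[%classic (moll z delta k) &
      \int[leb]_t moll z delta k t = 1].
Proof. by move=> d0; apply: mollifierP; rewrite ltrBlDr -addrA ltrDl addr_gt0. Qed.

Lemma dens_ge0 z delta x : 0 < delta -> 0 <= dens z delta x.
Proof. by move=> d0; apply: prodr_ge0 => k _; case: (mollP z k d0). Qed.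

Lemma bsupp_prodf (p q : 'I_n -> R) (h : 'I_n -> R -> R) :
  (forall k, bsupp `]p k, q k[%classic (h k)) -> bsupp (box p q) (prodf h).
Proof.
move=> bh; split.
- by apply: measurable_prodf => k; case: (bh k).
- have /choice[M HM] : forall k, exists M, forall t, `|h k t| <= M.
    by move=> k; case: (bh k) => _ [M HM] _; exists M.
  exists (\prod_k M k) => x; rewrite /prodf normr_prod; apply: ler_prod => k _.
  by rewrite normr_ge0 HM.
- by move=> x; apply: prodf_out => k t; case: (bh k) => _ _; exact.
Qed.

Lemma bsupp_dens z delta : 0 < delta -> bsupp (cube z delta) (dens z delta).
Proof. by move=> d0; apply: bsupp_prodf => k; case: (mollP z k d0). Qed.

Lemma int_dens z delta : 0 < delta -> \int[mu]_x dens z delta x = 1.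
Proof.
move=> d0; rewrite Rintegral_prodf.
- by rewrite big1// => k _; case: (mollP z k d0).
- by move=> k; case: (mollP z k d0) => _ _ [].
- by move=> k; case: (mollP z k d0).
- by move=> k; case: (mollP z k d0) => _ _ b _; exact: bsupp_integrable1 b.
Qed.

Lemma cubeS z z' r r' : `|z - z'| + r <= r' -> cube z r `<=` cube z' r'.
Proof.
move=> zr x xz k; have /andP[x1 x2] := xz k.
have := le_trans (coord_le_norm (z - z') k) (lexx _); rewrite !mxE ler_norml => /andP[h1 h2].
by apply/andP; split; lra.
Qed.

Lemma ccube_norm z r x : 0 <= r -> ccube z r x -> `|x - z| <= r.
Proof.
move=> r0 xz; apply: norm_le_coord => // k; have /andP[x1 x2] := xz k.
by rewrite !mxE ler_norml; apply/andP; split; lra.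
Qed.

Lemma cube_measurable z r : measurable (cube z r).
Proof. exact: box_measurable. Qed.

Lemma cube_fin z r : (mu (cube z r) < +oo)%E.
Proof. exact: box_finite. Qed.

End mollified_points.

Section chains.
Context (R : realType) (n : nat).
Local Notation V := 'rV[R]_n.
Local Notation mu := (@lebesgue_rV R n).
Variable Omega : set V.
Hypothesis oOmega : open Omega.
Hypothesis fOmega : (mu Omega < +oo)%E.
Implicit Types (F f : V -> R) (z y : V) (c r delta : R).

(** [plan_box] in the cube about [y], whose side is [2 * r], hence the factor [4 * r]. The first
    inequality places the target bump about [z] inside this cube. *)
Lemma plan_gather y z r delta (H : V -> R) : 0 < delta ->
  `|z - y| + delta <= r -> ccube y r `<=` Omega ->
  bsupp (cube y r) H -> (forall x, 0 <= H x) ->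
  plan Omega (n%:R * (4 * r) * \int[mu]_x H x) (fun M F => exists F0,
    [/\ measurable_fun setT F0, forall x, `|F0 x| <= M * H x &
        F = (fun x => F0 x - (\int[mu]_y F0 y) * dens z delta x)]).
Proof.
move=> d0 zyr yrO bH H0.
have r0 : 0 < r by rewrite (lt_le_trans _ zyr)// ltr_wpDl.
have sub k : `](z ord0 k - delta), (z ord0 k + delta)[%classic `<=`
    `](y ord0 k - r), (y ord0 k + r)[%classic.
  move=> t; rewrite /= !in_itv/= => /andP[t1 t2].
  have := coord_le_norm (z - y) k; rewrite !mxE ler_norml => /andP[h1 h2].
  by apply/andP; split; lra.
have P := @plan_box R n Omega oOmega (fun k => y ord0 k - r)
  (fun k => y ord0 k + r) (moll z delta) (2 * r) H yrO.
apply: planW (P _ _ _ _ _ _ bH H0).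
- by rewrite (_ : 2 * (2 * r) = 4 * r)//; lra.
- move=> M F M0 [F0 [mF0 F0H ->]]; exists F0; split => //; split => //.
    have [_ [N HN] _] := bH; exists (M * N) => x.
    rewrite (le_trans (F0H x))// ler_wpM2l//.
    by rewrite (le_trans _ (HN x))// ler_norm.
  move=> x Qx; apply/eqP; rewrite -normr_le0 (le_trans (F0H x))//.
  by have [_ _ ->] := bH; rewrite ?mulr0.
- by lra.
- by move=> k; lra.
- by move=> k; case: (mollP z k d0).
- by move=> k; case: (mollP z k d0).
- by move=> k; case: (mollP z k d0) => _ _ b _; exact: bsuppS (sub k) b.
- by move=> k; case: (mollP z k d0).
Qed.

(** Moving a bump is gathering with the density [c * dens z delta]. The constant [c] bounds the mass
    carried per unit of [M], so the weight is the same for all such masses. *)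
Lemma plan_step y z z' r delta delta' c : 0 < delta -> 0 < delta' -> 0 <= c ->
  `|z - y| + delta <= r -> `|z' - y| + delta' <= r -> ccube y r `<=` Omega ->
  plan Omega (n%:R * (4 * r) * c) (fun M F => exists2 m : R, `|m| <= M * c &
    F = (fun x => m * (dens z delta x - dens z' delta' x))).
Proof.
move=> d0 d'0 c0 zr z'r yrO.
have bd : bsupp (cube y r) (dens z delta).
  by apply: bsuppS (bsupp_dens z d0); exact: cubeS.
have id_ : mu.-integrable setT (EFin \o dens z delta).
  by apply: bsupp_integrable bd; [exact: cube_measurable|exact: cube_fin].
have P := @plan_gather y z' r delta' (fun x => c * dens z delta x) d'0 z'r yrO
  (bsuppZ c bd) (fun x => mulr_ge0 c0 (dens_ge0 z x d0)).
apply: planW P; first by rewrite RintegralZl// int_dens// mulr1.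
move=> M F M0 [m mc ->]; exists (fun x => m * dens z delta x); split.
- by apply: measurable_funM => //; case: bd.
- move=> x; rewrite normrM mulrA (ger0_norm (dens_ge0 z x d0)) ler_wpM2r//.
  exact: dens_ge0.
- by apply/funext => x; rewrite RintegralZl// int_dens// mulr1 mulrBr.
Qed.

Lemma plan_chain (N : nat) (z : nat -> V) delta c (r : nat -> R) : 0 < delta -> 0 <= c ->
  (forall j, (j < N)%N -> `|z j.+1 - z j| + delta <= r j) ->
  (forall j, (j < N)%N -> ccube (z j) (r j) `<=` Omega) ->
  plan Omega (\sum_(j < N) n%:R * (4 * r j) * c) (fun M F => exists2 m : R, `|m| <= M * c &
    F = (fun x => m * (dens (z 0%N) delta x - dens (z N) delta x))).
Proof.
move=> d0 c0; elim: N => [|N ih] zr rO.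
  rewrite big_ord0; apply: planW (plan0 Omega) => // M F _ [m _ ->].
  by apply/funext => x; rewrite subrr mulr0.
rewrite big_ord_recr/=.
have P1 : plan Omega (\sum_(j < N) n%:R * (4 * r j) * c) (fun M F => exists2 m : R, `|m| <= M * c &
    F = (fun x => m * (dens (z 0%N) delta x - dens (z N) delta x))).
  by apply: ih => j jN; [apply: zr|apply: rO]; exact: ltnW.
have P2 := @plan_step (z N) (z N) (z N.+1) (r N) delta delta c d0 d0 c0.
have zN := zr N (ltnSn N).
have zN' : `|z N - z N| + delta <= r N.
  by rewrite subrr normr0 add0r (le_trans _ zN)// lerDr.
apply: planW (planD oOmega fOmega P1 (P2 zN' zN (rO N (ltnSn N)))) => //.
move=> M F M0 [m mc ->].
exists (fun x => m * (dens (z 0%N) delta x - dens (z N) delta x)),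
  (fun x => m * (dens (z N) delta x - dens (z N.+1) delta x)); split.
- by exists m.
- by exists m.
- by apply/funext => x; rewrite -mulrDr addrA subrK.
Qed.

End chains.

Section sources.
Context (R : realType) (n : nat).
Local Notation V := 'rV[R]_n.
Local Notation mu := (@lebesgue_rV R n).
Variable Omega : set V.
Hypothesis oOmega : open Omega.
Hypothesis fOmega : (mu Omega < +oo)%E.
Variables (x0 : V) (eps0 : R).
Hypothesis eps0_gt0 : 0 < eps0.
Hypothesis x0O : ccube x0 eps0 `<=` Omega.
Implicit Types (F f : V -> R) (D : set V).

(* Sources carried by D, compensated near the reference point x0. *)
Definition source D (M : R) F := exists f : V -> R,
  [/\ measurable_fun setT f, forall x, `|f x| <= M * \1_D x &
      F = (fun x => f x - (\int[mu]_y f y) * dens x0 eps0 x)].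

(** The three summands in the cost are three stages: gathering in the cube about [y] into a small
    bump, a chain of small cubes along a path to [x0], and widening the small bump at [x0] to the
    fixed radius [eps0]. *)
Lemma plan_source (y : V) (r : R) D : 0 < r -> ccube y r `<=` Omega ->
  (geodesic_dist Omega y x0 < +oo)%E -> measurable D -> D `<=` cube y r ->
  plan Omega (n%:R * 4 * (r + (fine (geodesic_dist Omega y x0) + 2) + eps0) *
    \int[mu]_x \1_D x) (source D).
Proof.
move=> r0 yrO dy mD Dyr.
have [gamma [Lam [[cg gO g0 g1 _] GL dL]]] := geodesic_dist_path dy.
have [e e0 tube] := path_tube oOmega cg gO.
have e20 : 0 < e / 2 by rewrite divr_gt0.
have [s s0 equi] := path_equicontinuous e20 cg.
have [N [N0 Ns]] : exists N : nat, 0 < N%:R :> R /\ N%:R^-1 <= s.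
  by exists (Num.truncn s^-1).+1; rewrite invf_ple ?posrE// ltW ?truncnS_gt.
pose t j : R := j%:R / N%:R.
have t01 j : (j <= N)%N -> 0 <= t j <= 1.
  by move=> jN; rewrite divr_ge0//= ler_pdivrMr// mul1r ler_nat.
have tS j : t j.+1 = t j + N%:R^-1 by rewrite /t -natr1 mulrDl mul1r.
pose z j := gamma (t j).
(* The bound [e / 2] keeps the cubes of the chain in the tube around the path, the bound by the
   inverse of [N] limits the sum of the [N] margins to 1, and the last two make the small bumps fit
   in the cubes at the two ends. *)
pose delta := Num.min (Num.min (e / 2) N%:R^-1) (Num.min r eps0).
have d0 : 0 < delta by rewrite !lt_min e20 invr_gt0 N0 r0 eps0_gt0.
have [de dN dr deps] : [/\ delta <= e / 2, delta <= N%:R^-1, delta <= r & delta <= eps0].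
  by rewrite !ge_min !lexx ?orbT; split.
pose c := \int[mu]_x \1_D x : R.
have c0 : 0 <= c by apply: Rintegral_ge0.
have bD : bsupp (cube y r) (\1_D : V -> R) by exact: bsupp_indic.
have z0 : z 0%N = y by rewrite /z /t mul0r.
have zN : z N = x0 by rewrite /z /t mulfV// gt_eqF.
pose rr j := `|z j.+1 - z j| + delta.
have rre j : (j < N)%N -> rr j <= e.
  move=> jN; rewrite (splitr e) lerD//; apply: equi; rewrite ?t01//; first exact: ltnW.
  by rewrite tS addrC addKr ger0_norm// invr_ge0 ltW.
have rrO j : (j < N)%N -> ccube (z j) (rr j) `<=` Omega.
  move=> jN x /ccube_norm xz; apply: (tube (t j)); first by rewrite t01// ltnW.
  by apply: le_trans (rre j jN); apply: xz; rewrite addr_ge0// ltW.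
have P1 := @plan_gather R n Omega oOmega y y r delta (\1_D) d0 _ yrO bD _.
have {}P1 := P1 ltac:(by rewrite subrr normr0 add0r) ltac:(by []).
have P2 := @plan_chain R n Omega oOmega fOmega N z delta c rr d0 c0 (fun j _ => lexx _) rrO.
have P3 := @plan_step R n Omega oOmega x0 x0 x0 eps0 delta eps0 c d0 eps0_gt0 c0.
have {}P3 := P3 ltac:(by rewrite subrr normr0 add0r) ltac:(by rewrite subrr normr0 add0r) x0O.
(* Of the 2, one unit is the slack in the choice of the path and the other is the sum of the margins
   [delta]. *)
have srr : \sum_(j < N) rr j <= fine (geodesic_dist Omega y x0) + 2.
  have : \sum_(j < N) rr j <= \sum_(j < N) ((Lam (t j.+1) - Lam (t j)) + N%:R^-1).
    apply: ler_sum => j _; rewrite lerD// (le_trans (norm_le_enorm _))//.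
    have jN := ltn_ord j; apply: GL.
    - by have /andP[] := t01 j (ltnW jN).
    - by rewrite tS lerDl invr_ge0 ltW.
    - by have /andP[] := t01 j.+1 jN.
  have sN : \sum_(j < N) N%:R^-1 = 1 :> R.
    by rewrite sumr_const card_ord -[LHS]mulr_natr mulVf// gt_eqF.
  have -> : \sum_(j < N) ((Lam (t j.+1) - Lam (t j)) + N%:R^-1) =
      \sum_(j < N) (Lam (t j.+1) - Lam (t j)) + 1.
    by rewrite big_split/=; congr (_ + _); exact: sN.
  rewrite -(big_mkord xpredT (fun j => Lam (t j.+1) - Lam (t j))) telescope_sumr//.
  rewrite /t mul0r mulfV ?gt_eqF// => h.
  by rewrite (le_trans h)// (_ : 2 = 1 + 1)// addrA lerD2r.
apply: planW (planD oOmega fOmega (planD oOmega fOmega P1 P2) P3).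
  rewrite -mulr_suml -/c -mulrDl -mulrDl ler_wpM2r//.
  rewrite -mulr_sumr -mulr_sumr -!mulrDr -mulrA.
  by rewrite ler_wpM2l// ler_wpM2l// lerD2r lerD2l.
move=> M F M0 [f [mf fD ->]].
pose m := \int[mu]_x f x.
have iD : mu.-integrable setT (EFin \o (\1_D : V -> R)).
  by apply: bsupp_integrable bD; [exact: cube_measurable|exact: cube_fin].
have bf : bsupp (cube y r) f.
  split => //; first by exists M => x; rewrite (le_trans (fD x))// ler_piMr// indicE; case: (_ \in _).
  move=> x xy; apply/eqP; rewrite -normr_le0 (le_trans (fD x))// indicE memNset ?mulr0//.
  by move/Dyr.
have if_ : mu.-integrable setT (EFin \o f).
  by apply: bsupp_integrable bf; [exact: cube_measurable|exact: cube_fin].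
have mc : `|m| <= M * c.
  rewrite (le_trans (le_normr_Rintegral _ _))// -RintegralZl//.
  apply: le_Rintegral => //.
    rewrite (_ : _ \o _ = abse \o (EFin \o f)); last exact/funext.
    exact: integrable_abse.
  rewrite (_ : _ \o _ = (fun x => M%:E * (\1_D x)%:E)%E); last exact/funext.
  exact: integrableZl.
exists (fun x => (f x - m * dens y delta x) + m * (dens y delta x - dens x0 delta x)),
  (fun x => m * (dens x0 delta x - dens x0 eps0 x)); split.
- exists (fun x => f x - m * dens y delta x), (fun x => m * (dens y delta x - dens x0 delta x)).
  split => //; first by exists f.
  by exists m => //; rewrite z0 zN.
- by exists m.
- by apply/funext => x; rewrite /m; ring.
Qed.

End sources.

(** * Cutting the domain into cells *)

Section domains.
Context (R : realType) (n : nat).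
Local Notation V := 'rV[R]_n.
Local Notation mu := (@lebesgue_rV R n).
Implicit Types (Omega : set V) (x y z : V).

Lemma bounded_lebesgue_fin Omega : measurable Omega -> bounded_set Omega ->
  (mu Omega < +oo)%E.
Proof.
move=> mO [M [_ /(_ (`|M| + 1))]]; rewrite (le_lt_trans (ler_norm M)) ?ltrDl// => /(_ isT) OM.
have OB : Omega `<=` box (fun=> - (`|M| + 2)) (fun=> `|M| + 2).
  move=> x /OM xM k; rewrite -ltr_norml (le_lt_trans (coord_le_norm x k))//.
  by rewrite (le_lt_trans xM)// ltrD2l ltr1n.
apply: (@le_lt_trans _ _ (mu (box (fun=> - (`|M| + 2)) (fun=> `|M| + 2)))).
  by apply: le_measure; rewrite ?inE//; exact: box_measurable.
exact: box_finite.
Qed.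

Lemma open_ccube Omega x : open Omega -> Omega x -> exists2 e : R, 0 < e & ccube x e `<=` Omega.
Proof.
move=> oO Ox; have /nbhs_ballP[r /= r0 rO] : nbhs x Omega by exact: open_nbhs_nbhs.
exists (r / 2); first by rewrite divr_gt0.
move=> y /ccube_norm yx; apply: rO; rewrite -ball_normE/= distrC.
rewrite (le_lt_trans (yx _)) ?divr_ge0 ?(ltW r0)// ltr_pdivrMr// ltr_pMr// ltr1n//.
Qed.

Lemma ccube_center z (r : R) : 0 <= r -> ccube z r z.
Proof. by move=> r0 i; apply/andP; split; lra. Qed.

Lemma cube_segment z (r : R) x y (t : R) : ccube z r x -> ccube z r y -> 0 <= t <= 1 ->
  ccube z r (x + t *: (y - x)).
Proof.
move=> xz yz /andP[t0 t1] k; rewrite !mxE.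
have /andP[x1 x2] := xz k; have /andP[y1 y2] := yz k.
by apply/andP; split; nra.
Qed.

Lemma geodesic_dist_ccube Omega z (r : R) x y x0 : ccube z r `<=` Omega ->
  ccube z r x -> ccube z r y ->
  (geodesic_dist Omega x x0 <= (enorm (y - x))%:E + geodesic_dist Omega y x0)%E.
Proof.
move=> zO xz yz; apply: geodesic_dist_segment => t t01.
by apply: zO; exact: cube_segment.
Qed.

(** A cube with rational centre and radius the inverse of an integer. The last two conditions do not
    involve [x]: an unsuitable index gives an empty cell, so the whole countable index type can be
    used. *)
Definition cell Omega x0 (p : 'rV[rat]_n * nat) : set V :=
  let q : V := \row_i ratr (p.1 ord0 i) in let r : R := p.2.+1%:R^-1 in
  [set x | [/\ cube q r x, ccube q r `<=` Omega & (geodesic_dist Omega q x0 < +oo)%E]].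

Lemma cell_measurable Omega x0 p : measurable (cell Omega x0 p).
Proof.
rewrite /cell; set q : V := \row_i _; set r := _^-1.
have [[qO dq]|h] := pselect (ccube q r `<=` Omega /\ (geodesic_dist Omega q x0 < +oo)%E).
  rewrite (_ : [set x | _] = cube q r); first exact: cube_measurable.
  by apply/seteqP; split => x // [].
rewrite (_ : [set x | _] = set0)//.
by apply/seteqP; split => x // [_ ? ?]; apply: h.
Qed.

Lemma cell_cover Omega x0 x : open Omega -> Omega x -> (geodesic_dist Omega x x0 < +oo)%E ->
  exists p, cell Omega x0 p x.
Proof.
move=> oO Ox dx; have [e e0 eO] := open_ccube oO Ox.
(* The centre is chosen within [r] of [x], so its closed cube of radius [r] stays within [2 * r < e]
   of [x]. *)
have [k [r [rk r0 re]]] : exists (k : nat) (r : R), [/\ k.+1%:R^-1 = r, 0 < r & r < e / 2].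
  exists (Num.truncn (e / 2)^-1), (Num.truncn (e / 2)^-1).+1%:R^-1.
  by split; rewrite ?invr_gt0// invf_plt ?posrE ?divr_gt0// truncnS_gt.
have /choice[q qP] : forall i, exists q : rat, `|x ord0 i - ratr q| < r.
  move=> i; have [] := @dense_rat R (ball (x ord0 i) r).
  - by exists (x ord0 i); exact: ballxx.
  - exact: ball_open.
  - by move=> z [+ [q _ qz]]; rewrite -qz -ball_normE/= => ?; exists q.
pose p : 'rV[rat]_n * nat := (\row_i q i, k).
pose z : V := \row_i ratr (p.1 ord0 i).
have zE i : z ord0 i = ratr (q i) by rewrite /z /p /= !mxE.
have xq : cube z r x.
  move=> i; rewrite zE; have := qP i; rewrite ltr_norml => /andP[h1 h2].
  by apply/andP; split; lra.
have xq' := box_cbox xq.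
have qe : ccube z r `<=` ccube x e.
  move=> y yq i; have := yq i; have := xq i; rewrite !zE => /andP[h1 h2] /andP[h3 h4].
  by apply/andP; split; lra.
have qq : ccube z r z by exact/ccube_center/ltW.
exists p; rewrite /cell /= -/z rk; split => //; first exact: subset_trans qe eO.
apply: (le_lt_trans (geodesic_dist_ccube _ (subset_trans qe eO) qq xq')).
by rewrite lte_add_pinfty// ltry.
Qed.

(** The enumerated cells are made disjoint. The last estimate makes the distance at the centre of a
    cell comparable to the distance at any of its points, so the cost of a piece can be charged to
    an integral over that piece. *)
Lemma cell_pieces Omega x0 : open Omega ->
  exists (y : nat -> V) (r : nat -> R) (D : nat -> set V),
  [/\ forall m, measurable (D m), trivIset setT D,
      \bigcup_m D m = [set x | Omega x /\ (geodesic_dist Omega x x0 < +oo)%E] &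
      forall m, D m !=set0 -> [/\ 0 < r m <= 1, ccube (y m) (r m) `<=` Omega,
        D m `<=` cube (y m) (r m), (geodesic_dist Omega (y m) x0 < +oo)%E &
        forall x, D m x ->
          (geodesic_dist Omega (y m) x0 <= n%:R%:E + geodesic_dist Omega x x0)%E]].
Proof.
move=> oO.
pose cells m := if unpickle m is Some p then cell Omega x0 p else set0.
have mcells m : measurable (cells m).
  by rewrite /cells; case: unpickle => // p; exact: cell_measurable.
(* A default index, used only where decoding fails; the corresponding piece is empty and carries no
   claim. *)
pose p0 : 'rV[rat]_n * nat := (0, 0%N).
pose idx m := odflt p0 (unpickle m).
exists (fun m => \row_i ratr ((idx m).1 ord0 i)), (fun m => (idx m).2.+1%:R^-1),
  (seqDU cells).
have cellP m x : cells m x -> cell Omega x0 (idx m) x.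
  by rewrite /cells /idx; case: unpickle.
split.
- move=> m; apply: measurableD => //.
  by apply: bigsetU_measurable.
- exact: trivIset_seqDU.
- rewrite -seqDU_bigcup_eq; apply/seteqP; split => x.
    move=> [m _ /cellP[xq qO dq]]; split; first exact/qO/box_cbox.
    apply: (le_lt_trans (geodesic_dist_ccube _ qO (box_cbox xq) _)).
      by apply: ccube_center; rewrite invr_ge0.
    by rewrite lte_add_pinfty// ltry.
  move=> [Ox dx]; have [p px] := cell_cover oO Ox dx.
  by exists (pickle p) => //; rewrite /cells pickleK.
move=> m [x [cx _]]; have [xq qO dq] := cellP m x cx.
split => //.
- by rewrite invr_gt0 ltr0n/= invf_le1// ler1n.
- by move=> x' [/cellP[]].
- move=> x' [cx' _]; have [xq' _ _] := cellP m x' cx'.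
  have h : ccube (\row_i ratr ((idx m).1 ord0 i)) (idx m).2.+1%:R^-1
      (\row_i ratr ((idx m).1 ord0 i) : V).
    by apply: ccube_center; rewrite invr_ge0.
  apply: (le_trans (geodesic_dist_ccube _ qO h (box_cbox xq'))).
  (* The constant [n] is the ratio of the Euclidean to the sup norm, times a radius at most 1. *)
  rewrite leeD2r// lee_fin (le_trans (enorm_le_norm _))// ler_piMr//.
  rewrite (le_trans (ccube_norm _ (box_cbox xq')))// ?invr_ge0//.
  by rewrite invf_le1// ler1n.
Qed.

End domains.

(** * Superposition of the flows *)

Lemma sum_indic_trivIset (T : Type) (R : pzRingType) (D : nat -> set T) N (x : T) :
  trivIset setT D -> \sum_(m < N) \1_(D m) x = \1_(\bigcup_(m < N) D m) x :> R.
Proof.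
move=> tD; rewrite indicE; have [xD|xD] := boolP (x \in _).
  move: xD; rewrite inE => -[k /= km Dkx].
  rewrite (bigD1 (Ordinal km))//= big1 ?addr0; first by rewrite indicE mem_set.
  move=> [j jm] /= jk; rewrite indicE memNset// => Djx.
  by move: jk; rewrite -val_eqE/= => /eqP; apply; apply: (tD j k) => //; exists x.
rewrite big1// => k _; rewrite indicE memNset// => Dkx.
by move/negP: xD; apply; rewrite inE; exists k => /=.
Qed.

Section superposition.
Context (R : realType) (n : nat).
Local Notation V := 'rV[R]_n.
Local Notation mu := (@lebesgue_rV R n).
Variable Omega : set V.
Hypothesis oOmega : open Omega.
Hypothesis fOmega : (mu Omega < +oo)%E.
Variables (x0 : V) (eps0 : R).
Hypothesis eps0_gt0 : 0 < eps0.
Hypothesis x0O : ccube x0 eps0 `<=` Omega.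
Variables (D : nat -> set V) (W : nat -> V -> R).
Hypothesis mD : forall m, measurable (D m).
Hypothesis tD : trivIset setT D.
Hypothesis DO : \bigcup_m D m `<=` Omega.
Hypothesis bW : forall m, bsupp Omega (W m).
Hypothesis W0 : forall m x, 0 <= W m x.
Hypothesis PW : forall m M F, 0 <= M -> source x0 eps0 (D m) M F -> exists v,
     [/\ forall i, bsupp Omega (v i), forall i x, `|v i x| <= M * W m x & moves Omega v F].

Definition total_weight (x : V) : \bar R := (\sum_(m <oo) (W m x)%:E)%E.

Hypothesis iS : mu.-integrable Omega total_weight.

Let mOmega : measurable Omega := open_measurable_rV oOmega.
Local Notation S := total_weight.

(** Adding 1 makes the weight positive everywhere, also where [S] is infinite, since [fine] is then
    0; that happens only on a null set of [Omega]. *)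
Definition weight_function (x : V) : R := 1 + fine (S x).
Local Notation w := weight_function.

Lemma total_weight_ge0 x : (0 <= S x)%E.
Proof. by apply: nneseries_ge0 => m _ _; rewrite lee_fin. Qed.

Lemma measurable_total_weight : measurable_fun setT S.
Proof.
apply: (@ge0_emeasurable_sum _ _ _ _ (fun m x => (W m x)%:E) xpredT) => //.
  by move=> k x _ _; rewrite lee_fin.
by move=> k _; apply/measurable_EFinP; case: (bW k).
Qed.

Lemma weight_function_ge1 x : 1 <= w x.
Proof. by rewrite lerDl fine_ge0// total_weight_ge0. Qed.

Lemma measurable_weight_function : measurable_fun setT w.
Proof.
apply: measurable_funD => //; apply: measurableT_comp => //.
exact: measurable_total_weight.
Qed.

Lemma partial_weight_le x N : (S x < +oo)%E -> \sum_(m < N) W m x <= fine (S x).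
Proof.
move=> Sx; rewrite -lee_fin fineK ?ge0_fin_numE ?total_weight_ge0//.
rewrite -sumEFin -(big_mkord xpredT (fun m => (W m x)%:E)).
by apply: nneseries_lim_ge => m _ _; rewrite lee_fin.
Qed.

(** The sum of the first [N] flows solves the equation for [f] cut to the first [N] pieces, minus
    the mass of this cut times the bump at [x0]. That mass tends to the integral of [f], which is 0.
    The left side passes to the limit by dominated convergence, with the finite weighted norm of [g]
    in [E] giving the dominating function. *)
Lemma solve_source (M : R) (f : V -> R) : 0 <= M -> measurable_fun setT f ->
  (forall x, `|f x| <= M * \1_(\bigcup_m D m) x) -> \int[mu]_x f x = 0 ->
  exists u : V -> V, [/\ measurable_fun setT u,
    forall x i, `|u x ord0 i| <= M * w x &
    forall g G, in_E Omega w g G ->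
      (\int[mu]_(x in Omega) (dotr (u x) (G x))%:E =
       - (\int[mu]_x ((g \_ Omega) x * f x))%:E)%E].
Proof.
move=> M0 mf fM If.
pose f_ m x := \1_(D m) x * f x : R.
have f_M m x : `|f_ m x| <= M * \1_(D m) x.
  rewrite /f_ normrM indicE; have [xD|_] := boolP (x \in D m); last first.
    by rewrite normr0 mul0r mulr0.
  by rewrite normr1 mul1r mulr1 (le_trans (fM x))// ler_piMr// indicE; case: (_ \in _).
have mf_ m : measurable_fun setT (f_ m).
  by apply: measurable_funM => //; exact: measurable_indic.
pose F m x := f_ m x - (\int[mu]_y f_ m y) * dens x0 eps0 x.
have /choice[v vP] : forall m, exists v : 'I_n -> V -> R,
    [/\ forall i, bsupp Omega (v i), forall i x, `|v i x| <= M * W m x & moves Omega v (F m)].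
  by move=> m; apply: PW => //; exists (f_ m); split.
pose SN N i x := \sum_(m < N) v m i x.
have movesN N : moves Omega (SN N) (fun x => \sum_(m < N) F m x).
  elim: N => [|N ih].
    have -> : SN 0%N = (fun _ _ => 0).
      by apply/funext => i; apply/funext => x; rewrite /SN big_ord0.
    rewrite (_ : (fun x : V => \sum_(m < 0) F m x) = (fun=> 0)); first exact: moves0.
    by apply/funext => x; rewrite big_ord0.
  have -> : SN N.+1 = (fun i x => SN N i x + v N i x).
    by apply/funext => i; apply/funext => x; rewrite /SN big_ord_recr.
  rewrite (_ : (fun x : V => \sum_(m < N.+1) F m x) = (fun x => \sum_(m < N) F m x + F N x)).
    2: by apply/funext => x; rewrite big_ord_recr.
  by apply: movesD ih _ => //; case: (vP N).
have SNbound N i x : (S x < +oo)%E -> `|SN N i x| <= M * fine (S x).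
  move=> Sx; rewrite (le_trans (ler_norm_sum _ _ _))//.
  rewrite (@le_trans _ _ (M * \sum_(m < N) W m x))//.
    by rewrite mulr_sumr ler_sum// => m _; case: (vP m).
  by rewrite ler_wpM2l// partial_weight_le.
(* The series of flows converges absolutely where the total weight is finite; elsewhere the limit is
   set to 0 by [ui]. *)
pose Z : set V := [set x | (S x < +oo)%E].
have mZ : measurable Z.
  have := measurable_total_weight measurableT (emeasurable_itv `[-oo%E, +oo%E[).
  by rewrite setTI; congr measurable; apply/seteqP; split => x /=; rewrite in_itv/= ?leNye.
have cSN i x : Z x -> cvgn (fun N => SN N i x).
  move=> Zx; rewrite (_ : (fun N => SN N i x) = series (fun m => v m i x)); last first.
    by apply/funext => N; rewrite /series/= big_mkord.
  apply: (@normed_cvg R R).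
  have : cvgn (series (fun m => M * W m x)).
    apply: nondecreasing_is_cvgn.
      by apply: (@nondecreasing_series R (fun m => M * W m x) xpredT 0%N) => k _ _; exact: mulr_ge0.
    exists (M * fine (S x)) => _ [N _ <-]; rewrite /series/= -mulr_sumr big_mkord.
    by rewrite ler_wpM2l// partial_weight_le.
  apply: (@series_le_cvg R _ (fun m => M * W m x)) => m.
  - by rewrite /= normr_ge0.
  - exact: mulr_ge0.
  - by rewrite /=; case: (vP m).
pose ui i x := if x \in Z then limn (fun N => SN N i x) else 0.
have cui i x : (\1_Z x * SN N i x) @[N --> \oo] --> ui i x.
  rewrite /ui indicE; case: ifPn => [/set_mem Zx|_].
    by under eq_fun do rewrite mul1r; exact: cSN.
  by under eq_fun do rewrite mul0r; exact: cvg_cst.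
have mSN N i : measurable_fun setT (SN N i).
  by have [_ _] := movesN N; rewrite /SN; apply: measurable_sum => m; have [+ _ _] := vP m => /(_ i)[].
have mui i : measurable_fun setT (ui i).
  apply: (@measurable_fun_cvg _ _ _ _ (fun N x => \1_Z x * SN N i x)).
    by move=> N; apply: measurable_funM => //; exact: measurable_indic.
  by move=> x _; exact: cui.
pose u x : V := \row_i ui i x.
have uM x i : `|ui i x| <= M * fine (S x).
  have S0 : 0 <= fine (S x) by rewrite fine_ge0// total_weight_ge0.
  have : (fun N => `|\1_Z x * SN N i x|) @ \oo --> `|ui i x| by apply: cvg_norm; exact: cui.
  move=> /cvg_lim <-//; apply: limr_le.
    by apply: cvgP; apply: cvg_norm; exact: cui.
  near=> N; rewrite normrM indicE; have [/set_mem Zx|_] := boolP (x \in Z).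
    by rewrite normr1 mul1r; exact: SNbound.
  by rewrite normr0 mul0r mulr_ge0.
exists u; split.
- by apply: measurable_fun_rV => i; under eq_fun do rewrite mxE; exact: mui.
- move=> x i; rewrite mxE (le_trans (uM x i))// ler_wpM2l// lerDr//.
move=> g G [ig dG EG]; have [mG _ _] := dG.
have mGi i : measurable_fun Omega (fun x => G x ord0 i).
  exact: (measurableT_comp (measurable_rV_coord i) mG).
have [Fint Feq] : (forall N i, mu.-integrable setT (EFin \o (fun x => G x ord0 i * SN N i x))) /\
    forall N, \sum_i \int[mu]_x (G x ord0 i * SN N i x) =
      - \int[mu]_x ((g \_ Omega) x * \sum_(m < N) F m x).
  by split => N; have [_ /(_ g G ig dG)[h1 h2]] := movesN N.
have IN N : (\int[mu]_(x in Omega) (dotr (\row_i SN N i x) (G x))%:E =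
    (- \int[mu]_x ((g \_ Omega) x * \sum_(m < N) F m x))%:E)%E.
  rewrite -Feq integral_mkcond -sumEFin.
  rewrite (eq_bigr (fun i => \int[mu]_x (G x ord0 i * SN N i x)%:E))%E; last first.
    by move=> i _; rewrite /Rintegral fineK//; exact: integrable_fin_num (Fint N i).
  rewrite -integral_sum//; last by move=> i; exact: (Fint N i).
  apply: eq_integral => x _.
  rewrite patchE sumEFin; case: ifPn => [_|/negP xO].
    by congr EFin; apply: eq_bigr => i _; rewrite mxE mulrC.
  rewrite big1// => i _; rewrite (_ : SN N i x = 0) ?mulr0//.
  rewrite /SN big1// => m _; have [+ _ _] := vP m => /(_ i)[_ _ ->]//.
  by move=> xO'; apply: xO; rewrite inE.
pose pN N x := \1_(\bigcup_(m < N) D m) x * f x : R.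
have pNE N x : \sum_(m < N) f_ m x = pN N x.
  by rewrite /pN -sum_indic_trivIset// mulr_suml; apply: eq_bigr.
have UO N : \bigcup_(m < N) D m `<=` Omega.
  by move=> x [m _ xD]; apply: DO; exists m.
have mU N : measurable (\bigcup_(m < N) D m).
  by apply: bigcup_measurable => m _; exact: mD.
have bf : bsupp Omega f.
  split => //; first by exists M => x; rewrite (le_trans (fM x))// ler_piMr// indicE; case: (_ \in _).
  move=> x xO; apply/eqP; rewrite -normr_le0 (le_trans (fM x))// indicE memNset ?mulr0//.
  by move/DO.
have cp : bounded_cvg Omega pN f.
  have pf N x : `|pN N x| <= `|f x|.
    by rewrite normrM ler_piMl// indicE; case: (_ \in _); rewrite ?normr1 ?normr0.
  split.
  - move=> N; rewrite /pN; apply: bsuppM => //.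
    by exists 1 => x; rewrite indicE; case: (_ \in _); rewrite ?normr1 ?normr0.
  - by have [_ [B fB] _] := bf; exists B => N x; exact: le_trans (pf N x) (fB x).
  - move=> x; have [[m _ xm]|nx] := pselect ((\bigcup_m D m) x).
      apply: cvg_near_cst; exists m.+1 => // N /= mN; rewrite /pN indicE mem_set ?mul1r//.
      by exists m.
    apply: cvg_near_cst; apply: nearW => N; rewrite /pN.
    have := fM x; rewrite indicE memNset// mulr0 normr_le0 => /eqP ->.
    by rewrite mulr0.
(* The mass still uncompensated at [x0] after [N] pieces. *)
pose cN N := \int[mu]_x pN N x.
have ccN : cN @ \oo --> (0 : R).
  by rewrite -If; have [_] := bcont_int mOmega fOmega; exact.
have IcN N : \sum_(m < N) \int[mu]_x f_ m x = cN N.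
  rewrite -(bcont_sum _ (bcont_int mOmega fOmega)).
    by apply: eq_Rintegral => x _; exact: pNE.
  move=> m; rewrite /f_; apply: bsuppM => //.
  by exists 1 => x; rewrite indicE; case: (_ \in _); rewrite ?normr1 ?normr0.
have FNE N x : \sum_(m < N) F m x = pN N x - cN N * dens x0 eps0 x.
  by rewrite -IcN mulr_suml -pNE -sumrB.
have cF : bounded_cvg Omega (fun N x => \sum_(m < N) F m x) f.
  have [bp [B pB] cpx] := cp; have [_ [C dC] _] := bsupp_dens x0 eps0_gt0.
  have [B' cB'] : exists B' : R, forall N, `|cN N| <= B'.
    have /cvg_seq_bounded[B' [_ /(_ (B' + 1))]] : cvgn cN by apply: cvgP ccN.
    by rewrite ltrDl => /(_ ltr01) h; exists (B' + 1) => N; exact: h.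
  split.
  - by move=> N; have [] := movesN N.
  - exists (B + B' * C) => N x; rewrite FNE (le_trans (ler_normB _ _))// lerD// normrM.
    by rewrite ler_pM.
  - move=> x; under eq_fun do rewrite FNE.
    have := cvgB (cpx x) (cvgMr_tmp (b := dens x0 eps0 x) ccN).
    by rewrite mul0r subr0; exact.
have cR : (- \int[mu]_x ((g \_ Omega) x * \sum_(m < N) F m x))%:E @[N --> \oo] -->
    (- \int[mu]_x ((g \_ Omega) x * f x))%:E%E.
  apply: cvg_EFin; first exact: nearW.
  by apply: cvgN; have [_] := bcont_Rintegral Omega (integrable_patch oOmega ig); exact.
rewrite -EFinN -(cvg_lim _ cR)//; apply/esym/cvg_lim => //.
under eq_fun do rewrite -IN.
have we x : 0 <= w x by rewrite (le_trans ler01)// weight_function_ge1.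
have menorm : measurable_fun Omega (fun x => enorm (G x)).
  apply: (measurableT_comp (continuous_measurable_fun (@sqrt_continuous R))).
  by rewrite /dotr; apply: measurable_sum => i; apply: measurable_funM.
have iwG : mu.-integrable Omega (fun x => (w x * enorm (G x))%:E).
  apply/integrableP; split.
    apply/measurable_EFinP; apply: measurable_funM => //.
    exact: measurable_funS measurable_weight_function.
  under eq_integral do rewrite gee0_abs ?lee_fin ?mulr_ge0 ?enorm_ge0//.
  by apply: le_lt_trans EG; rewrite leeDr// integral_ge0.
have aS := integrable_ae mOmega iS.
have H1 N : measurable_fun Omega (fun x => (dotr (\row_i SN N i x) (G x))%:E).
  apply/measurable_EFinP; rewrite /dotr; apply: measurable_sum => i.
  under eq_fun do rewrite mxE.
  by apply: measurable_funM => //; exact: measurable_funS (mSN N i).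
have H2 : measurable_fun Omega (fun x => (dotr (u x) (G x))%:E).
  apply/measurable_EFinP; rewrite /dotr; apply: measurable_sum => i.
  rewrite /u; under eq_fun do rewrite mxE.
  by apply: measurable_funM => //; exact: measurable_funS (mui i).
have H3 : {ae mu, forall x, Omega x ->
    (fun N => (dotr (\row_i SN N i x) (G x))%:E) @ \oo --> (dotr (u x) (G x))%:E}.
  apply: filterS aS => x /[swap] Ox /(_ Ox) Sfin.
  have Zx : x \in Z by rewrite inE /Z /= -ge0_fin_numE// total_weight_ge0.
  apply: cvg_EFin; first exact: nearW.
  rewrite /dotr; apply: cvg_big => [|i _]; [exact: add_continuous|]; rewrite !mxE.
  under eq_fun do rewrite mxE.
  apply: cvgMr_tmp; have := cui i x; rewrite indicE Zx.
  by under eq_fun do rewrite mul1r; exact.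
(* Each of the [n] terms of the scalar product is at most [M * w x * enorm (G x)]. *)
have H4 : mu.-integrable Omega (fun x => (M * n%:R)%:E * (w x * enorm (G x))%:E)%E.
  exact: integrableZl.
have H5 : {ae mu, forall x N, Omega x ->
    (`|(dotr (\row_i SN N i x) (G x))%:E| <= (M * n%:R)%:E * (w x * enorm (G x))%:E)%E}.
  apply: filterS aS => x h N Ox; have Sfin := h Ox.
  have Sx : (S x < +oo)%E by rewrite -ge0_fin_numE// total_weight_ge0.
  rewrite lee_fin (le_trans (ler_norm_sum _ _ _))//.
  have -> : M * n%:R * (w x * enorm (G x)) = \sum_(i < n) M * w x * enorm (G x).
    by rewrite sumr_const card_ord -mulr_natr; ring.
  apply: ler_sum => i _; rewrite mxE normrM ler_pM ?coord_le_enorm//.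
  by rewrite (le_trans (SNbound N i x Sx))// ler_wpM2l// lerDr.
by have [_ _] := dominated_convergence mOmega H1 H2 H3 H4 H5.
Unshelve. all: by end_near. Qed.

End superposition.

(** * The essential supremum norm and pointwise bounds *)

Section Linfty.
Context (R : realType) (n : nat).
Local Notation V := 'rV[R]_n.
Local Notation mu := (@lebesgue_rV R n).
Implicit Types (Omega : set V) (f : V -> R).

Lemma Linfty_norm_ae Omega f : (Linfty_norm Omega f < +oo)%E ->
  exists M : R, [/\ 0 <= M, Linfty_norm Omega f = M%:E &
    {ae mu, forall x, Omega x -> `|f x| <= M}].
Proof.
move=> foo; have f0 : (0 <= Linfty_norm Omega f)%E by exact: Lnorm_ge0.
have ffin : Linfty_norm Omega f \is a fin_num by rewrite ge0_fin_numE.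
exists (fine (Linfty_norm Omega f)); split; first exact: fine_ge0.
  by rewrite fineK.
(* The norm is the essential supremum only when the whole space has positive measure, and 0
   otherwise; in that second case every set is null. *)
have [mu0|mu0] := ltP 0%E (mu [set: V]).
  have E : Linfty_norm Omega f = ess_sup mu (abse \o (EFin \o (f \_ Omega))).
    by rewrite /Linfty_norm unlock mu0.
  have := ess_sup_ge mu (abse \o (EFin \o (f \_ Omega))).
  apply: filterS => x /= h Ox; rewrite -lee_fin fineK// E.
  by move: h; rewrite patchE mem_set.
exists setT; split => //.
by apply/eqP; rewrite eq_le mu0 measure_ge0.
Qed.

Lemma Linfty_norm_le Omega f (M : R) : 0 <= M -> (forall x, Omega x -> `|f x| <= M) ->
  (Linfty_norm Omega f <= M%:E)%E.
Proof.
move=> M0 fM; rewrite /Linfty_norm unlock; case: ifP => _; last by rewrite lee_fin.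
apply/ess_supP; apply: nearW => x /=; rewrite lee_fin patchE.
by case: ifPn => [/set_mem/fM//|_]; rewrite normr0.
Qed.

End Linfty.

(** * Integrability of the distance implies solvability *)

Section sufficiency.
Context (R : realType) (n : nat).
Local Notation V := 'rV[R]_n.
Local Notation mu := (@lebesgue_rV R n).

Lemma integrable_geodesic_solvable (Omega : set V) (x0 : V) : (0 < n)%N ->
  open Omega -> bounded_set Omega -> Omega x0 ->
  mu.-integrable Omega (fun y => geodesic_dist Omega y x0) -> div_infty_solvable Omega.
Proof.
move=> n0 oO bO Ox0 id; have mO := open_measurable_rV oO.
have fO := bounded_lebesgue_fin mO bO.
have [eps0 e0 eO] := open_ccube oO Ox0.
have [y [r [D [mD tD UD DP]]]] := cell_pieces x0 oO.
have DO : \bigcup_m D m `<=` Omega by rewrite UD => x [].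
have DmO m : D m `<=` Omega by move=> x xD; apply: DO; exists m.
(* [A] is the factor of [plan_source]. In [B], the [n] comes from replacing the distance at the
   centre of a cell by that at its points, and the 3 is the 2 of [plan_source] plus a radius at most
   1. *)
pose A : R := n%:R * 4; pose B : R := n%:R + 3 + eps0.
have A0 : 0 <= A by rewrite /A mulr_ge0.
have B0 : 0 <= B by rewrite /B !addr_ge0// ltW.
pose h x := (A%:E * (geodesic_dist Omega x x0 + B%:E))%E.
have h0 x : (0 <= h x)%E by rewrite mule_ge0// adde_ge0// ?geodesic_dist_ge0.
have ih : mu.-integrable Omega h.
  apply: integrableZl => //; apply: integrableD => //.
  apply/integrableP; split; first exact: measurable_cst.
  by rewrite integral_cst// lte_mul_pinfty.
have mh := measurable_int mu ih.
have piece m : exists W : V -> R, [/\ bsupp Omega W, forall x, 0 <= W x,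
    (\int[mu]_x (W x)%:E <= \int[mu]_(x in D m) h x)%E &
    forall M F, 0 <= M -> source x0 eps0 (D m) M F -> exists v,
     [/\ forall i, bsupp Omega (v i), forall i x, `|v i x| <= M * W x & moves Omega v F]].
  (* An empty piece has no cube inside [Omega] attached to it, but its only source is zero. *)
  have [D0|/eqP/set0P Dm] := pselect (D m = set0).
    exists (fun=> 0); split => //; first exact: bsupp0.
      by rewrite integral0 integral_ge0.
    move=> M F M0 [f [mf fM ->]]; exists (fun _ _ => 0); split => //.
    - by move=> i; exact: bsupp0.
    - by move=> i x; rewrite normr0 mulr0.
    have f0 : f = fun=> 0.
      apply/funext => x; apply/eqP; rewrite -normr_le0 (le_trans (fM x))//.
      by rewrite D0 indic0 mulr0.
    have -> : (fun x => f x - (\int[mu]_y f y) * dens x0 eps0 x) = (fun=> 0); last exact: moves0.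
    by apply/funext => x; rewrite f0 Rintegral_cst// !mul0r subr0.
  have [/andP[r0 r1] rO Dr dy dD] := DP m Dm.
  have [W [bW W0 IW PW]] := plan_source oO fO e0 eO r0 rO dy (mD m) Dr.
  exists W; split => //.
  have iW : mu.-integrable setT (EFin \o W) := bsupp_integrable mO fO bW.
  have -> : (\int[mu]_x (W x)%:E = (\int[mu]_x W x)%:E)%E.
    by rewrite /Rintegral fineK//; exact: integrable_fin_num iW.
  have fD : (mu (D m) < +oo)%E by apply: le_lt_trans fO; apply: le_measure; rewrite ?inE.
  apply: (@le_trans _ _ (\int[mu]_(x in D m)
      (A * (r m + (fine (geodesic_dist Omega (y m) x0) + 2) + eps0))%:E)%E).
    rewrite integral_cst//; set c := _ * _.
    rewrite (_ : (c%:E * _ = (c * fine (mu (D m)))%:E)%E); last first.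
      by rewrite [RHS]EFinM fineK// ge0_fin_numE.
    rewrite lee_fin /c; apply: (le_trans IW); rewrite (_ : \int[mu]_x \1_(D m) x = fine (mu (D m)))//.
    by rewrite /Rintegral integral_indic// setIT.
  have dy0 := geodesic_dist_ge0 Omega (y m) x0.
  apply: ge0_le_integral => //.
  - by move=> x _; rewrite lee_fin mulr_ge0// !addr_ge0 ?fine_ge0// ltW.
  - exact: measurable_funS mh.
  - move=> x /dD dx; rewrite /h EFinM lee_wpmul2l//.
    have -> : r m + (fine (geodesic_dist Omega (y m) x0) + 2) + eps0 =
      fine (geodesic_dist Omega (y m) x0) + (r m + 2 + eps0) by ring.
    rewrite EFinD fineK ?ge0_fin_numE//.
    apply: (@le_trans _ _ (n%:R%:E + geodesic_dist Omega x x0 + (3 + eps0)%:E)%E).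
      by rewrite leeD// lee_fin lerD2r; lra.
    by rewrite addeAC addeC -EFinD addrA.
have {piece}/choice[W WP] := piece.
have bW m : bsupp Omega (W m) by case: (WP m).
have W0 m x : 0 <= W m x by case: (WP m).
have iS : mu.-integrable Omega (total_weight W).
  apply/integrableP; split.
    by apply: measurable_funS (measurable_total_weight bW W0).
  under eq_integral do rewrite gee0_abs ?total_weight_ge0//.
  (* The integral of the total weight is the sum of the costs, and these are at most the integrals
     of [h] over disjoint pieces of [Omega]. *)
  rewrite integral_nneseries//; last 2 first.
  - by move=> m; apply/measurable_EFinP; apply: (@measurable_funS _ _ _ _ setT) => //; case: (bW m).
  - by move=> m x _; rewrite lee_fin.
  apply: (@le_lt_trans _ _ (\sum_(m <oo) \int[mu]_(x in D m) h x)%E).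
    apply: lee_nneseries.
      by move=> m _ _; apply: integral_ge0 => x _; rewrite lee_fin.
    move=> m _; have [_ _ + _] := WP m; apply: le_trans.
    apply: ge0_subset_integral => //.
    - by apply/measurable_EFinP; case: (bW m).
    - by move=> x _; rewrite lee_fin.
  rewrite -ge0_integral_bigcup//; last exact: measurable_funS mh.
  apply: (@le_lt_trans _ _ (\int[mu]_(x in Omega) h x)%E).
    by apply: ge0_subset_integral => //; exact: bigcup_measurable.
  move/integrableP : ih => [_].
  by under eq_integral do rewrite gee0_abs ?h0//.
pose w := weight_function W.
have w1 x : 1 <= w x by exact: weight_function_ge1.
have mw : measurable_fun setT w by exact: measurable_weight_function.
exists w; split.
- exact: measurable_funS mw.
- by move=> x _; exact: lt_le_trans (w1 x).
- rewrite (_ : EFin \o w = (fun x => 1%:E + (fine (total_weight W x))%:E)%E)//.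
  apply: integrableD => //.
    apply/integrableP; split; first exact: measurable_cst.
    by rewrite integral_cst// lte_mul_pinfty.
  apply: (le_integrable mO (g := total_weight W)) => //.
    apply/measurable_EFinP; apply: measurableT_comp => //.
    exact: measurable_int iS.
  by move=> x _; case: (total_weight W x) => //= *; rewrite ?lexx// leey.
(* Each of the [n] components of [u] is at most [M * w], and the Euclidean norm is at most the sum
   of their absolute values. *)
exists n%:R; split; first by rewrite ltr0n.
move=> f [mf foo] f_int; have [M [M0 ME fM]] := Linfty_norm_ae foo.
pose U := \bigcup_m D m.
have mU : measurable U by exact: bigcup_measurable.
(* A representative of [f] bounded by [M] at every point and vanishing off the pieces. It differs
   from [f] on a null set of [Omega] only, because points at infinite distance form a null set by
   integrability. *)
pose ft x := \1_U x * Num.max (- M) (Num.min M ((f \_ Omega) x)).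
have mfO : measurable_fun setT (f \_ Omega) by exact/(measurable_restrictT _ mO).
have mft : measurable_fun setT ft.
  apply: measurable_funM => //.
  by apply: measurable_maxr => //; exact: measurable_minr.
have ftM x : `|ft x| <= M * \1_U x.
  rewrite /ft normrM ger0_norm// mulrC ler_wpM2r//.
  by rewrite ler_norml le_max lexx/= ge_max ge_min lexx/= andbT; lra.
have ftf : ae_eq mu Omega (EFin \o f) (EFin \o ft).
  have := integrable_ae mO id; move: fM; apply: filterS2 => x fMx dx Ox /=.
  have xU : U x by rewrite /U UD; split => //; rewrite -ge0_fin_numE ?geodesic_dist_ge0// dx.
  have := fMx Ox; rewrite ler_norml => /andP[f1 f2].
  rewrite /ft indicE mem_set// mul1r patchE mem_set//.
  by rewrite min_r// max_r.
have EU (F : V -> R) : (forall x, ~ U x -> F x = 0) ->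
    (\int[mu]_(x in Omega) (F x)%:E = \int[mu]_x (F x)%:E)%E.
  move=> F0; rewrite integral_mkcond; apply: eq_integral => x _.
  rewrite patchE; case: ifPn => // /negP xO; rewrite F0// => /DO xO'.
  by apply: xO; rewrite inE.
have ft0 x : ~ U x -> ft x = 0.
  by move=> xU; rewrite /ft indicE memNset// mul0r.
have Ift : \int[mu]_x ft x = 0.
  rewrite /Rintegral -EU// (_ : integral _ _ _ = 0%E)// -f_int; symmetry.
  apply: ae_eq_integral => //; first exact/measurable_EFinP.
  by apply/measurable_EFinP; exact: measurable_funS mft.
have PW m : forall M F, 0 <= M -> source x0 eps0 (D m) M F -> exists v,
     [/\ forall i, bsupp Omega (v i), forall i x, `|v i x| <= M * W m x & moves Omega v F].
  by case: (WP m).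
have [u [mu_ uM udiv]] := solve_source oO fO e0 mD tD DO bW W0 PW iS M0 mft ftM Ift.
exists u; split; last first.
  rewrite ME -EFinM; apply: Linfty_norm_le => [|x Ox]; first by rewrite mulr_ge0.
  have w0 : 0 < w x by exact: lt_le_trans (w1 x).
  rewrite ger0_norm ?enorm_ge0// enormZ ger0_norm ?invr_ge0 ?(ltW w0)//.
  rewrite ler_pdivrMl// (le_trans (enorm_le_sum _))//.
  have -> : w x * (n%:R * M) = \sum_(i < n) M * w x.
    by rewrite sumr_const card_ord -mulr_natr; ring.
  by apply: ler_sum => i _; exact: uM.
split; first exact: measurable_funS mu_.
move=> g G gE; rewrite (udiv g G gE); have [ig _ _] := gE.
have mg : measurable_fun Omega g by apply/measurable_EFinP; exact: (measurable_int mu ig).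
have -> : (\int[mu]_(x in Omega) (f x * g x)%:E = \int[mu]_(x in Omega) (ft x * g x)%:E)%E.
  apply: ae_eq_integral => //.
  - by apply/measurable_EFinP; exact: measurable_funM.
  - by apply/measurable_EFinP; apply: measurable_funM => //; exact: measurable_funS mft.
  - move: ftf; apply: filterS => x fx Ox; have /= fx1 := fx Ox; by rewrite /= EFinM fx1 -EFinM.
congr (- _)%E.
rewrite EU; last by move=> x /ft0 ->; rewrite mul0r.
have iR : mu.-integrable setT (EFin \o (fun x => (g \_ Omega) x * ft x)).
  apply: (@integrable_bounded_mul _ _ _ mu setT _ _ M) => //.
    exact: integrable_patch.
  move=> x _; rewrite (le_trans (ftM x))// ler_piMr// indicE; by case: (_ \in _).
rewrite /Rintegral fineK; last exact: integrable_fin_num iR.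
apply: eq_integral => x _; rewrite patchE; case: ifPn => [_|/negP xO].
  by rewrite mulrC.
by rewrite ft0 ?mul0r ?mulr0// => /DO xO'; apply: xO; rewrite inE.
Qed.

End sufficiency.

(** * Gradients of Lipschitz functions *)

Section representation.
Context d (T : measurableType d) (R : realType).
Variable mu : {sigma_finite_measure set T -> \bar R}.
Implicit Types (F G : T -> R) (Phi : (T -> R) -> R) (Q : set T).

(** On a set of finite measure, bounded pointwise convergence implies convergence in the mean. *)
Lemma bcont_L1_bounded Q Phi (M : R) : measurable Q -> (mu Q < +oo)%E ->
  (forall a F G, bsupp Q F -> bsupp Q G ->
     Phi (fun x => a * F x + G x) = a * Phi F + Phi G) ->
  (forall F, bsupp Q F -> `|Phi F| <= M * \int[mu]_x `|F x|) -> bcont Q Phi.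
Proof.
move=> mQ Qoo Pl PM; split=> // F_ F cF; have bF := bounded_cvg_bsupp cF.
have [bF_ [N F_N] F_F] := cF.
have bB k : bsupp Q (fun x => F x - F_ k x) by exact: bsuppB.
have d0 : (\int[mu]_x `|F x - F_ k x|) @[k --> \oo] --> (0 : R).
  have [_ c] := bcont_int mQ Qoo.
  have := c (fun k x => `|F x - F_ k x|) (fun=> 0).
  rewrite Rintegral_cst// mul0r; apply; split.
  - by move=> k; exact: bsupp_norm.
  - have [_ [L FL] _] := bF; exists (L + N) => k x; rewrite normr_id.
    by rewrite (le_trans (ler_normB _ _))// lerD.
  - move=> x; rewrite -(normr0 R) -(subrr (F x)); apply: cvg_norm.
    by apply: cvgB; [exact: cvg_cst|exact: F_F].
apply/subr_cvg0/norm_cvg0P.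
apply: (@squeeze_cvgr _ _ _ _ (fun=> 0) (fun k => M * \int[mu]_x `|F x - F_ k x|)).
- apply: nearW => k; rewrite normr_ge0/=.
  have := PM _ (bB k); have := Pl (-1) _ _ (bF_ k) bF; rewrite mulN1r.
  under [X in Phi X]eq_fun do rewrite mulN1r addrC.
  by move=> ->; rewrite addrC distrC.
- exact: cvg_cst.
- by rewrite -(mulr0 M); apply: cvgMl_tmp.
Qed.

(** Duality of the integrable and the essentially bounded functions, on bounded functions supported
    in [Q]: [Phi] defines a charge dominated by [mu], whose Radon-Nikodym density represents it. *)
Lemma L1_bounded_representation Q Phi : measurable Q -> (mu Q < +oo)%E ->
  (forall a F G, bsupp Q F -> bsupp Q G ->
     Phi (fun x => a * F x + G x) = a * Phi F + Phi G) ->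
  (forall F, bsupp Q F -> `|Phi F| <= \int[mu]_x `|F x|) ->
  exists h : T -> R, [/\ measurable_fun setT h, forall x, `|h x| <= 1 &
    forall F, bsupp Q F -> Phi F = \int[mu]_x (h x * F x)].
Proof.
move=> mQ Qoo Pl P1.
have bPhi : bcont Q Phi.
  by apply: (bcont_L1_bounded mQ Qoo Pl (M := 1)) => F bF; rewrite mul1r P1.
have bI A : measurable A -> bsupp Q (\1_(A `&` Q) : T -> R).
  by move=> mA; apply: bsupp_indic; [exact: measurableI|exact: subIsetr].
(* Intersecting with [Q] turns a functional on functions supported in [Q] into a charge on the whole
   space. *)
pose nu (A : set T) : \bar R := (Phi \1_(A `&` Q))%:E.
have nu0 : nu set0 = 0%E.
  by rewrite /nu set0I indic0 (bcont0 bPhi).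
have nufin A : measurable A -> nu A \is a fin_num by [].
have nusa : semi_sigma_additive nu.
  move=> A mA tA mUA; rewrite /nu setI_bigcupl.
  have SE k x : \sum_(0 <= i < k) \1_(A i `&` Q) x = \1_(\bigcup_(i < k) (A i `&` Q)) x :> R.
    by rewrite big_mkord; apply: (sum_indic_trivIset _ _ (D := fun i => A i `&` Q)); exact: trivIset_setIr.
  rewrite (_ : (fun n => _) = EFin \o (fun k => Phi (fun x => \sum_(0 <= i < k) \1_(A i `&` Q) x))).
    apply: cvg_EFin; first exact: nearW.
    have [_ cP] := bPhi; apply: cP; split.
    - by move=> k; apply: bsupp_sum => i; exact: bI.
    - exists 1 => k x; rewrite SE indicE; case: (_ \in _); rewrite ?normr1 ?normr0//.
    - move=> x; under eq_fun do rewrite SE.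
      have [[m _ xm]|nx] := pselect ((\bigcup_m (A m `&` Q)) x); last first.
        apply: cvg_near_cst; apply: nearW => N; rewrite !indicE !memNset//.
        by move=> [m _ xm]; apply: nx; exists m.
      rewrite [\1_(\bigcup_k (A k `&` Q)) x]indicE mem_set; last by exists m.
      apply: cvg_near_cst; exists m.+1 => // N /= mN; rewrite indicE mem_set//.
      by exists m.
  by apply/funext => k /=; rewrite sumEFin (bcont_sum _ bPhi)// => i; exact: bI.
pose nu_charge := isCharge.Build _ _ _ nu nu0 nufin nusa.
pose c : {charge set T -> \bar R} := HB.pack nu nu_charge.
have Phi_le A : measurable A -> A `<=` Q -> `|Phi \1_A| <= fine (mu A).
  move=> mA AQ; have := P1 _ (bsupp_indic R mA AQ); move=> /le_trans; apply.
  rewrite (_ : (fun x => _) = \1_A) /Rintegral ?integral_indic ?setIT//.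
  by apply/funext => x; rewrite indicE; case: (_ \in _); rewrite ?normr1 ?normr0.
have cmu : c `<< mu.
  apply/null_content_dominatesP => A mA A0; congr EFin; apply/eqP.
  rewrite -normr_le0 (le_trans (Phi_le _ _ _))//; first exact: measurableI.
  rewrite (_ : mu (A `&` Q) = 0%E)//; apply/eqP; rewrite eq_le measure_ge0 andbT -A0.
  by apply: le_measure; rewrite ?inE//; exact: measurableI.
pose h0 := Radon_Nikodym c mu; pose h1 x := fine (h0 x).
have h0E : h0 = EFin \o h1.
  by apply/funext => x; rewrite /= fineK// Radon_Nikodym_fin_num.
have ih1 : mu.-integrable setT (EFin \o h1).
  by rewrite -h0E; exact: Radon_Nikodym_integrable.
have mh1 : measurable_fun setT h1 by apply/measurable_EFinP; exact: measurable_int ih1.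
have PhiE A : measurable A -> A `<=` Q -> Phi \1_A = \int[mu]_(x in A) h1 x.
  move=> mA AQ; have := Radon_Nikodym_integral cmu mA.
  by rewrite -/h0 h0E /Rintegral => <-; rewrite /= /nu setIidl.
(* On the set [A] where [s * h1] exceeds 1, the integral of [s * h1 - 1] is [s * Phi \1_A] minus the
   measure of [A], hence at most 0, although the integrand is positive there. So [A] is null. *)
have clip (s : R) : `|s| = 1 -> {ae mu, forall x, Q x -> s * h1 x <= 1}.
  move=> s1; pose u x := s * h1 x - 1.
  have mu_ : measurable_fun setT u by apply: measurable_funB => //; exact: measurable_funM.
  pose A := Q `&` [set x | 0 < u x].
  have mA : measurable A.
    apply: measurableI => //; rewrite -[X in measurable X]setTI.
    have := measurable_fun_ltr (measurable_cst (0 : R)) mu_ measurableT (Y := [set true]) I.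
    by rewrite setTI.
  have AQ : A `<=` Q by exact: subIsetl.
  have Aoo : (mu A < +oo)%E by apply: le_lt_trans Qoo; apply: le_measure; rewrite ?inE.
  have i1 : mu.-integrable A (EFin \o h1) by exact: integrableS ih1.
  have is1 : mu.-integrable A (EFin \o (fun x => s * h1 x)).
    rewrite (_ : _ \o _ = (fun x => s%:E * (EFin \o h1) x)%E)//; exact: integrableZl.
  have ic : mu.-integrable A (EFin \o (fun=> 1 : R)).
    apply/integrableP; split; first exact: measurable_cst.
    by rewrite integral_cst// normr1 mul1e.
  have iu : mu.-integrable A (EFin \o u).
    rewrite (_ : _ \o u = (fun x => (EFin \o (fun x => s * h1 x)%R) x - (EFin \o (fun=> 1%R : R)) x)%E)//.
    exact: integrableB.
  have u0 : \int[mu]_(x in A) u x <= 0.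
    rewrite /u RintegralB// RintegralZl// -PhiE// Rintegral_cst// mul1r subr_le0.
    by rewrite (le_trans (ler_norm _))// normrM s1 mul1r Phi_le.
  have I0 : (\int[mu]_(x in A) `|(EFin \o u) x| = 0)%E.
    rewrite (@eq_integral _ _ _ mu A (EFin \o u)); last first.
      by move=> x /set_mem[_ /ltW ux]; rewrite gee0_abs.
    apply/eqP; rewrite eq_le integral_ge0 ?andbT; last by move=> x [_ /ltW].
    by rewrite -(fineK (integrable_fin_num mA iu)).
  move/(ae_eq_integral_abs mu mA (measurable_int mu iu)) : I0.
  apply: filterS => x xA Qx; rewrite leNgt; apply/negP => ux.
  have Ax : A x by split => //=; rewrite /u subr_gt0.
  by have := xA Ax; rewrite /= => -[u0']; move: ux; rewrite -subr_gt0 -/(u x) u0' ltxx.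
(* Clipping alters [h1] on a null set of [Q] only and makes the bound hold at every point. *)
pose h x := Num.max (- 1) (Num.min 1 (h1 x)).
have mh : measurable_fun setT h.
  by apply: measurable_maxr => //; exact: measurable_minr.
have hM x : `|h x| <= 1.
  by rewrite /h ler_norml le_max lexx/= ge_max ge_min lexx/= andbT; lra.
have hh1 : ae_eq mu Q (EFin \o h1) (EFin \o h).
  have := clip (- 1); rewrite normrN normr1 => /(_ erefl) c1.
  have := clip 1; rewrite normr1 => /(_ erefl); move: c1.
  apply: filterS2 => x x1 x2 Qx; have := x1 Qx; have := x2 Qx.
  rewrite mulN1r mul1r => {}x2 {}x1; rewrite /= /h min_r// max_r//; lra.
have mQh : measurable_fun setT (fun x => h x * \1_Q x) by exact: measurable_funM.
have bQh : bsupp Q (fun x => h x * \1_Q x).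
  by apply: bsuppM => //; [exact: bsupp_indic|exists 1].
exists (fun x => h x * \1_Q x); split => //.
  by move=> x; rewrite normrM -[leRHS]mul1r ler_pM// indicE; case: (_ \in _); rewrite ?normr1 ?normr0.
have iQh := bsupp_integrable mQ Qoo bQh.
have bP := bcont_Rintegral Q iQh.
move=> F bF; apply/eqP; rewrite -subr_eq0; apply/eqP.
have := bcont_eq0 (bcont_comb (- 1) bP bPhi) _ bF.
rewrite mulN1r addrC; apply => A mA AQ; rewrite mulN1r addrC PhiE//.
apply/eqP; rewrite subr_eq0; apply/eqP.
transitivity (\int[mu]_(x in A) h x).
  congr fine; apply: ae_eq_integral => //.
  - by apply/measurable_EFinP; exact: measurable_funS mh1.
  - by apply/measurable_EFinP; exact: measurable_funS mh.
  - by apply: filterS hh1 => x xQ /AQ.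
rewrite Rintegral_mkcond; apply: eq_Rintegral => x _; rewrite patchE !indicE.
by case: ifPn => [/set_mem Ax|_]; rewrite ?mulr0// mem_set ?mulr1//; exact: AQ.
Qed.

End representation.

(** * Translation invariance of the Lebesgue measure *)

Section translation.
Context (R : realType) (n : nat).
Local Notation V := 'rV[R]_n.
Local Notation mu := (@lebesgue_rV R n).

Lemma measurable_translate (c : V) : measurable_fun setT (fun x : V => x + c).
Proof.
apply: measurable_fun_rV => i; under eq_fun do rewrite mxE.
by apply: measurable_funD => //; exact: measurable_rV_coord.
Qed.

(** Both measures agree on boxes, which form a generating pi-system exhausting the space by sets of
    finite measure. *)
Lemma lebesgue_rV_translate (c : V) (A : set V) : measurable A ->
  pushforward mu (fun x => x + c) A = mu A.
Proof.
pose m2 : {measure set V -> \bar R} :=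
  @measure_function_pushforward__canonical__measure_function_Measure _ _ _ _ _
    mu (fun x => x + c) (measurable_translate c).
have shiftE (a b : 'I_n -> R) : (fun x : V => x + c) @^-1` box a b =
    box (fun i => a i - c ord0 i) (fun i => b i - c ord0 i).
  by apply/seteqP; split => x /= H i; have := H i; rewrite mxE; lra.
move=> mA; apply: (@measure_unique _ R V (@boxes R n) (fun k => box (fun=> - k%:R) (fun=> k%:R))
  (@measurable_boxes R n) (@boxes_setI R n) _ _ m2 mu) => //.
- by move=> i; do 2 eexists.
- apply/seteqP; split => // x _; pose k := (Num.truncn `|x|).+1; exists k => // i.
  by rewrite -ltr_norml (le_lt_trans (coord_le_norm _ _))// truncnS_gt.
- move=> _ [a [b ->]]; rewrite /m2 /= /pushforward.
  have boxE (p q : 'I_n -> R) : mu (box p q) = (\prod_(i < n) @lebesgue_measure R `]p i, q i[)%E.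
    by rewrite -lebesgue_rV_box//; congr (mu _).
  rewrite shiftE !boxE; apply: eq_bigr => i _; rewrite !lebesgue_measure_itv/= !lte_fin ltrD2r.
  by case: ifP => // _; rewrite -!EFinB; congr EFin; ring.
- by move=> k; rewrite /m2 /= /pushforward shiftE box_finite.
Qed.

Lemma Rintegral_translate (c : V) (F : V -> R) : measurable_fun setT F ->
  mu.-integrable setT (EFin \o (fun x => F (x + c))) ->
  \int[mu]_x F (x + c) = \int[mu]_x F x.
Proof.
move=> mF iF; congr fine.
have mF' : measurable_fun setT (EFin \o F) by exact/measurable_EFinP.
have := integral_pushforward (measurable_translate c) mF' iF measurableT.
rewrite preimage_setT => <-.
apply: eq_measure_integral; first exact: measurable_translate.
by move=> mT A mA _; exact: lebesgue_rV_translate.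
Qed.

End translation.

Section calculus.
Context (R : realType) (n : nat).
Local Notation V := 'rV[R]_n.
Implicit Types (phi : V -> R).

Lemma open_continuous_measurable_rV (O : set V) (f : V -> R) : open O ->
  (forall x, O x -> {for x, continuous f}) -> measurable_fun O f.
Proof.
move=> oO cf; apply: (measurability _ (RGenOpens.measurableE R)).
move=> _ [_ [a [b ->] <-]]; apply: open_measurable_rV.
rewrite openE => x [Ox fx]; apply: filterI; first exact: open_nbhs_nbhs.
by apply: (cf x Ox); apply: open_nbhs_nbhs; split => //; exact: interval_open.
Qed.

Lemma is_derive_line phi (x e : V) (t : R) : derivable phi (x + t *: e) e ->
  is_derive t (1 : R) (fun s : R => phi (x + s *: e)) ('D_e phi (x + t *: e)).
Proof.
have E : (fun h : R => h^-1 *: (((fun s : R => phi (x + s *: e)) \o shift t) (h *: 1) - phi (x + t *: e)))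
    = (fun h : R => h^-1 *: ((phi \o shift (x + t *: e)) (h *: e) - phi (x + t *: e))).
  apply/funext => h /=; congr (_ *: (phi _ - _)).
  by rewrite [h *: 1]mulr1 scalerDl addrCA addrC.
by move=> d; split; rewrite /derivable /derive ?E.
Qed.

Lemma difference_le phi (e : V) (M : R) : (forall x, derivable phi x e) ->
  (forall x, `|'D_e phi x| <= M) -> forall x (s : R), 0 <= s ->
  `|phi (x + s *: e) - phi x| <= M * s.
Proof.
move=> dphi DM x s s0.
have dl t := is_derive_line (dphi (x + t *: e)).
have [c _] : exists2 c : R, c \in `[0, s]%R &
    phi (x + s *: e) - phi (x + 0 *: e) = 'D_e phi (x + c *: e) * (s - 0).
  apply: (@MVT_segment R (fun t => phi (x + t *: e)) (fun t => 'D_e phi (x + t *: e))) => //.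
  by apply: continuous_subspaceT; exact: is_derive1_continuous dl.
rewrite scale0r addr0 subr0 => ->.
by rewrite normrM (ger0_norm s0) ler_wpM2r.
Qed.

Lemma difference_quotient_cvg phi (e x : V) : derivable phi x e ->
  m.+1%:R * (phi (x - m.+1%:R^-1 *: e) - phi x) @[m --> \oo] --> - 'D_e phi x.
Proof.
move=> d; pose h (m : nat) : R := - m.+1%:R^-1.
have h0 : h @ \oo --> (0 : R)^'.
  have : h @ \oo --> (0 : R) by rewrite -oppr0; apply: cvgN; exact: cvg_harmonic.
  have hm m : h m != 0 by rewrite oppr_eq0 invr_eq0 pnatr_eq0.
  move=> h0 A /= /h0 A0; have : \forall m \near \oo, h m != 0 -> A (h m) := A0.
  by apply: filterS => m; apply.
have := cvg_comp h _ h0 d.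
move=> /cvgN; apply: cvg_trans; apply: near_eq_cvg; apply: nearW => m /=.
rewrite [LHS](_ : _ = - ((h m)^-1 * (phi (h m *: e + x) - phi x)))//.
by rewrite /h scaleNr [- _ + x]addrC invrN invrK mulNr opprK.
Qed.

Lemma derive_out (e : V) phi (K : set V) : closed K -> (forall x, ~ K x -> phi x = 0) ->
  forall x, ~ K x -> 'D_e phi x = 0.
Proof.
move=> cK phi0 x Kx; rewrite (near_eq_derive _ (g := cst 0)) ?derive_cst//.
have : nbhs x (~` K) by apply: open_nbhs_nbhs; split => //; exact: closed_openC.
by apply: filterS => y /phi0.
Qed.

Lemma continuous_bounded_support phi (K : set V) : compact K -> continuous phi ->
  (forall x, ~ K x -> phi x = 0) -> exists2 M, 0 <= M & forall x, `|phi x| <= M.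
Proof.
move=> cK cphi phi0.
have [M [_ MK]] := compact_bounded (continuous_compact (continuous_subspaceT cphi) cK).
exists (`|M| + 1) => [|x]; first by rewrite addr_ge0.
have [Kx|/phi0 ->] := pselect (K x); last by rewrite normr0 addr_ge0.
apply: (MK (`|M| + 1)); last by exists x.
by rewrite (le_lt_trans (ler_norm M)) ?ltrDl.
Qed.

(** A cluster point of an ultrafilter is a limit, and compactness of the segment provides one. This
    takes the place of extracting a subsequence. *)
Lemma ultra_bounded_cvg (U : set_system nat) (u : nat -> R) (M : R) : UltraFilter U ->
  (forall k, `|u k| <= M) -> cvg (u @ U).
Proof.
move=> UU uM.
have pU : ProperFilter (u @ U) by exact: fmap_proper_filter.
have [|p [_ cl]] := @segment_compact R (- M) M _ pU.
  by rewrite /fmap /=; apply: filterE => k /=; rewrite in_itv/= -ler_norml.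
apply/cvg_ex; exists p => N Np.
have [//|UN] := in_ultra_setVsetC (u @^-1` N) UU.
have [|y []] := cl (~` N) N _ Np; last by [].
by [].
Qed.

End calculus.

Section lipschitz.
Context (R : realType) (n : nat).
Local Notation V := 'rV[R]_n.
Local Notation mu := (@lebesgue_rV R n).
Implicit Types (Omega : set V) (g : V -> R).

Lemma bsupp_integral Omega (F : V -> R) : measurable Omega -> (mu Omega < +oo)%E ->
  bsupp Omega F -> (\int[mu]_(x in Omega) (F x)%:E = (\int[mu]_x F x)%:E)%E.
Proof.
move=> mO fO bF; have iF := bsupp_integrable mO fO bF; have [_ _ F0] := bF.
have -> : (\int[mu]_(x in Omega) (F x)%:E = \int[mu]_x (F x)%:E)%E.
  rewrite integral_mkcond; apply: eq_integral => x _; rewrite patchE.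
  by case: ifPn => // /negP xO; rewrite F0// => Ox; apply: xO; rewrite inE.
by rewrite /Rintegral fineK//; exact: integrable_fin_num iF.
Qed.

(** Only cubes inside [Omega] are considered because they are convex: points of [Omega] that are
    close to each other across a piece of the boundary may be far apart for the geodesic
    distance. *)
Definition locally_lipschitz Omega g := forall z (r : R), ccube z r `<=` Omega ->
  forall x y, ccube z r x -> ccube z r y -> `|g x - g y| <= enorm (x - y).

Lemma ccube_shift (x : V) (i : 'I_n) (r : R) : 0 <= r ->
  ccube x r (x + r *: delta_mx ord0 i).
Proof.
move=> r0 k; rewrite !mxE eqxx/=; case: eqP => _; rewrite ?mulr1 ?mulr0; lra.
Qed.

Lemma enorm_delta (i : 'I_n) : enorm (delta_mx ord0 i : V) = 1.
Proof.
rewrite /enorm /dotr (bigD1 i)//= big1 ?addr0; first by rewrite mxE !eqxx mul1r sqrtr1.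
by move=> k /negPf ki; rewrite mxE eqxx ki mul0r.
Qed.

Lemma closure_support (phi : V -> R) x : ~ closure [set x | phi x != 0] x -> phi x = 0.
Proof.
by move=> Kx; apply/eqP; apply/negPn/negP => px; apply: Kx; exact: subset_closure.
Qed.

Lemma test_function_bsupp Omega phi : test_function Omega phi -> bsupp Omega phi.
Proof.
move=> [sphi cK KO]; have [cphi _] := sphi [::].
have [L0 _ phiL0] := continuous_bounded_support cK cphi (@closure_support phi).
split; [|by exists L0|by move=> x Ox; apply: closure_support => /KO].
by apply: open_continuous_measurable_rV; [exact: openT|move=> x _; exact: cphi].
Qed.

Lemma partial_bsupp Omega phi (i : 'I_n) : test_function Omega phi ->
  bsupp Omega (partial i phi).
Proof.
move=> [sphi cK KO]; have [cdphi _] := sphi [:: i].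
have dphi0 := derive_out (delta_mx ord0 i) (@closed_closure _ _) (@closure_support phi).
have [L _ dphiL] := continuous_bounded_support cK cdphi dphi0.
split; [|by exists L|by move=> x Ox; apply: dphi0 => /KO].
by apply: open_continuous_measurable_rV; [exact: openT|move=> x _; exact: cdphi].
Qed.

(* The difference quotients of g, clipped to [-1, 1], converge along an
   ultrafilter as functionals; Radon-Nikodym turns the limit into a function. *)
Lemma locally_lipschitz_partial Omega g (i : 'I_n) : open Omega -> (mu Omega < +oo)%E ->
  bsupp Omega g -> locally_lipschitz Omega g ->
  exists h : V -> R, [/\ measurable_fun setT h, forall x, `|h x| <= 1 &
    forall phi, test_function Omega phi ->
      \int[mu]_x (g x * partial i phi x) = - \int[mu]_x (h x * phi x)].
Proof.
move=> oO fO bg gL; have mO := open_measurable_rV oO.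
have [mg [N gN] g0] := bg.
pose e : V := delta_mx ord0 i.
(* Clipping gives a bound at every point, including those whose translate leaves [Omega], where the
   Lipschitz condition says nothing. *)
pose D (m : nat) (x : V) : R := Num.max (- 1) (Num.min 1 (m.+1%:R * (g (x + m.+1%:R^-1 *: e) - g x))).
have mtr (c : V) (f : V -> R) : measurable_fun setT f -> measurable_fun setT (fun x : V => f (x + c)).
  by move=> mf; apply: (measurableT_comp mf); exact: measurable_translate.
have mD m : measurable_fun setT (D m).
  apply: measurable_maxr => //; apply: measurable_minr => //.
  by apply: measurable_funM => //; apply: measurable_funB => //; exact: mtr.
have D1 m x : `|D m x| <= 1.
  by rewrite /D ler_norml le_max lexx/= ge_max ge_min lexx/= andbT; lra.
(* One ultrafilter serves all functions [F] simultaneously, so the limit is linear in [F]. *)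
have [U [UU oU]] := ultraFilterLemma (eventually_filter).
have bDM m F : bsupp Omega F -> bsupp Omega (fun x => D m x * F x).
  by move=> bF; apply: bsuppM => //; exists 1.
have PhiM F m : bsupp Omega F -> `|\int[mu]_x (D m x * F x)| <= \int[mu]_x `|F x|.
  move=> bF; have iDF := bsupp_integrable mO fO (bDM m F bF).
  rewrite (le_trans (le_normr_Rintegral _ _))//; apply: le_Rintegral => //.
  - exact: bsupp_integrable mO fO (bsupp_norm (bDM m F bF)).
  - exact: bsupp_integrable mO fO (bsupp_norm bF).
  - by move=> x _; rewrite normrM ler_piMl.
pose Phi F : R := lim ((fun m => \int[mu]_x (D m x * F x)) @ U).
have Phic F : bsupp Omega F -> (fun m => \int[mu]_x (D m x * F x)) @ U --> Phi F.
  by move=> bF; apply: (ultra_bounded_cvg UU) => m; exact: PhiM.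
have [h [mh h1 hE]] : exists h : V -> R, [/\ measurable_fun setT h, forall x, `|h x| <= 1 &
    forall F, bsupp Omega F -> Phi F = \int[mu]_x (h x * F x)].
  apply: L1_bounded_representation => //.
    move=> a F G bF bG; apply: cvg_lim => //.
    rewrite (_ : (fun m => _) = (fun m => a * \int[mu]_x (D m x * F x) + \int[mu]_x (D m x * G x))).
      by apply: cvgD; [apply: cvgMl_tmp|]; exact: Phic.
    apply/funext => m; have [dl _] := bcont_int mO fO.
    rewrite -dl; [|exact: bDM..]; apply: eq_Rintegral => x _ /=; ring.
  move=> F bF; have := Phic F bF => /cvg_norm cF.
  rewrite -(cvg_lim _ cF)//; apply: limr_le; first by apply/cvg_ex; exists `|Phi F|.
  by apply: filterE => m; exact: PhiM.
exists h; split => // phi tphi; have [sphi cK KO] := tphi.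
have [cphi dphi] := sphi [::].
have phi0 := closure_support (phi := phi).
have bphi : bsupp Omega phi := test_function_bsupp tphi.
have [mphi [L0 phiL0] _] := bphi.
have [mdphi [L dphiL] _] := partial_bsupp i tphi.
rewrite -hE//; apply/esym/eqP; rewrite eqr_oppLR; apply/eqP.
apply: cvg_lim => //.
have dphi' x : derivable phi x e by exact: dphi.
have r0 (m : nat) : 0 < m.+1%:R^-1 :> R by rewrite invr_gt0.
pose q (m : nat) (x : V) : R := m.+1%:R * (phi (x - m.+1%:R^-1 *: e) - phi x).
have [dlt dlt0 tube] := compact_tube cK oO KO.
have near_q : \forall m \near \oo, \int[mu]_x (g x * q m x) = \int[mu]_x (D m x * phi x).
  have : \forall m \near \oo, m.+1%:R^-1 <= dlt.
    have := @cvg_harmonic R => /cvgr_le; exact.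
  apply: filterS => m mdlt; pose r : R := m.+1%:R^-1.
  have mr : m.+1%:R * r = 1 by rewrite mulfV.
  pose A (x : V) := g (x + r *: e) * phi x; pose B (x : V) := phi x * g x.
  pose C (x : V) := phi (x - r *: e) * g x.
  have bA : bsupp Omega A.
    by apply: bsuppM => //; [exact: mtr|exists N].
  have bB : bsupp Omega B by apply: bsuppM => //; exists L0.
  have bC : bsupp Omega C by apply: bsuppM => //; [exact: mtr|exists L0].
  (* Discrete integration by parts: translation invariance moves the shift from [g] to [phi]. *)
  have AC : \int[mu]_x A x = \int[mu]_x C x.
    have CA : (fun x : V => C (x + r *: e)) = A.
      by apply/funext => x; rewrite /C addrK mulrC.
    rewrite -(@Rintegral_translate _ _ (r *: e) C) ?CA//; first by case: bC.
    exact: bsupp_integrable mO fO bA.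
  (* On the support of [phi] the cube of radius [r] about [x] lies in [Omega], so the quotient is
     already in [-1, 1] and clipping has no effect; elsewhere both sides are 0. *)
  have DE : (fun x => D m x * phi x) = (fun x => m.+1%:R * (A x - B x)).
    apply/funext => x; rewrite /A /B.
    have [Kx|/phi0 ->] := pselect (closure [set x | phi x != 0] x); last by rewrite mulr0 mul0r subr0 !mulr0.
    have xO : ccube x r `<=` Omega.
      by move=> y /(ccube_norm (ltW (r0 m))) yx; apply: (tube x) => //; exact: le_trans mdlt.
    have := gL x r xO _ _ (ccube_shift x i (ltW (r0 m))) (ccube_center x (ltW (r0 m))).
    have -> : x + r *: delta_mx ord0 i - x = r *: e by rewrite addrC addKr.
    rewrite enormZ enorm_delta mulr1 (ger0_norm (ltW (r0 m))) ler_norml -/e => /andP[g1 g2].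
    rewrite /D -/r min_r ?max_r; first by ring.
      by have := ler_wpM2l (ler0n R m.+1) g1; rewrite mulrN mr.
    by have := ler_wpM2l (ler0n R m.+1) g2; rewrite mr.
  have qE : (fun x => g x * q m x) = (fun x => m.+1%:R * (C x - B x)).
    by apply/funext => x; rewrite /q /C /B -/r; ring.
  have cI := bcont_int mO fO.
  rewrite DE qE (bcontZ _ cI (bsuppB bC bB)) (bcontZ _ cI (bsuppB bA bB)).
  by rewrite (bcontB cI bC bB) (bcontB cI bA bB) AC.
have ig : mu.-integrable setT (EFin \o g) := bsupp_integrable mO fO bg.
have [_ Cg] := bcont_Rintegral setT ig.
have cq : (fun m => \int[mu]_x (g x * q m x)) @ \oo --> - (\int[mu]_x (g x * partial i phi x)).
  have -> : - (\int[mu]_x (g x * partial i phi x)) = \int[mu]_x (g x * - partial i phi x).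
    have bgp : bsupp Omega (fun x => partial i phi x * g x) by apply: bsuppM => //; exists L.
    rewrite -mulN1r (_ : (fun x => g x * partial i phi x) = (fun x => partial i phi x * g x)).
      rewrite -(bcontZ _ (bcont_int mO fO) bgp); apply: eq_Rintegral => x _ /=; ring.
    by apply/funext => x; rewrite mulrC.
  apply: Cg; split.
  - move=> m; split; last by move=> x; apply: contra_notP.
      by apply: measurable_funM => //; apply: measurable_funB => //; exact: mtr.
    exists (m.+1%:R * (L0 + L0)) => x.
    by rewrite /q normrM ger0_norm// ler_wpM2l// (le_trans (ler_normB _ _))// lerD.
  - exists L => m x; rewrite /q normrM ger0_norm// distrC.
    have := difference_le dphi' dphiL (x - m.+1%:R^-1 *: e) (ltW (r0 m)).
    by rewrite subrK => /(ler_wpM2l (ler0n R m.+1)); rewrite mulrCA mulfV ?mulr1// pnatr_eq0.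
  - by move=> x; exact: difference_quotient_cvg.
(* An ordinary limit is also a limit along [U], which is finer than [\oo], and the two sequences
   agree eventually. *)
apply: (@cvg_trans _ ((fun m => \int[mu]_x (g x * q m x)) @ \oo)) => //.
move=> P PD; apply: oU.
have : \forall m \near \oo, P (\int[mu]_x (g x * q m x)) := PD.
by apply: filterS2 near_q => m /= <-.
Qed.

(** The partial derivatives are obtained separately, each bounded by 1, so the Euclidean norm is
    bounded by their number. *)
Lemma locally_lipschitz_gradient Omega g : open Omega -> (mu Omega < +oo)%E ->
  bsupp Omega g -> locally_lipschitz Omega g ->
  exists G, distributional_gradient Omega g G /\ forall x, enorm (G x) <= n%:R.
Proof.
move=> oO fO bg gL; have mO := open_measurable_rV oO.
have /choice[h hP] := fun i => locally_lipschitz_partial i oO fO bg gL.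
exists (fun x => \row_i h i x); split; last first.
  move=> x; rewrite (le_trans (enorm_le_sum _))//.
  rewrite (@le_trans _ _ (\sum_(i < n) 1))//; last by rewrite sumr_const card_ord.
  by apply: ler_sum => i _; rewrite mxE; have [_ h1 _] := hP i.
have mh i : measurable_fun setT (h i) by have [] := hP i.
split.
- apply: (@measurable_funS _ _ _ _ setT) => //; apply: measurable_fun_rV => i.
  rewrite (_ : (fun _ => _) = h i); first exact: mh.
  by apply/funext => x; rewrite mxE.
- move=> K i cK KO.
  have mK : measurable K.
    rewrite -(setCK K); apply: measurableC; apply: open_measurable_rV.
    by apply: closed_openC; apply: compact_closed => //; exact: norm_hausdorff.
  have fK : (mu K < +oo)%E.
    by apply: le_lt_trans fO; apply: le_measure; rewrite ?inE.
  have i1 : mu.-integrable K (EFin \o (fun=> 1 : R)).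
    apply/integrableP; split; first exact: measurable_cst.
    by rewrite integral_cst// normr1 mul1e.
  have mhK : measurable_fun K (h i) by exact: measurable_funS (mh i).
  have h1 x : K x -> `|h i x| <= 1 by move=> _; have [_ + _] := hP i; apply.
  have := integrable_bounded_mul mK i1 mhK h1.
  by congr (_.-integrable _ _); apply/funext => x /=; rewrite mxE mul1r.
- move=> phi i tphi; have [mhi h1 hE] := hP i; have [mg [N gN] _] := bg.
  have [mphi [L phiL] _] := test_function_bsupp tphi.
  have bgp : bsupp Omega (fun x => g x * partial i phi x).
    by apply: bsuppM; [exact: partial_bsupp|exact: mg|exists N].
  have bhp : bsupp Omega (fun x => h i x * phi x).
    by apply: bsuppM; [exact: test_function_bsupp|exact: mhi|exists 1].
  rewrite (bsupp_integral mO fO bgp) hE// EFinN -(bsupp_integral mO fO bhp).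
  by congr (- _)%E; apply: eq_integral => x _; rewrite mxE.
Qed.

End lipschitz.

(** * Necessity of the integrability *)

Section necessity.
Context (R : realType) (n : nat).
Local Notation V := 'rV[R]_n.
Local Notation mu := (@lebesgue_rV R n).
Implicit Types (Omega : set V) (g : V -> R).

Lemma locally_lipschitz_continuous Omega g x : open Omega -> locally_lipschitz Omega g ->
  Omega x -> {for x, continuous g}.
Proof.
move=> oO gL Ox; have [e e0 eO] := open_ccube oO Ox.
(* The factor [n] between the two norms is enlarged to [n.+1] so that the quotient is positive also
   for [n = 0]. *)
apply/(@cvgrPdist_lt _ _ _ (nbhs x) (nbhs_filter x)) => eps eps0; pose r := Num.min e (eps / n.+1%:R).
have r0 : 0 < r by rewrite /r lt_min e0 divr_gt0.
apply/nbhs_ballP; exists r => // y; rewrite -ball_normE /= lt_min => /andP[ye yeps].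
have ey : ccube x e y.
  move=> k; have := le_lt_trans (coord_le_norm (x - y) k) ye; rewrite !mxE ltr_norml.
  by move=> /andP[h1 h2]; apply/andP; split; lra.
rewrite (le_lt_trans (gL x e eO _ _ (ccube_center x (ltW e0)) ey))//.
rewrite (le_lt_trans (enorm_le_norm _))//.
apply: (@le_lt_trans _ _ (n.+1%:R * `|x - y|)); first by rewrite ler_wpM2r// ler_nat.
by rewrite mulrC -ltr_pdivlMr.
Qed.

Definition truncated_dist Omega x0 (k : nat) (x : V) : R :=
  fine (Order.min (geodesic_dist Omega x x0) k%:R%:E).

Local Notation tr := truncated_dist.

Lemma truncated_distE Omega x0 k x :
  (tr Omega x0 k x)%:E = Order.min (geodesic_dist Omega x x0) k%:R%:E.
Proof.
rewrite /tr fineK// ge0_fin_numE; last by rewrite le_min geodesic_dist_ge0 lee_fin ler0n.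
by rewrite gt_min ltry orbT.
Qed.

Lemma truncated_dist_ge0 Omega x0 k x : 0 <= tr Omega x0 k x.
Proof. by rewrite -lee_fin truncated_distE le_min geodesic_dist_ge0 lee_fin ler0n. Qed.

Lemma truncated_dist_le Omega x0 k x : tr Omega x0 k x <= k%:R.
Proof. by rewrite -lee_fin truncated_distE ge_min lexx orbT. Qed.

Lemma truncated_dist_lipschitz Omega x0 k : locally_lipschitz Omega (tr Omega x0 k).
Proof.
move=> z r zO.
suff H x y : ccube z r x -> ccube z r y ->
    tr Omega x0 k x <= enorm (x - y) + tr Omega x0 k y.
  move=> x y zx zy; have := H _ _ zx zy; have := H _ _ zy zx.
  by rewrite ler_norml -(enormN (y - x)) opprB => h1 h2; apply/andP; split; lra.
move=> zx zy; rewrite -lee_fin EFinD !truncated_distE.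
have := geodesic_dist_ccube x0 zO zx zy; rewrite -(enormN (y - x)) opprB => h.
have [_|_] := leP (geodesic_dist Omega y x0) k%:R%:E.
  by rewrite (le_trans _ h)// ge_min lexx.
by rewrite -EFinD ge_min !lee_fin lerDr enorm_ge0 orbT.
Qed.

Lemma truncated_dist_cvg Omega x0 x :
  (tr Omega x0 k x)%:E @[k --> \oo] --> geodesic_dist Omega x x0.
Proof.
under eq_fun do rewrite truncated_distE.
have := geodesic_dist_ge0 Omega x x0; case: (geodesic_dist Omega x x0) => [r||]// r0.
  apply: cvg_near_cst; exists (Num.truncn r).+1 => // k /= rk.
  rewrite min_l// lee_fin (le_trans (ltW (truncnS_gt r)))// ler_nat//.
apply/cvgeyPge => A; exists (Num.truncn A).+1 => // k /= rk.
by rewrite le_min leey lee_fin (le_trans (ltW (truncnS_gt A)))// ler_nat.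
Qed.

Lemma truncated_dist_nd Omega x0 x : {homo (fun k => (tr Omega x0 k x)%:E) : k l / (k <= l)%N >-> (k <= l)%E}.
Proof.
by move=> k l kl; rewrite !truncated_distE le_min2// lee_fin ler_nat.
Qed.

Lemma truncated_dist_measurable Omega x0 k : open Omega ->
  measurable_fun Omega (tr Omega x0 k).
Proof.
move=> oO; apply: open_continuous_measurable_rV => // x Ox.
exact: (locally_lipschitz_continuous oO (@truncated_dist_lipschitz Omega x0 k)).
Qed.

Lemma measurable_enorm (D : set V) (G : V -> V) : measurable_fun D G ->
  measurable_fun D (fun x => enorm (G x)).
Proof.
move=> mG; apply: (measurableT_comp (continuous_measurable_fun (@sqrt_continuous R))).
by apply: measurable_sum => i; apply: measurable_funM; apply: (measurableT_comp (measurable_rV_coord i)).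
Qed.

Lemma dotr_norm_le (u v : V) : `|dotr u v| <= enorm u * enorm v.
Proof.
rewrite ler_norml dotr_le andbT lerNl -(enormN u) (le_trans _ (dotr_le _ _))//.
by rewrite /dotr -sumrN; apply: ler_sum => i _; rewrite mxE mulNr.
Qed.

Lemma integral_dotr_le Omega (w : V -> R) (u G : V -> V) (M N : R) : measurable Omega ->
  0 <= M -> 0 <= N -> measurable_fun Omega w -> (forall x, Omega x -> 0 < w x) ->
  measurable_fun Omega u -> measurable_fun Omega G ->
  {ae mu, forall x, Omega x -> enorm ((w x)^-1 *: u x) <= M} ->
  (forall x, enorm (G x) <= N) ->
  (`|\int[mu]_(x in Omega) (dotr (u x) (G x))%:E| <=
    (M * N)%:E * \int[mu]_(x in Omega) (w x)%:E)%E.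
Proof.
move=> mO M0 N0 mw w0 mu_ mG uM GN.
have md : measurable_fun Omega (fun x => (dotr (u x) (G x))%:E).
  apply/measurable_EFinP; rewrite /dotr; apply: measurable_sum => i.
  by apply: measurable_funM; apply: (measurableT_comp (measurable_rV_coord i)).
apply: (le_trans (le_abse_integral mu mO md)).
rewrite -ge0_integralZl//; last 3 first.
- exact/measurable_EFinP.
- by move=> x /w0/ltW.
- by rewrite lee_fin mulr_ge0.
apply: ae_ge0_le_integral => //.
- exact: measurableT_comp.
- by move=> x /w0/ltW wx; rewrite -EFinM lee_fin !mulr_ge0.
- by apply/measurable_EFinP; apply: measurable_funM.
move: uM; apply: filterS => x /[swap] Ox /(_ Ox) uMx; have wx := w0 x Ox.
rewrite -EFinM lee_fin (le_trans (dotr_norm_le _ _))// mulrAC ler_pM ?enorm_ge0//.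
by move: uMx; rewrite enormZ ger0_norm ?invr_ge0 ?(ltW wx)// ler_pdivrMl// mulrC.
Qed.

Lemma solvable_integrable_geodesic Omega x0 : open Omega -> bounded_set Omega -> Omega x0 ->
  div_infty_solvable Omega -> mu.-integrable Omega (fun y => geodesic_dist Omega y x0).
Proof.
move=> oO bO Ox0 [w [mw w0 iw [C [C0 solve]]]]; have mO := open_measurable_rV oO.
have fO := bounded_lebesgue_fin mO bO.
have [eps e0 eO] := open_ccube oO Ox0.
have cO : cube x0 eps `<=` Omega.
  by move=> x xe; apply: eO => k; have /andP[h1 h2] := xe k; rewrite !ltW.
pose rho := dens x0 eps; pose m := fine (mu Omega).
have m0 : 0 <= m by exact: fine_ge0.
have brho : bsupp Omega rho := bsuppS cO (bsupp_dens x0 e0).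
have rho0 x : 0 <= rho x by exact: dens_ge0.
(* The bump has mass 1 and [m] is the measure of [Omega], so the mean is zero. The pairing of [f]
   with the distance is the wanted integral up to a term living near [x0], where the distance is
   bounded. *)
pose f x := \1_Omega x - m * rho x.
have b1 : bsupp Omega (\1_Omega : V -> R) by exact: bsupp_indic.
have bf : bsupp Omega f := bsuppB b1 (bsuppZ m brho).
have [mf [Mf fM] _] := bf.
have cI := bcont_int mO fO.
have Mf0 : 0 <= Mf by rewrite (le_trans _ (fM x0)).
have Lf : (Linfty_norm Omega f < +oo)%E.
  by apply: (@le_lt_trans _ _ Mf%:E); [exact: Linfty_norm_le|exact: ltry].
have [||u [[mu_ udiv] uC]] := solve f.
- by split => //; exact: measurable_funS mf.
- rewrite (bsupp_integral mO fO bf) (bcontB cI b1 (bsuppZ m brho)) (bcontZ _ cI brho).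
  by rewrite int_dens// mulr1 /Rintegral integral_indic// setIT subrr.
have [M [M0 _ uM]] : exists M : R, [/\ 0 <= M,
    Linfty_norm Omega (fun x => enorm ((w x)^-1 *: u x)) = M%:E &
    {ae mu, forall x, Omega x -> `|enorm ((w x)^-1 *: u x)| <= M}].
  apply: Linfty_norm_ae; apply: (le_lt_trans uC).
  have [Lf' [_ -> _]] := Linfty_norm_ae Lf.
  by rewrite -EFinM ltry.
have {}uM : {ae mu, forall x, Omega x -> enorm ((w x)^-1 *: u x) <= M}.
  by move: uM; apply: filterS => x h /h; rewrite ger0_norm ?enorm_ge0.
have iwfin := integrable_fin_num mO iw.
pose W := fine (\int[mu]_(x in Omega) (w x)%:E).
(* The first term bounds the pairing of [u] with a gradient of norm at most [n]; the second bounds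
   [m] times the mean of the distance against [rho]. Neither depends on the truncation level. *)
pose B := M * n%:R * W + m * (n%:R * eps).
pose t k := truncated_dist Omega x0 k \_ Omega.
have bt k : bsupp Omega (t k).
  split; first by apply/(measurable_restrictT _ mO); exact: truncated_dist_measurable.
    exists k%:R => x; rewrite /t patchE; case: ifPn => _; last by rewrite normr0.
    by rewrite ger0_norm ?truncated_dist_ge0 ?truncated_dist_le.
  by move=> x Ox; rewrite /t patchE memNset.
have tL k : locally_lipschitz Omega (t k).
  move=> z r zO x y zx zy; rewrite /t !patchE !mem_set; [|exact: zO..].
  exact: (@truncated_dist_lipschitz Omega x0 k z r zO).
have t0 k x : 0 <= t k x.
  by rewrite /t patchE; case: ifPn => // _; exact: truncated_dist_ge0.
have tB k : \int[mu]_x t k x <= B.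
  have [G [GG Gn]] := locally_lipschitz_gradient oO fO (bt k) (tL k).
  have [mG _ _] := GG.
  have it : mu.-integrable Omega (EFin \o t k).
    by apply: integrableS (bsupp_integrable mO fO (bt k)).
  (* The truncation makes the function bounded, hence integrable; its gradient is bounded and [w] is
     integrable. The distance itself is not yet known to belong to [E]. *)
  have tE : in_E Omega w (t k) G.
    split => //; rewrite /E_norm; apply: lte_add_pinfty.
      by case/integrableP : it.
    apply: (@le_lt_trans _ _ (\int[mu]_(x in Omega) (n%:R%:E * (w x)%:E))%E).
      apply: ge0_le_integral => //.
      - by move=> x /w0/ltW wx; rewrite lee_fin mulr_ge0 ?enorm_ge0.
      - apply/measurable_EFinP; apply: measurable_funM => //; exact: measurable_enorm.
      - by apply/measurable_EFinP; apply: measurable_funM.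
      - by move=> x /w0/ltW wx; rewrite -EFinM lee_fin mulrC ler_wpM2r.
    rewrite integralZl// -(fineK iwfin) -EFinM ltry//.
  have := udiv _ _ tE => /(congr1 abse); rewrite abseN.
  have := integral_dotr_le mO M0 (ler0n R n) mw w0 mu_ mG uM Gn.
  move=> /[swap] ->.
  have bft : bsupp Omega (fun x => f x * t k x) by apply: bsuppM => //; exists Mf.
  rewrite (bsupp_integral mO fO bft) -(fineK iwfin) -EFinM /= lee_fin => ftW.
  have brt : bsupp Omega (fun x => t k x * rho x).
    by apply: bsuppM => //; have [? [L tLL] _] := bt k => //; exists L.
  have ftE : \int[mu]_x (f x * t k x) = \int[mu]_x t k x - m * \int[mu]_x (t k x * rho x).
    rewrite -(bcontZ _ cI brt) -(bcontB cI (bt k) (bsuppZ m brt)).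
    apply: eq_Rintegral => x _; rewrite /f indicE.
    have [_|/negP Ox] := boolP (x \in Omega); first by rewrite /=; ring.
    have [_ _ ->] := bt k; first by rewrite !mulr0 mul0r mulr0 subrr.
    by move=> Ox'; apply: Ox; rewrite inE.
  (* On the cube carrying [rho], the segment to [x0] is an admissible path of length at most
     [n * eps]. *)
  have rtle : \int[mu]_x (t k x * rho x) <= n%:R * eps.
    have -> : n%:R * eps = \int[mu]_x (n%:R * eps * rho x).
      by rewrite (bcontZ _ cI brho) int_dens// mulr1.
    apply: le_Rintegral => //.
    - exact: bsupp_integrable mO fO brt.
    - exact: bsupp_integrable mO fO (bsuppZ _ brho).
    move=> x _; have [xc|xc] := pselect (cube x0 eps x); last first.
      by have [_ _ r0] := bsupp_dens x0 e0; rewrite /rho r0// !mulr0.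
    rewrite ler_wpM2r// /t patchE mem_set; last exact: cO.
    have xcc : ccube x0 eps x by move=> i; have /andP[h1 h2] := xc i; rewrite !ltW.
    rewrite -lee_fin truncated_distE ge_min; apply/orP; left.
    apply: (le_trans (geodesic_dist_ccube x0 eO xcc (ccube_center x0 (ltW e0)))).
    rewrite geodesic_distxx// adde0 lee_fin (le_trans (enorm_le_norm _))// ler_wpM2l//.
    by rewrite distrC (ccube_norm (ltW e0)).
  have := le_trans (ler_norm _) ftW; rewrite ftE -/W /B => h.
  by rewrite (le_trans _ (lerD h (ler_wpM2l m0 rtle)))// subrK.
have md : measurable_fun Omega (fun y => geodesic_dist Omega y x0).
  apply: (@emeasurable_fun_cvg _ _ _ _ (fun k y => (truncated_dist Omega x0 k y)%:E)).
    by move=> k; apply/measurable_EFinP; exact: truncated_dist_measurable.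
  by move=> x _; exact: truncated_dist_cvg.
apply/integrableP; split => //.
under eq_integral do rewrite gee0_abs ?geodesic_dist_ge0//.
apply: (@le_lt_trans _ _ B%:E); last exact: ltry.
have := @cvg_monotone_convergence _ _ _ mu Omega mO
  (fun k y => (truncated_dist Omega x0 k y)%:E).
rewrite (_ : (fun x => limn _) = (fun y => geodesic_dist Omega y x0)); last first.
  by apply/funext => x; apply/cvg_lim => //; exact: truncated_dist_cvg.
move=> cvI.
apply: (cvge_le _ (cvI _ _ _)).
- apply: nearW => k; have := tB k; rewrite -lee_fin -(bsupp_integral mO fO (bt k)).
  apply: le_trans; rewrite le_eqVlt; apply/orP; left; apply/eqP.
  by apply: eq_integral => x xO; rewrite /t patchE xO.
- by move=> k; apply/measurable_EFinP; exact: truncated_dist_measurable.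
- by move=> k x _; rewrite lee_fin truncated_dist_ge0.
- by move=> x _; exact: truncated_dist_nd.
Qed.

End necessity.

Theorem theorem2p1 (R : realType) (n : nat) (hn : (2 <= n)%N)
  (Omega : set 'rV[R]_n) (hOmega : domain Omega) (hOmega0 : Omega !=set0)
  (hbounded : bounded_set Omega) (x0 : 'rV[R]_n) (hx0 : Omega x0) :
  div_infty_solvable Omega <->
  (lebesgue_rV n).-integrable Omega (fun y => geodesic_dist Omega y x0).
Proof.
have [oO _] := hOmega; split.
  exact: solvable_integrable_geodesic.
by apply: integrable_geodesic_solvable => //; exact: leq_trans hn.
Qed.
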